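(* For every fixed integer $k\ge 3$, the decision problem $k$-CombDMR is NP-complete.
   Context: For $n\in\mathbb N$ write $[n]=\{1,\dots,n\}$. A graph realisation of an $n\times n$ matrix $D$ with non-negative integer entries is a pair $(G,\Phi)$, where $G=(V,E)$ is a finite simple undirected unweighted graph and $\Phi:[n]\to V$ is an injective map such that $d_G(\Phi(i),\Phi(j))=D_{ij}$ for all $i,j\in[n]$; here $d_G$ denotes the shortest-path distance in $G$ (equal to $\infty$ if no path exists). For a fixed $k\in\mathbb N_0$, the problem $k$-CombDMR is: given an $n\times n$ matrix $D$ with non-negative integer entries, decide whether there exists a graph realisation $(G=(V,E),\Phi)$ of $D$ with $|V|\le n+k$. *)

(* Defs.v *)
From HB Require Import structures.
From mathcomp Require Import all_boot all_order all_algebra.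
From Stdlib Require Import BinNat BinPos.
Set Implicit Arguments. Unset Strict Implicit. Unset Printing Implicit Defensive.

Definition simple_graph (V : finType) (e : rel V) : Prop :=
  symmetric e /\ irreflexive e.

Definition walk_of_len (V : finType) (e : rel V) (u v : V) (k : nat) : Prop :=
  exists p : seq V, [/\ size p = k, path e u p & last u p = v].

Definition is_dist (V : finType) (e : rel V) (u v : V) (k : nat) : Prop :=
  walk_of_len e u v k /\ forall m, m < k -> ~ walk_of_len e u v m.

Definition realisation (n : nat) (D : 'M[nat]_n) (V : finType) (e : rel V)
  (Phi : 'I_n -> V) : Prop :=
  [/\ simple_graph e, injective Phi &
      forall i j : 'I_n, is_dist e (Phi i) (Phi j) (D i j)].

Definition comb_realisable (k n : nat) (D : 'M[nat]_n) : Prop :=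
  exists (V : finType) (e : rel V) (Phi : 'I_n -> V),
    realisation D e Phi /\ #|V| <= n + k.

Fixpoint pos_bits (p : positive) : seq bool :=
  match p with
  | xH => [:: true]
  | xO q => false :: pos_bits q
  | xI q => true :: pos_bits q
  end.

Definition nat_bits (m : nat) : seq bool :=
  match N.of_nat m with N0 => [::] | Npos p => pos_bits p end.

Definition double_bits (s : seq bool) : seq bool :=
  flatten [seq [:: b; b] | b <- s].

(* self-delimiting encoding of a list of naturals *)
Definition enc_nats (s : seq nat) : seq bool :=
  flatten [seq double_bits (nat_bits m) ++ [:: false; true] | m <- s].

Definition enc_matrix (n : nat) (D : 'M[nat]_n) : seq bool :=
  enc_nats (n :: [seq D i j | i <- enum 'I_n, j <- enum 'I_n]).

Definition language := seq bool -> Prop.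

Definition CombDMR (k : nat) : language :=
  fun x => exists (n : nat) (D : 'M[nat]_n), x = enc_matrix D /\ comb_realisable k D.

(* Deterministic single-tape Turing machines (two-way infinite tape)    *)
(* Tape symbols 'I_3 : 0 = blank, 1 = bit false, 2 = bit true.
   States 'I_(tm_n.+3) : 0 = start, 1 = accept, 2 = reject (halting).
   Transition returns (new state, written symbol, move right?). *)
Record TM := { tm_n : nat;
               tm_delta : 'I_tm_n.+3 -> 'I_3 -> 'I_tm_n.+3 * 'I_3 * bool }.

Definition blank : 'I_3 := @Ordinal 3 0 isT.
Definition sym_of_bit (b : bool) : 'I_3 :=
  if b then @Ordinal 3 2 isT else @Ordinal 3 1 isT.

(* configuration: state, left part (nearest cell first), head cell and right part *)
Definition config (M : TM) := ('I_(tm_n M).+3 * seq 'I_3 * seq 'I_3)%type.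

Definition halting (M : TM) (q : 'I_(tm_n M).+3) : bool := (val q == 1) || (val q == 2).

Definition step (M : TM) (c : config M) : config M :=
  let: (q, l, r) := c in
  if halting q then c else
  let: (q', a', mv) := tm_delta q (head blank r) in
  if mv then (q', a' :: l, behead r)
  else (q', behead l, head blank l :: a' :: behead r).

Definition init (M : TM) (x : seq bool) : config M :=
  (@Ordinal (tm_n M).+3 0 isT, [::], map sym_of_bit x).

Definition run (M : TM) (t : nat) (x : seq bool) : config M := iter t (@step M) (init M x).

Definition cstate (M : TM) (c : config M) : 'I_(tm_n M).+3 := c.1.1.

(* output: the maximal bit string starting at the head, up to the first blank *)
Fixpoint out_bits (r : seq 'I_3) : seq bool :=
  match r with
  | [::] => [::]
  | a :: r' => if val a == 0 then [::] else (val a == 2) :: out_bits r'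
  end.

Definition poly (c d m : nat) : nat := c * m ^ d + c.

Definition decides_poly (M : TM) (L : language) : Prop :=
  exists c d, forall x, let cf := run M (poly c d (size x)) x in
    halting (cstate cf) /\ (val (cstate cf) = 1 <-> L x).

Definition inP (L : language) : Prop := exists M, decides_poly M L.

Definition FP (f : seq bool -> seq bool) : Prop :=
  exists M c d, forall x, let cf := run M (poly c d (size x)) x in
    halting (cstate cf) /\ out_bits cf.2 = f x.

Definition pair_words (x y : seq bool) : seq bool :=
  double_bits x ++ [:: false; true] ++ y.

Definition inNP (L : language) : Prop :=
  exists V : language, inP V /\ exists c d, forall x,
    L x <-> exists y, size y <= poly c d (size x) /\ V (pair_words x y).

Definition NP_hard (L : language) : Prop :=
  forall L' : language, inNP L' ->
    exists f, FP f /\ forall x, L' x <-> L (f x).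

Definition NP_complete (L : language) : Prop := inNP L /\ NP_hard L.

(* Main.v *)
From HB Require Import structures.
Require Import Defs.
From mathcomp Require Import all_boot all_order all_algebra zify.
From Stdlib Require BinNat Nnat.
Set Implicit Arguments. Unset Strict Implicit. Unset Printing Implicit Defensive.
Import Defs.

(* Membership: the certificate lists the adjacency bits of a graph on exactly [n + k] vertices, since
   isolated vertices may be added to a realisation; the distances are computed by growing balls and the resulting
   matrix is encoded and compared with the input.

   Hardness: the tableau of the verifier's computation is described by clauses saying which cell
   symbols are forced; they are Horn clauses except those that guess the certificate, so no clause
   needs to exclude a second symbol in a cell.  The clauses become a [k]-colouring instance.  For a
   graph on [vs], the distance matrix has a root at distance 2 from every [v] and at distance 1 from
   nothing, so each [v] shares a neighbour with the root that has to be one of the [k] additional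
   vertices; adjacent vertices are at distance 3 and thus cannot use the same one: this is a
   colouring.  Labelled pair vertices, forming a clique, realise all remaining distances.

   Polynomial time: a single-tape machine simulates a queue automaton, which simulates a structured
   program over four stacks, one instruction per rotation of the queue.  Trees in prefix code on the
   stacks then give a class of functions closed under composition, pairing, case analysis and
   size-bounded folds, in which both algorithms are expressed. *)

(** * Polynomial bounds *)

(** The bound $k\ge3$ comes from the clause gadget, an odd cycle: confined to three colours and kept
    off one of them at every vertex, it would need a proper 2-colouring. It has length 5 because a
    local rule of the tableau has three premises and one conclusion, hence four literals, and the
    fifth vertex is kept off colour 0 outright. Several symbols may hold in one cell of a satisfying
    assignment; this is harmless, since induction over the rows shows that the symbols of a genuine
    run are among them, that run halts within the clock, and a rejecting state may hold nowhere.
    Conversely a genuine accepting run satisfies every clause. On the machine side the obstacle is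
    that one head cannot serve several stacks: in a queue every bit passes the head in turn, so
    appending is the only operation that needs a walk. Prefix codes delimit themselves, so a program
    finds the end of the top value and leaves what lies below untouched. Folds need an explicit size
    bound because a polynomial-time step may double its accumulator at every turn. *)

(* Base [s x + 2] absorbs constants into the exponent. *)
Definition pb (T : Type) (s f : T -> nat) : Prop :=
  exists d, forall x, f x <= (s x + 2) ^ d.

Section PolyBounds.
Variables (T : Type) (s : T -> nat).

Lemma pb_le f g : (forall x, f x <= g x) -> pb s g -> pb s f.
Proof. by move=> fg [d H]; exists d => x; apply: leq_trans (fg x) (H x). Qed.

Lemma pb_const c : pb s (fun=> c).
Proof.
exists c => x; apply: leq_trans (ltnW (ltn_expl c (ltnSn 1))) _.
by case: c => [|c]; rewrite ?expn0 // leq_exp2r // leq_addl.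
Qed.

Lemma pb_id : pb s s.
Proof. by exists 1 => x; rewrite expn1 leq_addr. Qed.

Lemma pb_mul f g : pb s f -> pb s g -> pb s (fun x => f x * g x).
Proof. by move=> [d Hf] [e Hg]; exists (d + e) => x; rewrite expnD leq_mul. Qed.

Lemma pb_add f g : pb s f -> pb s g -> pb s (fun x => f x + g x).
Proof.
move=> [d Hf] [e Hg]; exists (d + e).+1 => x.
have p1 n : 0 < (s x + 2) ^ n by rewrite expn_gt0 addn2.
rewrite expnSr expnD; move: (Hf x) (Hg x) (p1 d) (p1 e).
move: (_ ^ d) (_ ^ e) => a b; nia.
Qed.

Lemma pb_comp (U : Type) (s' h : U -> nat) (g : T -> U) :
  pb s' h -> pb s (fun x => s' (g x)) -> pb s (fun x => h (g x)).
Proof.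
(* With [a = (s x + 2) ^ e], the new base is at most [a + 2 <= 3 * a], and two further factors
   [s x + 2] absorb the 3. *)
move=> [d Hh] [e Hg]; exists ((e + 2) * d) => x; apply: leq_trans (Hh _) _.
rewrite expnM; have [->|d0] := posnP d; first by rewrite !expn0.
rewrite leq_exp2r // expnD; apply: (@leq_trans ((s x + 2) ^ e + 2)).
  by rewrite leq_add2r.
have : 0 < (s x + 2) ^ e by rewrite expn_gt0 addn2.
move: (_ ^ e) => a; rewrite expnS expn1; nia.
Qed.

Lemma pb_exp f n : pb s f -> pb s (fun x => f x ^ n).
Proof.
move=> Hf; elim: n => [|n IH]; first exact: pb_le (pb_const 1).
by apply: pb_le (pb_mul Hf IH) => x; rewrite expnS.
Qed.

Lemma pb_leq_poly f : pb s f -> exists c d, forall x, f x <= poly c d (s x).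
Proof.
(* For size [n + 1] the base [n + 3] is at most [3 * (n + 1)]; for size 0 the additive constant of
   [poly] suffices. *)
move=> [d H]; exists (3 ^ d), d => x; apply: leq_trans (H x) _.
rewrite /poly; case: (s x) => [|n].
  by apply: leq_trans (leq_addl _ _); have [->//|d0] := posnP d; rewrite leq_exp2r.
apply: leq_trans (leq_addr _ _); rewrite -expnMn.
by have [->//|d0] := posnP d; rewrite leq_exp2r //; lia.
Qed.

End PolyBounds.

Lemma leq_poly c d : {homo poly c d : m n / m <= n}.
Proof.
move=> m n mn; rewrite /poly leq_add2r leq_mul2l; apply/orP; right.
by have [->//|d0] := posnP d; rewrite leq_exp2r.
Qed.

(** * Turing machines over an arbitrary finite state type *)

Section FinTM.
Variables (S : finType) (s0 : S) (dl : S -> 'I_3 -> (S + bool) * 'I_3 * bool).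

Definition gconf : Type := ((S + bool) * seq 'I_3 * seq 'I_3)%type.

Definition gstep (c : gconf) : gconf :=
  let: (q, l, r) := c in
  match q with
  | inr _ => c
  | inl s =>
    let: (q', a', mv) := dl s (head blank r) in
    if mv then (q', a' :: l, behead r)
    else (q', behead l, head blank l :: a' :: behead r)
  end.

Definition st_enc (q : S + bool) : 'I_(#|S|).+3 :=
  match q with
  | inl s => inord (enum_rank s).+3
  | inr b => inord (if b then 1 else 2)
  end.

(** A run must start in state 0, which [st_enc] never produces, so [s0] has two codes: 0 and its
    rank plus three. This is why [tm_sim] compares decoded states. *)
Definition st_dec (i : 'I_(#|S|).+3) : S :=
  if val i == 0 then s0 else nth s0 (enum S) (i - 3).

Definition fin_tm : TM :=
  {| tm_n := #|S|;
     tm_delta := fun i a => let: (q, a', mv) := dl (st_dec i) a in (st_enc q, a', mv) |}.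

Definition tm_sim (c : config fin_tm) (g : gconf) : Prop :=
  [/\ c.1.2 = g.1.2, c.2 = g.2 &
      match g.1.1 with
      | inl s => ~~ halting c.1.1 /\ st_dec c.1.1 = s
      | inr b => val c.1.1 = if b then 1 else 2
      end].

Lemma st_decK s : st_dec (st_enc (inl s)) = s /\ ~~ @halting fin_tm (st_enc (inl s)).
Proof.
have lt : (enum_rank s).+3 < #|S|.+3 by rewrite !ltnS.
split; first by rewrite /st_dec /= inordK // !subSS subn0 nth_enum_rank.
by rewrite /halting /= inordK.
Qed.

Lemma tm_sim_step c g : tm_sim c g -> tm_sim (step c) (gstep g).
Proof.
case: c => [[q l] r]; case: g => [[qg lg] rg] [/= <- <-] {lg rg}.
case: qg => [s [hq dq]|b qb] /=; last first.
  have -> // : halting q by move/eqP: qb; rewrite /halting; case: b => H;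
    apply/orP; [left | right]; exact: H.
rewrite (negPf hq) dq.
case: (dl s (head blank r)) => [[q' a'] mv].
by case: mv; split=> //=; case: q' => [s'|b] //=;
  rewrite ?inordK; case: b || (split; case: (st_decK s')).
Qed.

Lemma tm_sim_iter n c g : tm_sim c g -> tm_sim (iter n (@step _) c) (iter n gstep g).
Proof. by move=> H; elim: n => //= n; exact: tm_sim_step. Qed.

Lemma tm_sim_init x : tm_sim (init fin_tm x) (inl s0, [::], map sym_of_bit x).
Proof. by []. Qed.

Lemma gstep_halted n (g : gconf) b : g.1.1 = inr b -> iter n gstep g = g.
Proof. by case: g => [[q l] r] /= ->; elim: n => //= n ->. Qed.

(** A halted configuration no longer changes, so the exact halting time may be replaced by any later
    one, in particular by a polynomial clock. *)
Lemma fin_tm_run x n m b l r :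
  iter n gstep (inl s0, [::], map sym_of_bit x) = (inr b, l, r) -> n <= m ->
  let cf := run fin_tm m x in
  [/\ halting (cstate cf), cf.2 = r & (val (cstate cf) = 1 <-> b)].
Proof.
move=> H nm cf; have := tm_sim_iter m (tm_sim_init x).
rewrite -/(run fin_tm m x) -/cf -(subnK nm) iterD H (@gstep_halted _ _ b) //.
case: cf => [[q l'] r'] [/= _ -> E]; rewrite /halting /cstate /= E.
by split; case: b {H} E.
Qed.

End FinTM.

(** * Queue automata *)

Variant qop (Q : Type) := QPop of (bool -> Q) | QApp of bool & Q | QEnd of bool.
Arguments QEnd {Q}.

Inductive qreach (Q : Type) (op : Q -> qop Q) : nat -> Q * seq bool -> Q * seq bool -> Prop :=
| qr_refl c : qreach op 0 c c
| qr_pop q k b w c n : op q = QPop k -> qreach op n (k b, w) c -> qreach op n.+1 (q, b :: w) c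
| qr_app q b q' w c n : op q = QApp b q' -> qreach op n (q', rcons w b) c -> qreach op n.+1 (q, w) c.

Lemma qr_trans Q (op : Q -> qop Q) n m c1 c2 c3 :
  qreach op n c1 c2 -> qreach op m c2 c3 -> qreach op (n + m) c1 c3.
Proof.
elim=> [//|q k b w c n' E _ IH /IH|q b q' w c n' E _ IH /IH];
  rewrite addSn; [exact: qr_pop | exact: qr_app].
Qed.

(* The input [x] is first rewritten into the word [1 b1 1 b2 ...]. *)
Definition mark_bits (x : seq bool) : seq bool := flatten [seq [:: true; b] | b <- x].

(** [L0] to [L5] load the input: [L1] and [L2] carry a bit right over the unread input and the
    marked word, [L3] writes it, [L4] and [L5] walk back. [TR] stands at the front of the queue,
    [TG] walks to its end to append, [TB] returns, [Z] halts. *)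
Variant tst (Q : Type) :=
  L0 | L1 of bool | L2 of bool | L3 of bool | L4 | L5 | Z of bool
| TR of Q | TG of bool & Q | TB of Q.
Arguments L0 {Q}. Arguments L1 {Q}. Arguments L2 {Q}. Arguments L3 {Q}.
Arguments L4 {Q}. Arguments L5 {Q}. Arguments Z {Q}.

Section TstFin.
Variable Q : Type.

Definition tst_pack (s : tst Q) : 'I_10 * bool * option Q :=
  match s with
  | L0 => (@Ordinal 10 0 isT, false, None)
  | L1 b => (@Ordinal 10 1 isT, b, None)
  | L2 b => (@Ordinal 10 2 isT, b, None)
  | L3 b => (@Ordinal 10 3 isT, b, None)
  | L4 => (@Ordinal 10 4 isT, false, None)
  | L5 => (@Ordinal 10 5 isT, false, None)
  | Z b => (@Ordinal 10 6 isT, b, None)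
  | TR q => (@Ordinal 10 7 isT, false, Some q)
  | TG b q => (@Ordinal 10 8 isT, b, Some q)
  | TB q => (@Ordinal 10 9 isT, false, Some q)
  end.

Definition tst_unpack (c : 'I_10 * bool * option Q) : tst Q :=
  let: (i, b, o) := c in
  match val i, o with
  | 1, _ => L1 b
  | 2, _ => L2 b
  | 3, _ => L3 b
  | 4, _ => L4
  | 5, _ => L5
  | 6, _ => Z b
  | 7, Some q => TR q
  | 8, Some q => TG b q
  | 9, Some q => TB q
  | _, _ => L0
  end.

Lemma tst_packK : cancel tst_pack tst_unpack.
Proof. by case. Qed.

End TstFin.

HB.instance Definition _ (Q : finType) := Finite.copy (tst Q) (can_type (@tst_packK Q)).

Section QueueTM.
Variables (Q : finType) (op : Q -> qop Q) (q0 : Q).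

(* Tape during loading: the unread input, a blank, the marked word.
   Tape afterwards: the queue, starting at the head; a step that appends walks to its end and back. *)
Definition qdl (s : tst Q) (a : 'I_3) : (tst Q + bool) * 'I_3 * bool :=
  let nb := val a != 0 in
  match s with
  | L0 => if nb then (inl (L1 (val a == 2)), blank, true) else (inl (TR q0), blank, true)
  | L1 b => if nb then (inl (L1 b), a, true) else (inl (L2 b), a, true)
  | L2 b => if nb then (inl (L2 b), a, true) else (inl (L3 b), sym_of_bit true, true)
  | L3 b => (inl L4, sym_of_bit b, false)
  | L4 => if nb then (inl L4, a, false) else (inl L5, a, false)
  | L5 => if nb then (inl L5, a, false) else (inl L0, a, true)
  | TR q =>
    match op q with
    | QPop k => (inl (TR (k (val a == 2))), blank, true)
    | QApp b q' => if nb then (inl (TG b q'), a, true) else (inl (TB q'), sym_of_bit b, false)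
    | QEnd b => (inl (Z b), a, false)
    end
  | TG b q => if nb then (inl (TG b q), a, true) else (inl (TB q), sym_of_bit b, false)
  | TB q => if nb then (inl (TB q), a, false) else (inl (TR q), a, true)
  | Z b => (inr b, a, true)
  end.

Local Notation sym := (map sym_of_bit).
Local Notation gs := (gstep qdl).

Lemma sym_nb b : val (sym_of_bit b) != 0. Proof. by case: b. Qed.
Lemma sym_bit b : (val (sym_of_bit b) == 2) = b. Proof. by case: b. Qed.

Lemma head_nblank n : head blank (nseq n blank) = blank. Proof. by case: n. Qed.
Lemma behead_nblank n : behead (nseq n blank) = nseq n.-1 blank. Proof. by case: n. Qed.

Lemma go_right s : (forall a, val a != 0 -> qdl s a = (inl s, a, true)) ->
  forall w l r, iter (size w) gs (inl s, l, sym w ++ r) = (inl s, rev (sym w) ++ l, r).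
Proof.
move=> H; elim=> [//|b w IH] l r; rewrite [size _]/= iterSr /=.
by rewrite H ?sym_nb // IH rev_cons cat_rcons.
Qed.

Lemma go_left s : (forall a, val a != 0 -> qdl s a = (inl s, a, false)) ->
  forall w b l r, iter (size w).+1 gs (inl s, sym w ++ l, sym_of_bit b :: r) =
    (inl s, behead l, head blank l :: rev (sym w) ++ sym_of_bit b :: r).
Proof.
move=> H; elim=> [|c w IH] b l r; first by rewrite /= H ?sym_nb.
rewrite [size _]/= iterSr; set g := gs _.
have -> : g = (inl s, sym w ++ l, sym_of_bit c :: sym_of_bit b :: r).
  by rewrite /g /= H ?sym_nb.
by rewrite IH rev_cons cat_rcons.
Qed.

(** The explicit blanks are left by popped cells and by walks past the ends of the queue; their
    number is irrelevant. *)
Definition qtape (s : tst Q) (w : seq bool) (g : gconf (tst Q)) : Prop :=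
  exists n m, g = (inl s, nseq n blank, sym w ++ nseq m blank).

(** Stated for any [s] that reacts like [TG b q], because the first move of an append is made in
    state [TR]. *)
Lemma append_sim s b q w g :
  (forall a, val a != 0 -> qdl s a = (inl (TG b q), a, true)) ->
  qdl s blank = (inl (TB q), sym_of_bit b, false) ->
  qtape s w g -> exists2 t, t <= 2 * size w + 4 & qtape (TR q) (rcons w b) (iter t gs g).
Proof.
move=> Hnb Hbl [n [m ->]].
have E : iter (size w) gs (inl s, nseq n blank, sym w ++ nseq m blank) =
   (inl (if w is [::] then s else TG b q), rev (sym w) ++ nseq n blank, nseq m blank).
  case: w => [//|c w]; rewrite [size _]/= iterSr.
  set g1 := gs _.
  have -> : g1 = (inl (TG b q), sym_of_bit c :: nseq n blank, sym w ++ nseq m blank).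
    by rewrite /g1 /= Hnb ?sym_nb.
  rewrite go_right; first by rewrite rev_cons cat_rcons.
  by move=> a na /=; rewrite na.
have E2 : gs (inl (if w is [::] then s else TG b q), rev (sym w) ++ nseq n blank, nseq m blank) =
  (inl (TB q), behead (rev (sym w) ++ nseq n blank),
    head blank (rev (sym w) ++ nseq n blank) :: sym_of_bit b :: nseq m.-1 blank).
  have -> : forall s' : tst Q, qdl s' blank = (inl (TB q), sym_of_bit b, false) ->
     forall l, gs (inl s', l, nseq m blank) =
      (inl (TB q), behead l, head blank l :: sym_of_bit b :: nseq m.-1 blank) => //.
    by move=> s' Hs' l; rewrite /= head_nblank Hs' behead_nblank.
  by case: (w).
have [->|[w' [c Ew]]] : w = [::] \/ exists w' c, w = rcons w' c.
  by case/lastP: (w) => [|w' c]; [left | right; exists w', c].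
  exists 2 => //.
  exists n.-1.+1, m.-1; rewrite [iter 2 _ _](_ : _ = gs (gs (inl s, nseq n blank, nseq m blank))) //.
  have -> : gs (inl s, nseq n blank, nseq m blank) =
      (inl (TB q), nseq n.-1 blank, blank :: sym_of_bit b :: nseq m.-1 blank).
    by rewrite /= head_nblank Hbl !behead_nblank head_nblank.
  by [].
exists (1 + ((size w').+1 + (1 + size w))).
  by rewrite Ew size_rcons; lia.
rewrite iterD [iter ((size w').+1 + _) _ _]iterD [iter (1 + size w) _ _]iterD E.
rewrite [iter 1 gs (inl (if _ is [::] then _ else _), _, _)]E2 Ew.
rewrite map_rcons rev_rcons cat_cons [behead _]/= [head _ _]/= -map_rev.
rewrite -{1}(size_rev w') go_left => [|a na] /=; last by rewrite na.
rewrite head_nblank behead_nblank /=.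
exists n.-1.+1, m.-1.
by rewrite -map_rev revK !map_rcons -!cats1 -!catA.
Qed.

(** During [N] steps the queue is never longer than at the start plus [N], and an append costs one
    walk over it and back. *)
Lemma qtape_reach N c c' g :
  qreach op N c c' -> qtape (TR c.1) c.2 g ->
  exists2 t, t <= N * (2 * (size c.2 + N) + 4) & qtape (TR c'.1) c'.2 (iter t gs g).
Proof.
move=> H; elim: H g => {N c c'} [c|q k b w c n E _ IH|q b q' w c n E _ IH] g Hg.
- by exists 0.
- have [n0 [m0 Eg]] := Hg.
  case: (IH (gs g)) => [|t lt_t Ht]; last by exists t.+1; [move: lt_t => /=; nia | rewrite iterSr].
  by exists n0.+1, m0; rewrite Eg /= E sym_bit.
- have [t lt_t Ht] : exists2 t, t <= 2 * size w + 4 & qtape (TR q') (rcons w b) (iter t gs g).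
    by apply: append_sim Hg => [a na|] /=; rewrite E ?na.
  case: (IH _ Ht) => t' lt_t' Ht'; exists (t' + t); last by rewrite iterD.
  by move: lt_t lt_t'; rewrite /= size_rcons; nia.
Qed.

(** Every step has to move the head; [Z] undoes the left move made on [QEnd], so that the output
    begins under the head. *)
Lemma qtape_end q w g b : op q = QEnd b -> qtape (TR q) w g ->
  exists l m, iter 2 gs g = (inr b, l, sym w ++ nseq m blank).
Proof.
move=> E [n [m ->]] /=; rewrite E /=.
exists (head blank (nseq n blank) :: behead (nseq n blank)).
case: w => [|c w] /=; last by exists m; rewrite head_nblank.
by exists m.-1.+1; rewrite !head_nblank !behead_nblank.
Qed.

(** One round of loading. [T] is the separating blank followed by the marked word; it is described
    through [head] and [behead] because before the first round it may be the empty list. *)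
Lemma qload_bit n b x w r T m :
  r = sym (b :: x) ++ T -> head blank T = blank -> behead T = sym w ++ nseq m blank ->
  exists2 t, t <= 2 * size x + 2 * size w + 10 &
  exists n' m', iter t gs (inl L0, nseq n blank, r) =
    (inl L0, nseq n' blank, sym x ++ blank :: sym (w ++ [:: true; b]) ++ nseq m' blank).
Proof.
move=> -> hT bT.
pose g1 := (inl (L1 b) : tst Q + bool, nseq n.+1 blank, sym x ++ T).
have S1 : gs (inl L0, nseq n blank, sym (b :: x) ++ T) = g1.
  by rewrite /= sym_nb sym_bit.
pose l2 := blank :: rev (sym x) ++ nseq n.+1 blank.
have S2 : iter (size x).+1 gs g1 = (inl (L2 b), l2, sym w ++ nseq m blank).
  rewrite iterS go_right; last by move=> a /= ->.
  by rewrite /= hT /= bT.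
have S3 : iter (size w).+2 gs (inl (L2 b), l2, sym w ++ nseq m blank) =
    (inl L4, rev (sym w) ++ l2, sym_of_bit true :: sym_of_bit b :: nseq m.-2 blank).
  rewrite !iterS go_right; last by move=> a /= ->.
  rewrite [X in gs X](_ : _ = (inl (L3 b), sym_of_bit true :: rev (sym w) ++ l2, nseq m.-1 blank)).
    by rewrite /= behead_nblank.
  by rewrite /= head_nblank /= behead_nblank.
pose w' := w ++ [:: true; b].
have S4 : iter (size w).+1 gs
    (inl L4, rev (sym w) ++ l2, sym_of_bit true :: sym_of_bit b :: nseq m.-2 blank) =
    (inl L4, behead l2, blank :: sym w' ++ nseq m.-2 blank).
  rewrite -map_rev -(size_rev w) go_left; last by move=> a /= ->.
  by rewrite -map_rev revK /w' map_cat -catA.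
have S5 : exists n', iter (size x).+2 gs (inl L4, behead l2, blank :: sym w' ++ nseq m.-2 blank) =
    (inl L0, nseq n' blank, sym x ++ blank :: sym w' ++ nseq m.-2 blank).
  exists n.+1; rewrite /l2 [behead _]/=.
  case/lastP: x {g1 S1 l2 S2 S3 S4} => [|x c]; first by [].
  rewrite size_rcons map_rcons rev_rcons cat_cons [iter _ _ _]iterSr.
  set g := gs (inl L4, _, _).
  have -> : g = (inl L5, rev (sym x) ++ nseq n.+1 blank,
                 sym_of_bit c :: blank :: sym w' ++ nseq m.-2 blank) by [].
  rewrite -map_rev -(size_rev x) iterS go_left; last by move=> a /= ->.
  by rewrite -map_rev revK /= cat_rcons.
case: S5 => n' S5.
exists ((size x).+2 + ((size w).+1 + ((size w).+2 + ((size x).+1 + 1)))); first lia.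
exists n', m.-2; rewrite iterD [iter (_ + (_ + (_ + _))) _ _]iterD.
rewrite [iter (_ + (_ + _)) _ _]iterD [iter (_ + 1) _ _]iterD.
by rewrite [iter 1 _ _]S1 S2 S3 S4 S5.
Qed.

Lemma qload_aux x n w r T m :
  r = sym x ++ T -> head blank T = blank -> behead T = sym w ++ nseq m blank ->
  exists2 t, t <= size x * (6 * size x + 2 * size w + 10) + 1 &
    qtape (TR q0) (w ++ mark_bits x) (iter t gs (inl L0, nseq n blank, r)).
Proof.
elim: x n w r T m => [|b x IH] n w r T m Er hT bT.
  exists 1 => //; exists n.+1, m.
  by rewrite Er [sym [::] ++ T]/= [iter 1 _ _]/= hT /= bT cats0.
have [t lt_t [n' [m' E]]] := qload_bit n Er hT bT.
have [||t' lt_t' Ht] := IH n' (w ++ [:: true; b]) _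
  (blank :: sym (w ++ [:: true; b]) ++ nseq m' blank) m' erefl; rewrite ?map_cat //.
exists (t' + t); last by rewrite iterD E; move: Ht; rewrite -catA.
by move: lt_t lt_t'; rewrite size_cat /=; nia.
Qed.

Lemma qload x : exists2 t, t <= size x * (6 * size x + 10) + 1 &
  qtape (TR q0) (mark_bits x) (iter t gs (inl L0, [::], sym x)).
Proof.
have [|||t lt_t Ht] := @qload_aux x 0 [::] (sym x) [::] 0; rewrite ?cats0 //.
by exists t => //; move: lt_t; rewrite muln0 addn0.
Qed.

End QueueTM.

Lemma out_bits_sym w m : out_bits (map sym_of_bit w ++ nseq m blank) = w.
Proof. by elim: w => [|[] w /= ->] //; case: m. Qed.

Theorem qreach_tm (Q : finType) (op : Q -> qop Q) (q0 : Q)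
    (f : seq bool -> seq bool) (g : seq bool -> bool) (T : seq bool -> nat) :
  pb size T ->
  (forall x, exists n q, [/\ n <= T x, qreach op n (q0, mark_bits x) (q, f x) & op q = QEnd (g x)]) ->
  exists M c d, forall x, let cf := run M (poly c d (size x)) x in
    [/\ halting (cstate cf), out_bits cf.2 = f x & (val (cstate cf) = 1 <-> g x)].
Proof.
move=> pT H.
(* Loading, then [T x] queue steps on a word of length at most [2 * size x + T x] (marking doubles
   the input), then the two halting steps. *)
pose B x := size x * (6 * size x + 10) + 1 + T x * (2 * (2 * size x + T x) + 4) + 2.
have [c [d Bcd]] : exists c d, forall x, B x <= poly c d (size x).
  apply: (pb_leq_poly (s := size)); rewrite /B.
  by do ![apply: pT | apply: pb_id | apply: pb_const | apply: pb_add | apply: pb_mul].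
exists (fin_tm L0 (qdl op q0)), c, d => x.
have [n [q [nT R E]]] := H x.
have [t1 lt1 H1] := qload op q0 x.
have [t2 lt2 H2] := qtape_reach q0 R H1.
have [l [m H3]] := qtape_end q0 E H2.
have [||h o v] := @fin_tm_run _ L0 (qdl op q0) x (2 + (t2 + t1)) (poly c d (size x)) (g x) l
  (map sym_of_bit (f x) ++ nseq m blank).
- by rewrite iterD [iter (t2 + t1) _ _]iterD.
- apply: leq_trans (Bcd x); rewrite /B.
  have sm : size (mark_bits x) = 2 * size x by elim: (x) => //= b y; rewrite /mark_bits /=; lia.
  move: lt2; rewrite /= sm.
  have : n * (2 * (2 * size x + n) + 4) <= T x * (2 * (2 * size x + T x) + 4).
    by apply: leq_mul => //; lia.
  by move: (n * _) (T x * _) => u v; lia.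
- by split=> //; rewrite o out_bits_sym.
Qed.

(** * Programs over four bit stacks *)

Variant stk := sA | sB | sC | sD.

Definition stacks : Type := (seq bool * seq bool * seq bool * seq bool)%type.

Definition get (s : stk) (st : stacks) : seq bool :=
  let: (a, b, c, d) := st in
  match s with sA => a | sB => b | sC => c | sD => d end.

Definition upd (s : stk) (w : seq bool) (st : stacks) : stacks :=
  let: (a, b, c, d) := st in
  match s with sA => (w, b, c, d) | sB => (a, w, c, d) | sC => (a, b, w, d) | sD => (a, b, c, w) end.

Definition ssize (st : stacks) : nat :=
  let: (a, b, c, d) := st in size a + size b + size c + size d.

Variant instr := IPush of stk & bool & nat | IPop of stk & nat & nat & nat | IJmp of nat.

Definition astep (C : seq instr) (c : nat * stacks) : nat * stacks :=
  let: (pc, st) := c in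
  if pc < size C then
    match nth (IJmp 0) C pc with
    | IPush s b n => (n, upd s (b :: get s st) st)
    | IPop s n0 n1 nE =>
      match get s st with
      | [::] => (nE, st)
      | b :: w => (if b then n1 else n0, upd s w st)
      end
    | IJmp n => (n, st)
    end
  else c.

(** Tests consume the bit they inspect, and [While] goes on exactly after a [true]. A stack of
    marked bits closed by [false], or the code of a list, can therefore drive a loop without a
    counter. *)
Inductive cmd :=
| Skip
| Push of stk & bool
| Case of stk & cmd & cmd & cmd
| Seq of cmd & cmd
| While of stk & cmd.

(* The number is an upper bound for the running time of the compiled program. *)
Inductive exec : cmd -> stacks -> nat -> stacks -> Prop :=
| ex_skip st : exec Skip st 0 st
| ex_push s b st : exec (Push s b) st 1 (upd s (b :: get s st) st)
| ex_caseE s c0 c1 cE st st' t : get s st = [::] -> exec cE st t st' ->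
    exec (Case s c0 c1 cE) st t.+2 st'
| ex_case s c0 c1 cE (b : bool) w st st' t : get s st = b :: w ->
    exec (if b then c1 else c0) (upd s w st) t st' -> exec (Case s c0 c1 cE) st t.+2 st'
| ex_seq c1 c2 st1 st2 st3 t1 t2 : exec c1 st1 t1 st2 -> exec c2 st2 t2 st3 ->
    exec (Seq c1 c2) st1 (t1 + t2) st3
| ex_whileE s c st : get s st = [::] -> exec (While s c) st 1 st
| ex_while0 s c st w : get s st = false :: w -> exec (While s c) st 1 (upd s w st)
| ex_while1 s c st w st1 st2 t1 t2 : get s st = true :: w ->
    exec c (upd s w st) t1 st1 -> exec (While s c) st1 t2 st2 ->
    exec (While s c) st (t1 + t2).+2 st2
| ex_weak c st t t' st' : exec c st t st' -> t <= t' -> exec c st t' st'.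

Fixpoint clen (c : cmd) : nat :=
  match c with
  | Skip => 0
  | Push _ _ => 1
  | Case _ c0 c1 cE => (clen c0 + clen c1 + clen cE).+4
  | Seq c1 c2 => clen c1 + clen c2
  | While _ c => (clen c).+2
  end.

Fixpoint compile (c : cmd) (p : nat) : seq instr :=
  match c with
  | Skip => [::]
  | Push s b => [:: IPush s b p.+1]
  | Case s c0 c1 cE =>
    let n0 := p.+1 in let n1 := n0 + (clen c0).+1 in let nE := n1 + (clen c1).+1 in
    let e := nE + (clen cE).+1 in
    IPop s n0 n1 nE :: (compile c0 n0 ++ [:: IJmp e]) ++ (compile c1 n1 ++ [:: IJmp e]) ++
      (compile cE nE ++ [:: IJmp e])
  | Seq c1 c2 => compile c1 p ++ compile c2 (p + clen c1)
  | While s c => let e := p + (clen c).+2 in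
    IPop s e p.+1 e :: compile c p.+1 ++ [:: IJmp p]
  end.

Lemma size_compile c p : size (compile c p) = clen c.
Proof.
elim: c p => [|s b|s c0 I0 c1 I1 cE IE|c1 I1 c2 I2|s c I] p //=.
- by rewrite !size_cat /= I0 I1 IE; lia.
- by rewrite size_cat I1 I2.
- by rewrite size_cat I /=; lia.
Qed.

Definition code_at (C : seq instr) (p : nat) (D : seq instr) : Prop :=
  exists E F, C = E ++ D ++ F /\ size E = p.

Lemma code_at_cat C p D1 D2 :
  code_at C p (D1 ++ D2) -> code_at C p D1 /\ code_at C (p + size D1) D2.
Proof.
case=> E [F [-> <-]]; split; first by exists E, (D2 ++ F); rewrite -!catA.
by exists (E ++ D1), F; rewrite size_cat -!catA.
Qed.

Lemma code_at_cons C p i D :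
  code_at C p (i :: D) -> [/\ p < size C, nth (IJmp 0) C p = i & code_at C p.+1 D].
Proof.
case=> E [F [-> <-]]; split; first by rewrite !size_cat /=; lia.
  by rewrite nth_cat ltnn subnn.
by exists (E ++ [:: i]), F; rewrite size_cat addn1 -catA.
Qed.

Definition areach (C : seq instr) t x y := exists2 n, n <= t & iter n (astep C) x = y.

Lemma areach_trans C t1 t2 x y z :
  areach C t1 x y -> areach C t2 y z -> areach C (t1 + t2) x z.
Proof. by case=> n1 l1 E1 [n2 l2 E2]; exists (n2 + n1); [lia | rewrite iterD E1]. Qed.

Lemma areach_step C x : areach C 1 x (astep C x).
Proof. by exists 1. Qed.

(** The two units charged for a [Case] and for each turn of a [While] pay for the test and for the
    jump that closes the branch or the body. *)
Lemma compile_ok c st t st' : exec c st t st' ->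
  forall C p, code_at C p (compile c p) -> areach C t (p, st) (p + clen c, st').
Proof.
elim=> {c st t st'}.
- by move=> st C p _; exists 0; rewrite ?addn0.
- by move=> s b st C p /code_at_cons[lt E _]; exists 1; rewrite //= lt E addn1.
- move=> s c0 c1 cE st st' t E _ IH C p /= /code_at_cons[lt Ei].
  case/code_at_cat=> _; case/code_at_cat=> _; case/code_at_cat.
  rewrite !size_cat !size_compile /= !addn1 => /IH H /code_at_cons[lt' Ei' _].
  rewrite -[t.+2]/(1 + t.+1) -[t.+1]addn1; apply: areach_trans (areach_step _ _) _.
  rewrite /= lt Ei E; apply: areach_trans H _; exists 1 => //=.
  by rewrite lt' Ei'; congr (_, _); lia.
- move=> s c0 c1 cE b w st st' t E _ IH C p /= /code_at_cons[lt Ei].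
  rewrite -[t.+2]/(1 + t.+1) -[t.+1]addn1 => H.
  apply: areach_trans (areach_step _ _) _; rewrite /= lt Ei E.
  case: b E IH => /= E IH.
    case/code_at_cat: H => _; case/code_at_cat=> H _; case/code_at_cat: H.
    rewrite !size_cat !size_compile /= !addn1 => /IH H /code_at_cons[lt' Ei' _].
    rewrite -(addn1 t).
    by apply: areach_trans H _; exists 1 => //=; rewrite lt' Ei'; congr (_, _); lia.
  case/code_at_cat: H => H _; case/code_at_cat: H.
  rewrite !size_compile /= => /IH H /code_at_cons[lt' Ei' _].
  by apply: areach_trans H _; exists 1 => //=; rewrite lt' Ei'; congr (_, _); lia.
- move=> c1 c2 st1 st2 st3 t1 t2 _ I1 _ I2 C p /= /code_at_cat[/I1 H].
  by rewrite size_compile => /I2; rewrite -addnA; apply: areach_trans.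
- move=> s c st E C p /= /code_at_cons[lt Ei _].
  by exists 1; rewrite //= lt Ei E.
- move=> s c st w E C p /= /code_at_cons[lt Ei _].
  by exists 1; rewrite //= lt Ei E.
- move=> s c st w st1 st2 t1 t2 E _ I1 _ I2 C p /= H.
  case/code_at_cons: (H) => [lt Ei] /code_at_cat[/I1 H1].
  rewrite size_compile => /code_at_cons[lt' Ei' _].
  have -> : (t1 + t2).+2 = 1 + (t1 + (1 + t2)) by lia.
  apply: areach_trans (areach_step _ _) _; rewrite /= lt Ei E.
  apply: areach_trans H1 _; apply: areach_trans (areach_step _ _) _.
  by rewrite /= lt' Ei'; apply: I2.
- by move=> c st t t' st' _ IH le C p /IH[n ln E]; exists n => //; apply: leq_trans ln le.
Qed.

Lemma ssize_upd s w st : ssize (upd s w st) + size (get s st) = ssize st + size w.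
Proof. by case: st => [[[a b] c] d]; case: s => /=; lia. Qed.

(** Each push costs a unit of time. Time bounds therefore give bounds on output sizes, which
    compositions need. *)
Lemma exec_size c st t st' : exec c st t st' -> ssize st' <= ssize st + t.
Proof.
elim=> {c st t st'}.
- by move=> st; rewrite addn0.
- by move=> s b st; have := ssize_upd s (b :: get s st) st => /=; lia.
- by move=> s c0 c1 cE st st' t _ _; lia.
- by move=> s c0 c1 cE b w st st' t E _; have := ssize_upd s w st; rewrite E /=; lia.
- by move=> c1 c2 st1 st2 st3 t1 t2 _ + _; lia.
- by move=> s c st _; lia.
- by move=> s c st w E; have := ssize_upd s w st; rewrite E /=; lia.
- by move=> s c st w st1 st2 t1 t2 E _ + _; have := ssize_upd s w st; rewrite E /=; lia.
- by move=> c st t t' st' _; lia.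
Qed.

(** * Stack programs on a queue automaton *)

(* The queue holds the four stacks, top first, each bit preceded by [true] and each stack
   closed by [false]; one instruction is performed during one full rotation. *)
Definition segm (w : seq bool) : seq bool := mark_bits w ++ [:: false].

Definition queue_of (st : stacks) : seq bool :=
  let: (a, b, c, d) := st in segm a ++ segm b ++ segm c ++ segm d.

(** Place inside a segment: [KS] begins it, [KC] continues it, [K1] has read a marker, [KB] reads
    the bit behind it, [Kb] writes that bit, [K0] has read the closing bit, [KU] drops a popped
    bit. *)
Variant sub := KS | KC | K1 | KB | Kb of bool | K0 | KU.

(** [Run] holds the program counter, the done flag, the stack passing by and the place in its
    segment. [Ini] appends the closing bits of the four stacks, [Un0] to [Un3] strip all markers at
    the end, and [QE] carries the verdict. *)
Variant qst (N : nat) :=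
| Run of 'I_N.+1 & bool & stk & sub
| Ini of stk
| Un0 of bool | Un1 | Un2 of bool | Un3 of stk & bool | QE of bool.
Arguments Ini {N}. Arguments Un0 {N}. Arguments Un1 {N}. Arguments Un2 {N}.
Arguments Un3 {N}. Arguments QE {N}.

Definition stk_pack s := match s with sA => (false, false) | sB => (false, true)
  | sC => (true, false) | sD => (true, true) end.
Definition stk_unpack s := match s with (false, false) => sA | (false, true) => sB
  | (true, false) => sC | (true, true) => sD end.
Lemma stk_packK : cancel stk_pack stk_unpack. Proof. by case. Qed.
HB.instance Definition _ := Finite.copy stk (can_type stk_packK).

Section QstFin.
Variable N : nat.

Definition sub_pack (s : sub) : 'I_7 * bool :=
  match s with
  | KS => (@Ordinal 7 0 isT, false)
  | KC => (@Ordinal 7 1 isT, false)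
  | K1 => (@Ordinal 7 2 isT, false)
  | KB => (@Ordinal 7 3 isT, false)
  | Kb b => (@Ordinal 7 4 isT, b)
  | K0 => (@Ordinal 7 5 isT, false)
  | KU => (@Ordinal 7 6 isT, false)
  end.

Definition sub_unpack (c : 'I_7 * bool) : sub :=
  match val c.1 with
  | 0 => KS | 1 => KC | 2 => K1 | 3 => KB | 4 => Kb c.2 | 5 => K0 | _ => KU
  end.

Lemma sub_packK : cancel sub_pack sub_unpack. Proof. by case. Qed.

Definition qst_pack (q : qst N) :
    'I_N.+1 * bool * stk * ('I_7 * bool) + 'I_6 * stk * bool :=
  match q with
  | Run p d s u => inl (p, d, s, sub_pack u)
  | Ini s => inr (@Ordinal 6 0 isT, s, false)
  | Un0 b => inr (@Ordinal 6 1 isT, sA, b)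
  | Un1 => inr (@Ordinal 6 2 isT, sA, false)
  | Un2 b => inr (@Ordinal 6 3 isT, sA, b)
  | Un3 s b => inr (@Ordinal 6 4 isT, s, b)
  | QE b => inr (@Ordinal 6 5 isT, sA, b)
  end.

Definition qst_unpack (c : 'I_N.+1 * bool * stk * ('I_7 * bool) + 'I_6 * stk * bool) : qst N :=
  match c with
  | inl (p, d, s, u) => Run p d s (sub_unpack u)
  | inr (i, s, b) =>
    match val i with
    | 0 => Ini s | 1 => Un0 b | 2 => Un1 | 3 => Un2 b | 4 => Un3 s b | _ => QE b
    end
  end.

Lemma qst_packK : cancel qst_pack qst_unpack.
Proof. by case=> //= p d s u; rewrite sub_packK. Qed.

End QstFin.

HB.instance Definition _ N := Finite.copy (qst N) (can_type (@qst_packK N)).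

Section StackQueue.
Variable C : seq instr.
Local Notation N := (size C).
Local Notation pcN n := (inord (minn n N) : 'I_N.+1).

(* The flag [d] tells whether the current instruction has been performed. *)
Definition nx (p : 'I_N.+1) (d : bool) (s : stk) : qst N :=
  match s with
  | sA => Run p d sB KS | sB => Run p d sC KS | sC => Run p d sD KS | sD => Run p false sA KS
  end.

Definition op_copy (p : 'I_N.+1) d s : qop (qst N) :=
  QPop (fun x : bool => Run p d s (if x then K1 else K0)).

(** An instruction acts when the segment of its stack begins: the top comes first, so a push inserts
    a marked bit before the copy and a pop omits one. A jump is taken at once. Counters beyond the
    program are clamped to [N], where unloading starts. *)
Definition qop_of (q : qst N) : qop (qst N) :=
  match q with
  | Run p d s KS =>
    if d then op_copy p d s else
    if N <= p then QPop (fun x : bool => if x then Un1 else Un3 sB false) else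
    match nth (IJmp 0) C p with
    | IPush s' b n => if s' == s then QApp true (Run (pcN n) true s (Kb b)) else op_copy p d s
    | IPop s' n0 n1 nE =>
      if s' == s then
        QPop (fun x : bool => if x then Run p d s KU else Run (pcN nE) true s K0)
      else op_copy p d s
    | IJmp n => op_copy (pcN n) true s
    end
  | Run p d s KC => op_copy p d s
  | Run p d s K1 => QApp true (Run p d s KB)
  | Run p d s KB => QPop (fun b => Run p d s (Kb b))
  | Run p d s (Kb b) => QApp b (Run p d s KC)
  | Run p d s K0 => QApp false (nx p d s)
  | Run p d s KU =>
    QPop (fun b : bool =>
      Run (if nth (IJmp 0) C p is IPop _ n0 n1 _ then pcN (if b then n1 else n0) else p) true s KC)
  | Ini s => QApp false
      match s with sA => Ini sB | sB => Ini sC | sC => Ini sD | sD => Run (pcN 0) false sA KS end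
  | Un0 l => QPop (fun x : bool => if x then Un1 else Un3 sB l)
  | Un1 => QPop (fun b => Un2 b)
  | Un2 b => QApp b (Un0 b)
  | Un3 s l => QPop (fun _ =>
      match s with sB => Un3 sC l | sC => Un3 sD l | _ => QE l end)
  | QE l => QEnd l
  end.

Local Notation reach := (qreach qop_of).

Definition qle t x y := exists2 n, n <= t & reach n x y.

Lemma qle_trans t1 t2 x y z : qle t1 x y -> qle t2 y z -> qle (t1 + t2) x z.
Proof. by case=> n1 l1 E1 [n2 l2 E2]; exists (n1 + n2); [lia | apply: qr_trans E2]. Qed.

Lemma segm_cons b w : segm (b :: w) = true :: b :: segm w. Proof. by []. Qed.

Lemma copy_segm q p d s w r : qop_of q = op_copy p d s ->
  reach (2 * size (segm w)) (q, segm w ++ r) (nx p d s, r ++ segm w).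
Proof.
elim: w q r => [|b w IH] q r E.
  apply: qr_pop E _; apply: qr_app; first by [].
  by rewrite -cats1; apply: qr_refl.
rewrite segm_cons (_ : 2 * _ = (2 * size (segm w)).+4); last by rewrite /=; lia.
apply: qr_pop E _; apply: qr_app; first by [].
rewrite rcons_cons; apply: qr_pop; first by []; apply: qr_app; first by [].
have := IH (Run p d s KC) (r ++ [:: true; b]) erefl.
by rewrite -!cats1 -!catA.
Qed.

Definition ieff (i : instr) (w : seq bool) : nat * seq bool :=
  match i with
  | IPush _ b n => (n, b :: w)
  | IPop _ n0 n1 nE => if w is b :: w' then (if b then n1 else n0, w') else (nE, w)
  | IJmp n => (n, w)
  end.

(** A jump concerns no stack; it is performed while the first one passes. *)
Definition itarget (i : instr) : stk :=
  match i with IPush s _ _ => s | IPop s _ _ _ => s | IJmp _ => sA end.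

Definition imiss (i : instr) (s : stk) : bool :=
  match i with IJmp _ => false | IPush s' _ _ | IPop s' _ _ _ => s' != s end.

Lemma hit_segm (p : 'I_N.+1) s w r : p < N -> let i := nth (IJmp 0) C p in itarget i = s ->
  qle (2 * size (segm w) + 4) (Run p false s KS, segm w ++ r)
    (nx (pcN (ieff i w).1) true s, r ++ segm (ieff i w).2).
Proof.
move=> lt i; have E : qop_of (Run p false s KS) = match i with
    | IPush s' b n => if s' == s then QApp true (Run (pcN n) true s (Kb b)) else op_copy p false s
    | IPop s' n0 n1 nE =>
      if s' == s then
        QPop (fun x : bool => if x then Run p false s KU else Run (pcN nE) true s K0)
      else op_copy p false s
    | IJmp n => op_copy (pcN n) true s
    end by rewrite /= leqNgt lt.
case Ei: i E => [s' b n|s' n0 n1 nE|n] E /= Es; rewrite ?Es ?eqxx in E.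
- exists (2 + 2 * size (segm w)); first lia.
  apply: qr_app E _; apply: qr_app; first by [].
  have := @copy_segm (Run (pcN n) true s KC) (pcN n) true s w (r ++ [:: true; b]).
  by rewrite segm_cons -!cats1 -!catA; apply.
- case: w => [|b w]; rewrite ?segm_cons.
    exists 2 => //; apply: qr_pop E _; apply: qr_app; first by [].
    by rewrite -cats1; apply: qr_refl.
  exists (2 + 2 * size (segm w)); first by rewrite [size (_ :: _)]/=; lia.
  apply: qr_pop E _; apply: qr_pop => /=; first by [].
  by rewrite -/i Ei; apply: copy_segm.
- by exists (2 * size (segm w)); [lia | apply: copy_segm E].
Qed.

Lemma miss_segm (p : 'I_N.+1) s w r : p < N -> let i := nth (IJmp 0) C p in
  imiss i s ->
  qle (2 * size (segm w) + 4) (Run p false s KS, segm w ++ r) (nx p false s, r ++ segm w).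
Proof.
move=> lt i H; exists (2 * size (segm w)); rewrite ?leq_addr //; apply: copy_segm.
rewrite /= leqNgt lt /= -/i.
by case: i H => [s' b n|s' n0 n1 nE|n] //= /negPf->.
Qed.

Lemma done_segm p s w r :
  qle (2 * size (segm w) + 4) (Run p true s KS, segm w ++ r) (nx p true s, r ++ segm w).
Proof. by exists (2 * size (segm w)); rewrite ?leq_addr //; apply: copy_segm. Qed.

Lemma qle_le t t' x y : qle t x y -> t <= t' -> qle t' x y.
Proof. by case=> n ln R le; exists n => //; apply: leq_trans ln le. Qed.

Lemma size_segm w : size (segm w) = (2 * size w).+1.
Proof.
rewrite size_cat addn1 mul2n; congr _.+1.
by elim: w => //= b w IH; rewrite /mark_bits /= -/(mark_bits w) IH.
Qed.

Lemma astep_ieff pc st : pc < N -> let i := nth (IJmp 0) C pc in let s := itarget i in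
  astep C (pc, st) = ((ieff i (get s st)).1, upd s (ieff i (get s st)).2 st).
Proof.
move=> lt /=; rewrite lt; case: (nth _ _ _) => [s b n|s n0 n1 nE|n] //=.
  by case E: (get s st) => //=; case: st E => [[[a b] c] d]; case: s => /= ->.
by case: st => [[[a b] c] d].
Qed.

(** Segments before the target stack are copied with the flag down, the target is edited, and the
    later ones are copied with the flag up; the fourth segment lowers the flag again. *)
Lemma queue_step pc st : pc < N ->
  qle (8 * ssize st + 24) (Run (pcN pc) false sA KS, queue_of st)
    (Run (pcN (astep C (pc, st)).1) false sA KS, queue_of (astep C (pc, st)).2).
Proof.
move=> lt; rewrite astep_ieff //.
have vp : val (pcN pc) = pc by rewrite /= inordK ?(minn_idPl (ltnW lt)) // ltnS ltnW.
have lt' : pcN pc < N by rewrite -[nat_of_ord _]/(val _) vp.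
have H s w r := @hit_segm (pcN pc) s w r lt'.
have M s w r := @miss_segm (pcN pc) s w r lt'.
rewrite /= -[nat_of_ord _]/(val _) vp in H M.
case: st => [[[a b] c] d].
apply: (qle_le (t := 2 * size (segm a) + 4 + (2 * size (segm b) + 4 +
  (2 * size (segm c) + 4 + (2 * size (segm d) + 4))))); last by rewrite !size_segm /=; lia.
move: (nth _ _ _) H M => i H M.
have [E|[[E nA]|[[E nA nB]|[E nA nB nC]]]] : itarget i = sA \/
    (itarget i = sB /\ imiss i sA) \/ [/\ itarget i = sC, imiss i sA & imiss i sB] \/
    [/\ itarget i = sD, imiss i sA, imiss i sB & imiss i sC].
- by case: i {H M} => [[] ? ?|[] ? ? ?|?]; do ?[by left | by right; left | by right; right; left | by right; right; right].
- rewrite E /=; apply: qle_trans (H _ _ _ E) _; rewrite [nx _ _ _]/= -!(catA (segm _)).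
  apply: qle_trans (done_segm _ _ _ _) _; rewrite [nx _ _ _]/= -!(catA (segm _)).
  apply: qle_trans (done_segm _ _ _ _) _; rewrite [nx _ _ _]/= -!(catA (segm _)).
  by have := done_segm (pcN (ieff i a).1) sD d (segm (ieff i a).2 ++ segm b ++ segm c); rewrite [nx _ _ _]/= -?(catA (segm _)); apply.
- rewrite E /=; apply: qle_trans (M sA _ _ nA) _; rewrite [nx _ _ _]/= -!(catA (segm _)).
  apply: qle_trans (H _ _ _ E) _; rewrite [nx _ _ _]/= -!(catA (segm _)).
  apply: qle_trans (done_segm _ _ _ _) _; rewrite [nx _ _ _]/= -!(catA (segm _)).
  by have := done_segm (pcN (ieff i b).1) sD d (segm a ++ segm (ieff i b).2 ++ segm c); rewrite [nx _ _ _]/= -?(catA (segm _)); apply.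
- rewrite E /=; apply: qle_trans (M sA _ _ nA) _; rewrite [nx _ _ _]/= -!(catA (segm _)).
  apply: qle_trans (M sB _ _ nB) _; rewrite [nx _ _ _]/= -!(catA (segm _)).
  apply: qle_trans (H _ _ _ E) _; rewrite [nx _ _ _]/= -!(catA (segm _)).
  by have := done_segm (pcN (ieff i c).1) sD d (segm a ++ segm b ++ segm (ieff i c).2); rewrite [nx _ _ _]/= -?(catA (segm _)); apply.
- rewrite E /=; apply: qle_trans (M sA _ _ nA) _; rewrite [nx _ _ _]/= -!(catA (segm _)).
  apply: qle_trans (M sB _ _ nB) _; rewrite [nx _ _ _]/= -!(catA (segm _)).
  apply: qle_trans (M sC _ _ nC) _; rewrite [nx _ _ _]/= -!(catA (segm _)).
  by have := H sD d (segm a ++ segm b ++ segm c) E; rewrite [nx _ _ _]/= -?(catA (segm _)); apply.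
Qed.

Lemma ssize_astep c : ssize (astep C c).2 <= (ssize c.2).+1.
Proof.
case: c => pc st /=; case: ifP => //= _; case: (nth _ _ _) => [s b n|s n0 n1 nE|n] //=.
  by have := ssize_upd s (b :: get s st) st => /=; lia.
by case E: (get s st) => [|b w] //=; have := ssize_upd s w st; rewrite E /=; lia.
Qed.

Lemma astep_halted n pc st : N <= pc -> iter n (astep C) (pc, st) = (pc, st).
Proof. by move=> h; elim: n => //= n ->; rewrite /= ltnNge h. Qed.

Lemma queue_iter n c :
  qle (n * (8 * (ssize c.2 + n) + 24)) (Run (pcN c.1) false sA KS, queue_of c.2)
    (Run (pcN (iter n (astep C) c).1) false sA KS, queue_of (iter n (astep C) c).2).
Proof.
elim: n c => [|n IH] c; first by exists 0 => //; apply: qr_refl.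
have [h|] := boolP (N <= c.1).
  by case: c h => pc st h; rewrite astep_halted //; exists 0 => //; apply: qr_refl.
rewrite -ltnNge => lt.
have := IH (astep C c); rewrite -iterSr => H.
have := queue_step c.2 lt; rewrite -surjective_pairing => H1.
apply: qle_le (qle_trans H1 H) _; have := ssize_astep c; nia.
Qed.

(** [q] is general because unloading begins in the [Run] state whose counter has left the program.
    The last bit seen is remembered as the verdict. *)
Lemma unload_bits q w r l : qop_of q = qop_of (Un0 l) ->
  qle (3 * size w + 4) (q, mark_bits w ++ [:: false; false; false; false] ++ r)
    (QE (last l w), r ++ w).
Proof.
elim: w q r l => [|b w IH] q r l E.
  exists 4 => //; apply: qr_pop E _; do 3![apply: qr_pop; first by []].
  by rewrite cats0; apply: qr_refl.
have [n ln R] := IH (Un0 b) (rcons r b) b erefl.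
exists n.+3; first by rewrite /=; lia.
rewrite [mark_bits _ ++ _]/= -/(mark_bits w); apply: qr_pop E _.
apply: qr_pop; first by []; apply: qr_app; first by [].
by move: R; rewrite -!cats1 -!catA.
Qed.

Lemma start_zeros w :
  reach 4 (Ini sA, w) (Run (pcN 0) false sA KS, w ++ [:: false; false; false; false]).
Proof.
do 4![apply: qr_app; first by []]; rewrite -!cats1 -!catA; exact: qr_refl.
Qed.

End StackQueue.

Theorem cmd_tm (c : cmd) (f : seq bool -> seq bool) (T : seq bool -> nat) :
  pb size T ->
  (forall x, exec c (x, [::], [::], [::]) (T x) (f x, [::], [::], [::])) ->
  exists M c d, forall x, let cf := run M (poly c d (size x)) x in
    [/\ halting (cstate cf), out_bits cf.2 = f x & (val (cstate cf) = 1 <-> last false (f x))].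
Proof.
move=> pT H; set C := compile c 0.
pose B x := 4 + T x * (8 * (size x + T x) + 24) + (3 * (size x + T x) + 4).
apply: (@qreach_tm _ (@qop_of C) (Ini sA) f (fun x => last false (f x)) B).
  by rewrite /B; do ![apply: pT | apply: pb_id | apply: pb_const | apply: pb_add | apply: pb_mul].
move=> x; have HC : code_at C 0 (compile c 0) by exists [::], [::]; rewrite cats0.
have [n ln E] := compile_ok (H x) HC.
have := queue_iter C n (0, (x, [::], [::], [::])); rewrite E add0n /= => -[n1 l1 R1].
have sf : size (f x) <= size x + T x by have := exec_size (H x); rewrite /= !addn0.
have hq : qop_of (Run (inord (minn (clen c) (size C))) false sA KS) = qop_of (@Un0 (size C) false).
  rewrite /= ifT //; have -> : minn (clen c) (size C) = size C by rewrite size_compile minnn.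
  by rewrite inordK.
have [n2 l2 R2] := unload_bits (f x) [::] hq.
exists (4 + n1 + n2), (QE (last false (f x))); split=> //.
  move: l1 l2; rewrite /B /= !addn0.
  have : n * (8 * (size x + n) + 24) <= T x * (8 * (size x + T x) + 24) by apply: leq_mul => //; lia.
  by move: (n * _) (T x * _) => u v; lia.
have S := start_zeros C (mark_bits x).
have E0 y : queue_of (y, [::], [::], [::]) = mark_bits y ++ [:: false; false; false; false].
  by rewrite /= -catA.
have {}R1 : qreach (@qop_of C) n1
  (Run (inord (minn 0 (size C))) false sA KS, queue_of (x, [::], [::], [::]))
  (Run (inord (minn (clen c) (size C))) false sA KS, queue_of (f x, [::], [::], [::])) := R1.
rewrite !E0 in R1; rewrite cats0 cat0s in R2.
exact: qr_trans (qr_trans S R1) R2.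
Qed.

(** * Polynomial-time functions on encoded data *)

Inductive tree := Lf | Nd of tree & tree.

Fixpoint tcode (t : tree) : seq bool :=
  if t is Nd l r then true :: tcode l ++ tcode r else [:: false].

(** The code is prefix-free; the arbitrary continuations are what the induction on a node needs. *)
Lemma tcode_inj_cat t u a b : tcode t ++ a = tcode u ++ b -> t = u /\ a = b.
Proof.
elim: t u a b => [|l IHl r IHr] [|l' r'] a b //=; first by case.
by case; rewrite -!catA => /IHl[<- /IHr[<- <-]].
Qed.

Lemma tcode_inj : injective tcode.
Proof. by move=> t u E; case: (@tcode_inj_cat t u [::] [::]); rewrite ?E. Qed.

(* A tree code [w] parked on a side stack: last bit on top, closed by [false]. *)
Definition park (w b : seq bool) : seq bool := mark_bits (rev w) ++ false :: b.

Lemma mark_bits_cat u v : mark_bits (u ++ v) = mark_bits u ++ mark_bits v.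
Proof. by rewrite /mark_bits map_cat flatten_cat. Qed.

(** * Stack programs that read, move and copy tree codes *)

Fixpoint seqs (cs : seq cmd) : cmd := if cs is c :: cs' then Seq c (seqs cs') else Skip.

Definition save (s : stk) (b : bool) : cmd := Seq (Push s b) (Push s true).

(* Stack [sD] counts the subtrees still to be read. *)
Definition trav_loop : cmd :=
  While sD (Case sA (seqs [:: save sB false; save sC false])
    (seqs [:: Push sD true; Push sD true; save sB true; save sC true]) Skip).
Definition trav : cmd :=
  seqs [:: Push sB false; Push sC false; Push sD false; Push sD true; trav_loop].

Ltac straight := repeat first [apply: ex_skip | apply: ex_push | apply: ex_seq].

(** Formulated from the rest of the loop back to the whole, so that at a node the hypotheses for the
    two subtrees are simply applied in succession. *)
Lemma trav_loop_tree t a b c d T st' :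
  exec trav_loop (a, mark_bits (rev (tcode t)) ++ b, mark_bits (rev (tcode t)) ++ c, d) T st' ->
  exec trav_loop (tcode t ++ a, b, c, true :: d) (T + 12 * size (tcode t)) st'.
Proof.
elim: t a b c d T st' => [|l IHl r IHr] a b c d T st' H.
  apply: ex_weak; first apply: ex_while1; [by [] | | exact: H |].
    by apply: ex_case; [by [] |]; straight.
  by rewrite /=; lia.
have -> : tcode (Nd l r) ++ a = true :: tcode l ++ tcode r ++ a by rewrite /= -catA.
apply: ex_weak.
  apply: (@ex_while1 _ _ _ _
    (tcode l ++ tcode r ++ a, true :: true :: b, true :: true :: c, true :: true :: d)) => //.
    by apply: ex_case; [by [] |]; straight.
  apply: IHl; apply: IHr.
  move: H; rewrite /= rev_cons rev_cat rcons_cat -cats1 !mark_bits_cat /= -!catA; exact.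
by rewrite /= size_cat; lia.
Qed.

Lemma trav_ok t a b c d :
  exec trav (tcode t ++ a, b, c, d) (12 * size (tcode t) + 5)
    (a, park (tcode t) b, park (tcode t) c, d).
Proof.
apply: ex_weak.
  do 4![apply: ex_seq; first exact: ex_push].
  apply: ex_seq; last exact: ex_skip.
  by apply: trav_loop_tree; apply: ex_while0.
by lia.
Qed.

Definition back (s : stk) : cmd := While s (Case s (Push sA false) (Push sA true) Skip).
Definition disc (s : stk) : cmd := While s (Case s Skip Skip Skip).

Lemma backB w a b c d : exec (back sB) (a, park w b, c, d) (5 * size w + 1) (w ++ a, b, c, d).
Proof.
rewrite /park; move E: (rev w) => v; rewrite -(revK w) E size_rev {w E}.
elim: v a => [|x v IH] a.
  exact: ex_while0.
apply: ex_weak; first apply: (@ex_while1 _ _ _ _ (x :: a, mark_bits v ++ false :: b, c, d) _ 3); [by [] | | | ].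
- by apply: ex_case; [by [] | case: x; exact: ex_push].
- by rewrite rev_cons cat_rcons; case: x; apply: IH.
by rewrite /=; lia.
Qed.

Lemma backC w a b c d : exec (back sC) (a, b, park w c, d) (5 * size w + 1) (w ++ a, b, c, d).
Proof.
rewrite /park; move E: (rev w) => v; rewrite -(revK w) E size_rev {w E}.
elim: v a => [|x v IH] a.
  exact: ex_while0.
apply: ex_weak; first apply: (@ex_while1 _ _ _ _ (x :: a, b, mark_bits v ++ false :: c, d) _ 3); [by [] | | | ].
- by apply: ex_case; [by [] | case: x; exact: ex_push].
- by rewrite rev_cons cat_rcons; case: x; apply: IH.
by rewrite /=; lia.
Qed.

Lemma discB w a b c d : exec (disc sB) (a, park w b, c, d) (4 * size w + 1) (a, b, c, d).
Proof.
rewrite /park -(size_rev w); elim: (rev w) => [|x v IH]; first exact: ex_while0.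
apply: ex_weak; first apply: (@ex_while1 _ _ _ _ (a, mark_bits v ++ false :: b, c, d) _ 2); [by [] | | exact: IH | ].
  by apply: ex_case; [by [] | case: x; exact: ex_skip].
by rewrite /=; lia.
Qed.

Lemma discC w a b c d : exec (disc sC) (a, b, park w c, d) (4 * size w + 1) (a, b, c, d).
Proof.
rewrite /park -(size_rev w); elim: (rev w) => [|x v IH]; first exact: ex_while0.
apply: ex_weak; first apply: (@ex_while1 _ _ _ _ (a, b, mark_bits v ++ false :: c, d) _ 2); [by [] | | exact: IH | ].
  by apply: ex_case; [by [] | case: x; exact: ex_skip].
by rewrite /=; lia.
Qed.

(** Reading a tree destroys it, so [trav] leaves two parked copies: moving discards one of them,
    duplicating brings both back. *)
Definition mvB := Seq trav (disc sC).
Definition mvC := Seq trav (disc sB).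
Definition dup := Seq trav (Seq (back sC) (back sB)).
Definition drop_top := Seq mvB (disc sB).
Definition swap := Seq mvB (Seq mvC (Seq (back sB) (back sC))).

Lemma mvB_ok t a b c d :
  exec mvB (tcode t ++ a, b, c, d) (30 * size (tcode t) + 30) (a, park (tcode t) b, c, d).
Proof. apply: ex_weak; first by apply: ex_seq; [apply: trav_ok | apply: discC]. lia. Qed.

Lemma mvC_ok t a b c d :
  exec mvC (tcode t ++ a, b, c, d) (30 * size (tcode t) + 30) (a, b, park (tcode t) c, d).
Proof. apply: ex_weak; first by apply: ex_seq; [apply: trav_ok | apply: discB]. lia. Qed.

Lemma dup_ok t a b c d :
  exec dup (tcode t ++ a, b, c, d) (30 * size (tcode t) + 30) (tcode t ++ tcode t ++ a, b, c, d).
Proof.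
apply: ex_weak.
  apply: ex_seq; first apply: trav_ok.
  by apply: ex_seq; [apply: backC | apply: backB].
lia.
Qed.

Lemma drop_ok t a b c d :
  exec drop_top (tcode t ++ a, b, c, d) (40 * size (tcode t) + 40) (a, b, c, d).
Proof. apply: ex_weak; first by apply: ex_seq; [apply: mvB_ok | apply: discB]. lia. Qed.

Lemma swap_ok t u a b c d :
  exec swap (tcode t ++ tcode u ++ a, b, c, d) (40 * (size (tcode t) + size (tcode u)) + 80)
    (tcode u ++ tcode t ++ a, b, c, d).
Proof.
apply: ex_weak; first (apply: ex_seq; first apply: mvB_ok).
  apply: ex_seq; first apply: mvC_ok.
  by apply: ex_seq; [apply: backB | apply: backC].
lia.
Qed.

(** * Encodable types and the class [FPt] of polynomial-time functions *)

Class Enc (T : Type) := { enc : T -> tree; enc_inj : injective enc }.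

Definition code (T : Type) {eT : Enc T} (x : T) : seq bool := tcode (enc x).
Definition sz (T : Type) {eT : Enc T} (x : T) : nat := size (code x).

Arguments code {T eT} x.
Arguments sz {T eT} x.

Lemma code_inj (T : Type) {eT : Enc T} : injective (@code T eT).
Proof. by move=> x y E; apply: enc_inj; apply: tcode_inj. Qed.

#[refine, global] Instance Enc_unit : Enc unit := {| enc := fun _ => Lf; enc_inj := _ |}.
Proof. by do 2!case. Defined.

#[refine, global] Instance Enc_bool : Enc bool := {| enc := fun b => if b then Nd Lf Lf else Lf; enc_inj := _ |}.
Proof. by do 2!case. Defined.

#[refine, global] Instance Enc_prod (T U : Type) {eT : Enc T} {eU : Enc U} : Enc (T * U) :=
  {| enc := fun p : T * U => Nd (enc p.1) (enc p.2); enc_inj := _ |}.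
Proof. by case=> a b [c d] /= [E1 E2]; rewrite (enc_inj E1) (enc_inj E2). Defined.

#[refine, global] Instance Enc_seq (T : Type) {eT : Enc T} : Enc (seq T) :=
  {| enc := foldr (fun x t => Nd (enc x) t) Lf; enc_inj := _ |}.
Proof. by elim=> [|x s IH] [|y u] //= [E1 E2]; rewrite (enc_inj E1) (IH _ E2). Defined.

(** Numbers are coded in unary, so that loops up to a number and polynomials in it stay polynomial
    in the size of its code. *)
#[refine, global] Instance Enc_nat : Enc nat := {| enc := fun n => iter n (Nd Lf) Lf; enc_inj := _ |}.
Proof. by elim=> [|n IH] [|m] //= [E]; rewrite (IH _ E). Defined.

#[refine, global] Instance Enc_sum (T U : Type) {eT : Enc T} {eU : Enc U} : Enc (T + U) :=
  {| enc := fun s => match s with inl x => Nd Lf (enc x) | inr y => Nd (Nd Lf Lf) (enc y) end; enc_inj := _ |}.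
Proof. by do 2!case=> ?; case=> // E; rewrite (enc_inj E). Defined.

Lemma code_pair (T U : Type) {eT : Enc T} {eU : Enc U} (x : T) (y : U) :
  code (x, y) = true :: code x ++ code y.
Proof. by []. Qed.

Lemma code_cons (T : Type) {eT : Enc T} (x : T) (l : seq T) :
  code (x :: l) = true :: code x ++ code l.
Proof. by []. Qed.

Lemma code_nil (T : Type) {eT : Enc T} : code (Nil T) = [:: false].
Proof. by []. Qed.

Lemma sz_pair (T U : Type) {eT : Enc T} {eU : Enc U} (x : T) (y : U) :
  sz (x, y) = (sz x + sz y).+1.
Proof. by rewrite /sz code_pair /= size_cat. Qed.

Lemma sz_cons (T : Type) {eT : Enc T} (x : T) (l : seq T) : sz (x :: l) = (sz x + sz l).+1.
Proof. by rewrite /sz code_cons /= size_cat. Qed.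

Lemma ex_popA (b : bool) c0 c1 cE w B C D t st' :
  exec (if b then c1 else c0) (w, B, C, D) t st' ->
  exec (Case sA c0 c1 cE) (b :: w, B, C, D) t.+2 st'.
Proof. by move=> H; apply: (@ex_case _ _ _ _ b w). Qed.

Lemma ex_pushA b w B C D : exec (Push sA b) (w, B, C, D) 1 (b :: w, B, C, D).
Proof. exact: ex_push. Qed.

(* Programs act on the code on top of [sA] and preserve everything below and on the other stacks. *)
Definition runs (T U : Type) {eT : Enc T} {eU : Enc U} (p : cmd) (f : T -> U) (tm : T -> nat) :=
  forall x a b c d, exec p (code x ++ a, b, c, d) (tm x) (code (f x) ++ a, b, c, d).

Definition FPt (T U : Type) {eT : Enc T} {eU : Enc U} (f : T -> U) : Prop :=
  exists p d, runs p f (fun x => (sz x + 2) ^ d).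

Section Functions.
Context {T U : Type} {eT : Enc T} {eU : Enc U}.

Lemma FPt_runs (p : cmd) (f : T -> U) tm : pb sz tm -> runs p f tm -> FPt f.
Proof. by case=> d H R; exists p, d => x a b c e; apply: ex_weak (R _ _ _ _ _) (H x). Qed.

Lemma FPt_pb (f : T -> U) : FPt f -> exists p tm, pb sz tm /\ runs p f tm.
Proof. by case=> p [d H]; exists p, (fun x => (sz x + 2) ^ d); split=> //; exists d. Qed.

Lemma FPt_sz (f : T -> U) : FPt f -> pb sz (fun x => sz (f x)).
Proof.
case/FPt_pb=> p [tm [ptm R]]; apply: pb_le (pb_add (pb_id sz) ptm) => x.
by have := exec_size (R x [::] [::] [::] [::]); rewrite /= !cats0 !addn0.
Qed.

Lemma FPt_ext (f g : T -> U) : f =1 g -> FPt f -> FPt g.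
Proof. by move=> fg [p [d R]]; exists p, d => x a b c e; rewrite -fg. Qed.

(** Encodings coincide on purpose: [x :: l] is coded like [(x, l)], [n.+1] like [(tt, n)], and a
    list of [tt] like its length. Constructors and conversions of this kind cost nothing. *)
Lemma FPt_cast (f : T -> U) : (forall x, enc (f x) = enc x) -> FPt f.
Proof.
move=> H; apply: (@FPt_runs Skip f (fun=> 0)) (pb_const _ _) _ => x a b c d.
by rewrite /code H; apply: ex_skip.
Qed.

End Functions.

Ltac pbt := repeat match goal with
  | |- pb _ (fun _ => ?c) => exact: pb_const
  | |- pb _ (fun x => _ + _) => apply: pb_add
  | |- pb _ (fun x => _ * _) => apply: pb_mul
  | |- pb _ (fun x => _ ^ _) => apply: pb_exp
  | |- _ => first [eassumption | exact: pb_id]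
  end.

Section Closure.
Context {T U W E : Type} {eT : Enc T} {eU : Enc U} {eW : Enc W} {eE : Enc E}.

Lemma FPt_comp (g : U -> W) (f : T -> U) : FPt f -> FPt g -> FPt (fun x => g (f x)).
Proof.
move=> Ff Fg; have := FPt_sz Ff; case/FPt_pb: Ff => p [tf [ptf Rf]].
case/FPt_pb: Fg => q [tg [ptg Rg]] sf.
apply: (@FPt_runs _ _ _ _ (Seq p q) _ (fun x => tf x + tg (f x))).
  by apply: pb_add => //; apply: pb_comp ptg sf.
by move=> x a b c d; apply: ex_seq (Rf _ _ _ _ _) (Rg _ _ _ _ _).
Qed.

(** The second component is computed first, because the code of a pair has the first one on top. *)
Lemma FPt_pair (f : T -> U) (g : T -> W) : FPt f -> FPt g -> FPt (fun x => (f x, g x)).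
Proof.
move=> Ff Fg; have sf := FPt_sz Ff; have sg := FPt_sz Fg.
case/FPt_pb: Ff => p [tf [ptf Rf]]; case/FPt_pb: Fg => q [tg [ptg Rg]].
apply: (@FPt_runs _ _ _ _ (seqs [:: dup; q; swap; p; Push sA true]) _
  (fun x => (30 * sz x + 30) + (tg x + ((40 * (sz (g x) + sz x) + 80) + (tf x + 1))))).
  by pbt.
move=> x a b c d; apply: ex_weak.
  apply: ex_seq; first exact: dup_ok.
  apply: ex_seq; first exact: Rg.
  apply: ex_seq; first exact: swap_ok.
  apply: ex_seq; first exact: Rf.
  by apply: ex_seq; [exact: ex_push | rewrite /= catA; exact: ex_skip].
by rewrite /sz /code; lia.
Qed.

Lemma FPt_const (u : U) : FPt (fun _ : T => u).
Proof.
pose pushes := foldr (fun b c => Seq c (Push sA b)) Skip.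
have P w a b c d : exec (pushes w) (a, b, c, d) (size w) (w ++ a, b, c, d).
  elim: w => [|x w IH] /=; first exact: ex_skip.
  by rewrite -addn1; apply: ex_seq IH _; exact: ex_push.
apply: (@FPt_runs _ _ _ _ (Seq drop_top (pushes (code u))) _
  (fun x => (40 * sz x + 40) + size (code u))); first by pbt.
by move=> x a b c d; apply: ex_seq; [apply: drop_ok | apply: P].
Qed.

Lemma FPt_fst : FPt (@fst T U).
Proof.
apply: (@FPt_runs _ _ _ _ (Case sA Skip (Seq swap drop_top) Skip) _ (fun x => 80 * sz x + 200)).
  by pbt.
case=> x y a b c d; rewrite code_pair cat_cons -catA; apply: ex_weak.
  by apply: ex_popA; apply: ex_seq; [apply: swap_ok | apply: drop_ok].
by rewrite sz_pair /sz /code; lia.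
Qed.

Lemma FPt_snd : FPt (@snd T U).
Proof.
apply: (@FPt_runs _ _ _ _ (Case sA Skip drop_top Skip) _ (fun x => 80 * sz x + 200)).
  by pbt.
case=> x y a b c d; rewrite code_pair cat_cons -catA; apply: ex_weak.
  by apply: ex_popA; apply: drop_ok.
by rewrite sz_pair /sz /code; lia.
Qed.

End Closure.

Lemma FPt_id (T : Type) {eT : Enc T} : FPt (fun x : T => x).
Proof. exact: FPt_cast. Qed.

Lemma leq_expn m n d : m <= n -> m ^ d <= n ^ d.
Proof. by case: d => // d; rewrite leq_exp2r. Qed.

Section Branching.
Context {T U E : Type} {eT : Enc T} {eU : Enc U} {eE : Enc E}.

(** The codes of [(x :: l', e)] and [((x, l'), e)] are the same word, so after the tests it is
    enough to push the two consumed markers back. *)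
Lemma FPt_case (l : E -> seq T) (f : E -> U) (g : (T * seq T) * E -> U) :
  FPt l -> FPt f -> FPt g ->
  FPt (fun e => if l e is x :: l' then g ((x, l'), e) else f e).
Proof.
move=> Fl [p [m Rf]] [q [n Rg]].
enough (F : FPt (fun y : seq T * E => if y.1 is x :: l' then g ((x, l'), y.2) else f y.2)).
  exact (FPt_comp (FPt_pair Fl FPt_id) F).
apply: (@FPt_runs _ _ _ _ (Case sA Skip (Case sA p (seqs [:: Push sA true; Push sA true; q]) Skip)
  Skip) _ (fun x => (sz x + 10) ^ m + (sz x + 10) ^ n + 10)).
  by pbt.
case=> -[|x l'] e a b c d; rewrite code_pair ?code_nil ?code_cons !cat_cons -!catA.
  apply: ex_weak; first by apply: ex_popA; apply: ex_popA; apply: Rf.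
  have : (sz e + 2) ^ m <= (sz (Nil T, e) + 10) ^ m by apply: leq_expn; rewrite sz_pair; lia.
  by move: (_ ^ _) (_ ^ _) (_ ^ _) => u v w; lia.
apply: ex_weak.
  apply: ex_popA; apply: ex_popA; apply: ex_seq; first exact: ex_pushA.
  apply: ex_seq; first exact: ex_pushA; apply: ex_seq; last exact: ex_skip.
  by have := Rg ((x, l'), e) a b c d; rewrite !code_pair !cat_cons -!catA; apply.
have : (sz ((x, l'), e) + 2) ^ n <= (sz (x :: l', e) + 10) ^ n.
  by apply: leq_expn; rewrite !sz_pair sz_cons; lia.
by move: (_ ^ _) (_ ^ _) (_ ^ _) => u v w; lia.
Qed.

Lemma FPt_if (f : E -> bool) (g h : E -> U) :
  FPt f -> FPt g -> FPt h -> FPt (fun e => if f e then g e else h e).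
Proof.
move=> Ff [p [m Rg]] [q [n Rh]].
enough (F : FPt (fun y : bool * E => if y.1 then g y.2 else h y.2)).
  exact: (FPt_comp (FPt_pair Ff FPt_id) F).
apply: (@FPt_runs _ _ _ _ (Case sA Skip (Case sA q
   (Seq (Case sA Skip Skip Skip) (Seq (Case sA Skip Skip Skip) p)) Skip)
  Skip) _ (fun x => (sz x + 10) ^ m + (sz x + 10) ^ n + 10)).
  by pbt.
have L (y : bool) e k : (sz e + 2) ^ k <= (sz (y, e) + 10) ^ k.
  by apply: leq_expn; rewrite sz_pair; lia.
case=> -[] e a b c d; rewrite code_pair cat_cons -catA; apply: ex_weak.
(* [true] has a three-bit code, of which two bits remain after the test and are popped here. *)
- apply: ex_popA; apply: ex_popA; apply: ex_seq; first by apply: ex_popA; apply: ex_skip.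
  apply: ex_seq; first by apply: ex_popA; apply: ex_skip.
  exact: Rg.
- by have := L true e m; move: (_ ^ _) (_ ^ _) (_ ^ _) => u v w; lia.
- by apply: ex_popA; apply: ex_popA; apply: Rh.
- by have := L false e n; move: (_ ^ _) (_ ^ _) (_ ^ _) => u v w; lia.
Qed.

End Branching.

Lemma size_le_sz (T : Type) {eT : Enc T} (l : seq T) : size l <= sz l.
Proof. by elim: l => //= x l IH; rewrite sz_cons; lia. Qed.

Section Fold.
Context {T U E : Type} {eT : Enc T} {eU : Enc U} {eE : Enc E}.
Variable g : T * (U * E) -> U.

(** Below the consumed list marker lie [x], the rest [l], the accumulator [u] and [e]. They are
    parked so that [l] is deepest and returns last; [e] is duplicated, and the two pushes build the
    code of [(x, (u, e))]. *)
Definition fold_body (p : cmd) : cmd :=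
  seqs [:: swap; mvB; mvB; mvB; dup; back sB; Push sA true; back sB; Push sA true; p; back sB].

Local Notation stepE e := (fun u x => g (x, (u, e))).

Lemma fold_loop p m e L l u a b c d : runs p g (fun y => (sz y + 2) ^ m) ->
  sz e <= L -> sz l <= L -> (forall n, sz (foldl (stepE e) u (take n l)) <= L) ->
  exec (While sA (fold_body p)) (code l ++ code u ++ code e ++ a, b, c, d)
    (size l * ((3 * L + 10) ^ m + 1000 * L.+1) + 1)
    (code (foldl (stepE e) u l) ++ code e ++ a, b, c, d).
Proof.
move=> R le_e; elim: l u => [|x l IH] u le_l H.
  by rewrite code_nil; exact: ex_while0.
rewrite code_cons cat_cons -catA; move: le_l; rewrite sz_cons => le_l.
have Hu := H 0; rewrite /= in Hu.
apply: ex_weak.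
  apply: (@ex_while1 _ _ _ (code x ++ code l ++ code u ++ code e ++ a)
     (code l ++ code (g (x, (u, e))) ++ code e ++ a, b, c, d)); first by [].
    rewrite /upd; do 4![apply: ex_seq; first by [apply: swap_ok | apply: mvB_ok]].
    apply: ex_seq; first exact: dup_ok.
    apply: ex_seq; first exact: backB; apply: ex_seq; first exact: ex_pushA.
    apply: ex_seq; first exact: backB; apply: ex_seq; first exact: ex_pushA.
    apply: ex_seq.
      pose proof (R (x, (u, e)) (code e ++ a) (park (code l) b) c d) as Rx.
      by move: Rx; rewrite !code_pair !cat_cons -!catA !cat_cons -!catA; apply.
    by apply: ex_seq; [exact: backB | exact: ex_skip].
  apply: IH; first lia.
  by move=> n; apply: (H n.+1).
have : (sz (x, (u, e)) + 2) ^ m <= (3 * L + 10) ^ m.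
  by apply: leq_expn; rewrite !sz_pair; lia.
rewrite -!/(code _) -!/(sz _) /=.
rewrite (mulSn (size l)); move: (_ ^ _) (_ ^ _) => v w; move: (size l * _) => z; lia.
Qed.

(** [B] bounds the accumulators of all initial segments, hence the cost of each turn; the cons
    markers of the list code drive the loop. *)
Lemma FPt_foldl (l : E -> seq T) (u : E -> U) (B : E -> nat) :
  FPt l -> FPt u -> FPt g -> pb sz B ->
  (forall e n, sz (foldl (stepE e) (u e) (take n (l e))) <= B e) ->
  FPt (fun e => foldl (stepE e) (u e) (l e)).
Proof.
move=> Fl Fu [p [m R]] pB HB.
have [q [tq [ptq Rq]]] := FPt_pb (FPt_pair Fl (FPt_pair Fu FPt_id)).
have psl := FPt_sz Fl.
pose (L := fun e => B e + sz e + sz (l e)).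
have pL : pb sz L by rewrite /L; pbt.
(* The first commands build [(l e, (u e, e))] and strip both pair markers; the list is set aside for
   a moment to reach the inner one. *)
apply: (@FPt_runs _ _ _ _
  (seqs [:: q; Case sA Skip mvB Skip; Case sA Skip (back sB) Skip; While sA (fold_body p);
    swap; drop_top]) _
  (fun e => tq e + (sz (l e) * ((3 * L e + 10) ^ m + 1000 * (L e + 1)) + 1000 * (L e + 1)))).
  by pbt.
move=> e a b c d.
have HL : forall n, sz (foldl (stepE e) (u e) (take n (l e))) <= L e.
  by move=> n; apply: leq_trans (HB e n) _; rewrite /L; lia.
apply: ex_weak.
  apply: ex_seq; first exact: Rq.
  rewrite !code_pair cat_cons -!catA cat_cons -!catA.
  apply: ex_seq; first by apply: ex_popA; exact: mvB_ok.
  apply: ex_seq; first by apply: ex_popA; exact: backB.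
  apply: ex_seq; first by apply: (@fold_loop _ _ _ (L e)) R _ _ HL; rewrite /L; lia.
  apply: ex_seq; first exact: swap_ok.
  by apply: ex_seq; [exact: drop_ok | exact: ex_skip].
have := HL (size (l e)); rewrite take_size; rewrite -!/(code _) -!/(sz _).
have : size (l e) * ((3 * L e + 10) ^ m + 1000 * (L e).+1) <=
   sz (l e) * ((3 * L e + 10) ^ m + 1000 * (L e + 1)).
  by apply: leq_mul; rewrite ?size_le_sz ?addn1.
have : sz e <= L e /\ sz (l e) <= L e by rewrite /L; lia.
case; move: (_ * (_ + _)) (_ * (_ + _)) => v w; lia.
Qed.

End Fold.

(** * Bit strings *)

(** A parked word comes back last bit first, which is the order in which list cells have to be
    pushed on top of the empty list. *)
Definition listB : cmd :=
  Seq (Push sA false) (While sB (Case sB (seqs [:: Push sA false; Push sA true])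
    (seqs [:: Push sA false; Push sA false; Push sA true; Push sA true]) Skip)).

Lemma listB_ok w a b c d :
  exec listB (a, park w b, c, d) (10 * size w + 2) (code w ++ a, b, c, d).
Proof.
apply: ex_weak.
  apply: ex_seq; first exact: ex_pushA.
  enough (H : forall v u, exec (While sB (Case sB (seqs [:: Push sA false; Push sA true])
    (seqs [:: Push sA false; Push sA false; Push sA true; Push sA true]) Skip))
    (code u ++ a, mark_bits v ++ false :: b, c, d) (10 * size v + 1) (code (catrev v u) ++ a, b, c, d)).
    by have := H (rev w) [::]; rewrite catrevE revK cats0; apply.
  elim=> [|x v IH] u; first exact: ex_while0.
  apply: ex_weak.
    apply: (@ex_while1 _ _ _ (x :: mark_bits v ++ false :: b)
      (code (x :: u) ++ a, mark_bits v ++ false :: b, c, d)); first by [].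
      apply: (@ex_case _ _ _ _ x (mark_bits v ++ false :: b)); first by [].
      apply: (@ex_weak _ _ 4); last exact: leqnn.
      rewrite code_cons cat_cons -catA.
      case: x; last by apply: ex_weak; [apply: ex_seq; [exact: ex_pushA | apply: ex_seq; [exact: ex_pushA | exact: ex_skip]] |].
      by do 4![apply: (@ex_seq _ _ _ _ _ 1 _ _ _); first exact: ex_pushA]; exact: ex_skip.
    exact: IH.
  by rewrite /=; lia.
by rewrite size_rev; lia.
Qed.

(** Turning a code into data reduces equality on every encoded type to equality of bit words. *)
Lemma FPt_code (T : Type) {eT : Enc T} : FPt (fun x : T => code x).
Proof.
apply: (@FPt_runs _ _ _ _ (Seq mvB listB) _ (fun x => 30 * sz x + 30 + (10 * sz x + 2))).
  by pbt.
by move=> x a b c d; apply: ex_seq; [apply: mvB_ok | apply: listB_ok].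
Qed.

Lemma sz_bits (w : seq bool) : sz w <= 4 * size w + 1.
Proof. by elim: w => // b w IH; rewrite sz_cons /=; have : sz b <= 3 by [case: b]; lia. Qed.

(** The raw input contains arbitrary bits and cannot drive a [While]; a flag on [sD] does, and it is
    not renewed once the input is exhausted. *)
Definition load : cmd :=
  seqs [:: Push sB false; Push sD true;
    While sD (Case sA (seqs [:: Push sB false; Push sB true; Push sD true])
      (seqs [:: Push sB true; Push sB true; Push sD true]) Skip); listB].

Lemma load_ok (x : seq bool) :
  exec load (x, [::], [::], [::]) (20 * size x + 20) (code x, [::], [::], [::]).
Proof.
apply: ex_weak.
  apply: ex_seq; first exact: ex_push; apply: ex_seq; first exact: ex_push.
  apply: (@ex_seq _ _ _ ([::], park x [::], [::], [::]) _ (8 * size x + 5)).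
    rewrite /upd /get /park.
    suff H v : exec (While sD (Case sA (seqs [:: Push sB false; Push sB true; Push sD true])
        (seqs [:: Push sB true; Push sB true; Push sD true]) Skip))
        (x, mark_bits v ++ [:: false], [::], [:: true]) (8 * size x + 5)
        ([::], mark_bits (rev x ++ v) ++ [:: false], [::], [::]).
      by have := H [::]; rewrite cats0.
    elim: x v => [|b x IH] v.
      apply: ex_weak; first apply: (@ex_while1 _ _ _ [::] ([::], mark_bits v ++ [:: false], [::], [::])).
      - by [].
      - by apply: ex_caseE; [by [] | apply: ex_skip].
      - by apply: ex_whileE.
      - by [].
    apply: ex_weak.
      apply: (@ex_while1 _ _ _ [::] (x, mark_bits (b :: v) ++ [:: false], [::], [:: true])); first by [].
        apply: (@ex_case _ _ _ _ b x); first by [].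
        apply: (@ex_weak _ _ 3); last exact: leqnn.
        by case: b; (apply: ex_weak; first straight).
      by rewrite rev_cons cat_rcons; apply: IH.
    by rewrite /=; lia.
  apply: ex_seq; last exact: ex_skip.
  by have := listB_ok x [::] [::] [::] [::]; rewrite cats0; apply.
lia.
Qed.

Definition unload : cmd :=
  seqs [:: Push sB false;
    While sA (Case sA (seqs [:: Push sB false; Push sB true])
      (seqs [:: Case sA Skip Skip Skip; Case sA Skip Skip Skip; Push sB true; Push sB true]) Skip);
    back sB].

Lemma unload_ok (w : seq bool) :
  exec unload (code w, [::], [::], [::]) (20 * size w + 20) (w, [::], [::], [::]).
Proof.
apply: ex_weak.
  apply: ex_seq; first exact: ex_push.
  apply: (@ex_seq _ _ _ ([::], park w [::], [::], [::]) _ (12 * size w + 5)).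
    rewrite /upd /get /park.
    enough (H : forall v, exec (While sA (Case sA (seqs [:: Push sB false; Push sB true])
        (seqs [:: Case sA Skip Skip Skip; Case sA Skip Skip Skip; Push sB true; Push sB true]) Skip))
        (code w, mark_bits v ++ [:: false], [::], [::]) (12 * size w + 5)
        ([::], mark_bits (rev w ++ v) ++ [:: false], [::], [::])).
      by have := H [::]; rewrite cats0.
    elim: w => [|b w IH] v.
      by apply: ex_weak; first exact: ex_while0.
    rewrite code_cons; apply: ex_weak.
      apply: (@ex_while1 _ _ _ (code b ++ code w) (code w, mark_bits (b :: v) ++ [:: false], [::], [::])).
      - by [].
      - apply: (@ex_weak _ _ 8); last exact: leqnn; case: b.
        + apply: ex_weak; first apply: ex_popA.
            apply: ex_seq; first by apply: ex_popA; apply: ex_skip.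
            apply: ex_seq; first by apply: ex_popA; apply: ex_skip.
            by straight.
          by [].
        + by apply: ex_weak; first (apply: ex_popA; straight).
      - by rewrite rev_cons cat_rcons; apply: IH.
    by rewrite /=; lia.
  apply: ex_seq; last exact: ex_skip.
  by have := backB w [::] [::] [::] [::]; rewrite cats0; apply.
lia.
Qed.

Theorem FPt_tm (f : seq bool -> seq bool) : FPt f ->
  exists M c d, forall x, let cf := run M (poly c d (size x)) x in
    [/\ halting (cstate cf), out_bits cf.2 = f x & (val (cstate cf) = 1 <-> last false (f x))].
Proof.
move=> Ff; have Fs := FPt_sz Ff; case: (FPt_pb Ff) => p [tm [ptm R]].
have psz : pb size (fun x : seq bool => sz x).
  by apply: pb_le sz_bits _; pbt.
apply: (@cmd_tm (seqs [:: load; p; unload]) f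
  (fun x => 20 * size x + 20 + (tm x + (20 * sz (f x) + 20)))).
  pbt; [exact: pb_comp ptm psz | exact: pb_comp Fs psz].
move=> x; apply: ex_weak.
  apply: ex_seq; first exact: load_ok.
  apply: ex_seq; first by have := R x [::] [::] [::] [::]; rewrite !cats0; apply.
  by apply: ex_seq; [exact: unload_ok | exact: ex_skip].
by pose proof (size_le_sz (f x)); lia.
Qed.

Corollary FPt_FP (f : seq bool -> seq bool) : FPt f -> FP f.
Proof. by case/FPt_tm=> M [c [d H]]; exists M, c, d => x; case: (H x). Qed.

(** * Closure of [FPt] under operations on lists, numbers and equality tests *)

Section Basics.
Context {T U W E : Type} {eT : Enc T} {eU : Enc U} {eW : Enc W} {eE : Enc E}.

Lemma FPt_fst_of (f : E -> T * U) : FPt f -> FPt (fun e => (f e).1).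
Proof. by move=> Ff; apply: FPt_comp Ff FPt_fst. Qed.

Lemma FPt_snd_of (f : E -> T * U) : FPt f -> FPt (fun e => (f e).2).
Proof. by move=> Ff; apply: FPt_comp Ff FPt_snd. Qed.

Lemma FPt_cons (f : E -> T) (g : E -> seq T) : FPt f -> FPt g -> FPt (fun e => f e :: g e).
Proof.
move=> Ff Fg; apply: (FPt_comp (g := fun p : T * seq T => p.1 :: p.2)) (FPt_pair Ff Fg) _.
exact: FPt_cast.
Qed.

Lemma FPt_S (f : E -> nat) : FPt f -> FPt (fun e => (f e).+1).
Proof.
move=> Ff; apply: (FPt_comp (g := fun p : unit * nat => p.2.+1)) (FPt_pair (FPt_const tt) Ff) _.
by apply: FPt_cast => -[[] y].
Qed.

Lemma FPt_inl (f : E -> T) : FPt f -> FPt (fun e => inl U (f e)).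
Proof.
move=> Ff; apply: (FPt_comp (g := fun p : unit * T => inl U p.2)) (FPt_pair (FPt_const tt) Ff) _.
by apply: FPt_cast => -[[] y].
Qed.

Lemma FPt_inr (f : E -> U) : FPt f -> FPt (fun e => inr T (f e)).
Proof.
move=> Ff; apply: (FPt_comp (g := fun p : (unit * unit) * U => inr T p.2))
  (FPt_pair (FPt_const (tt, tt)) Ff) _.
by apply: FPt_cast => -[[[] []] y].
Qed.

Lemma FPt_negb (f : E -> bool) : FPt f -> FPt (fun e => ~~ f e).
Proof. by move=> Ff; apply: (FPt_if Ff (FPt_const false) (FPt_const true)). Qed.

Lemma FPt_andb (f g : E -> bool) : FPt f -> FPt g -> FPt (fun e => f e && g e).
Proof. by move=> Ff Fg; apply: (FPt_if Ff Fg (FPt_const false)). Qed.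

Lemma FPt_orb (f g : E -> bool) : FPt f -> FPt g -> FPt (fun e => f e || g e).
Proof. by move=> Ff Fg; apply: (FPt_if Ff (FPt_const true) Fg). Qed.

Lemma FPt_addb (f g : E -> bool) : FPt f -> FPt g -> FPt (fun e => f e (+) g e).
Proof. by move=> Ff Fg; apply: FPt_ext (FPt_if Ff (FPt_negb Fg) Fg) => e; case: (f e). Qed.

End Basics.

Section Basics2.
Context {T E : Type} {eT : Enc T} {eE : Enc E}.

Lemma FPt_behead (f : E -> seq T) : FPt f -> FPt (fun e => behead (f e)).
Proof.
move=> Ff; apply: (FPt_ext (f := fun e => if f e is _ :: l then l else [::])).
  by move=> e; case: (f e).
exact (FPt_case (g := fun p : (T * seq T) * E => p.1.2) Ff (FPt_const [::])
  (FPt_snd_of FPt_fst)).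
Qed.

Lemma FPt_head (x : T) (f : E -> seq T) : FPt f -> FPt (fun e => head x (f e)).
Proof.
move=> Ff; apply: (FPt_ext (f := fun e => if f e is y :: _ then y else x)).
  by move=> e; case: (f e).
exact (FPt_case (g := fun p : (T * seq T) * E => p.1.1) Ff (FPt_const x)
  (FPt_fst_of FPt_fst)).
Qed.

End Basics2.

Lemma FPt_fold (T U E : Type) {eT : Enc T} {eU : Enc U} {eE : Enc E}
    (h : E -> U -> T -> U) (u : E -> U) (l : E -> seq T) (B : E -> nat) :
  FPt (fun p : T * (U * E) => h p.2.2 p.2.1 p.1) -> FPt u -> FPt l -> pb sz B ->
  (forall e n, sz (foldl (h e) (u e) (take n (l e))) <= B e) ->
  FPt (fun e => foldl (h e) (u e) (l e)).
Proof.
by move=> Fh Fu Fl pB HB; apply: (FPt_foldl (g := fun p => h p.2.2 p.2.1 p.1) Fl Fu Fh pB HB).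
Qed.

Section Sizes.
Context {T : Type} {eT : Enc T}.

Lemma sz_nil : sz (Nil T) = 1. Proof. by []. Qed.

Lemma sz_catS (l1 l2 : seq T) : (sz (l1 ++ l2)).+1 = sz l1 + sz l2.
Proof. by elim: l1 => [|x l IH] //=; rewrite !sz_cons; lia. Qed.

Lemma sz_rev (l : seq T) : sz (rev l) = sz l.
Proof.
elim: l => [//|x l IH]; rewrite rev_cons -cats1; apply: succn_inj.
by rewrite sz_catS IH !sz_cons sz_nil; lia.
Qed.

Lemma sz_take n (l : seq T) : sz (take n l) <= sz l.
Proof. by elim: l n => [|x l IH] [|n] //=; rewrite !sz_cons ?sz_nil; have := IH n; lia. Qed.

Lemma sz_drop n (l : seq T) : sz (drop n l) <= sz l.
Proof. by elim: l n => [|x l IH] [|n] //=; rewrite !sz_cons ?sz_nil; have := IH n; lia. Qed.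

End Sizes.

Lemma sz_nat (n : nat) : sz n = (2 * n).+1.
Proof.
elim: n => [//|n IH]; have -> : sz n.+1 = (sz n).+2 by [].
by rewrite IH mulnS.
Qed.

Lemma sz_map_le (T U : Type) {eT : Enc T} {eU : Enc U} (f : T -> U) (l : seq T) B :
  (forall x, sz x <= sz l -> sz (f x) <= B) -> sz (map f l) <= size l * B.+1 + 1.
Proof.
elim: l => //= x l IH H; rewrite sz_cons.
have Hx : sz (f x) <= B by apply: H; rewrite sz_cons; lia.
have : sz (map f l) <= size l * B.+1 + 1 by apply: IH => y ly; apply: H; rewrite sz_cons; lia.
lia.
Qed.

Lemma FPt_rev (T E : Type) {eT : Enc T} {eE : Enc E} (l : E -> seq T) : FPt l -> FPt (fun e => rev (l e)).
Proof.
move=> Fl; apply: (FPt_ext (f := fun e => foldl (fun u x => x :: u) [::] (l e))).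
  move=> e; rewrite -[LHS]revK -[X in rev (X)]revK; congr rev.
  by rewrite revK; elim/last_ind: (l e) => // s x IH; rewrite -cats1 foldl_cat /= rev_cons IH cats1.
apply: (@FPt_fold _ _ _ _ _ _ (fun _ u x => x :: u) _ l (fun e => sz (l e))) => //.
- by apply: FPt_cons; [exact: FPt_fst | exact: FPt_fst_of FPt_snd].
- exact: FPt_const.
- exact: FPt_sz.
- move=> e n; apply: leq_trans (sz_take n (l e)); rewrite -(sz_rev (take n (l e))).
  suff -> : forall s u : seq T, foldl (fun u x => x :: u) u s = catrev s u by rewrite catrevE cats0.
  by elim=> //= x s IH u; rewrite IH.
Qed.

Lemma FPt_cat (T E : Type) {eT : Enc T} {eE : Enc E} (f g : E -> seq T) : FPt f -> FPt g -> FPt (fun e => f e ++ g e).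
Proof.
move=> Ff Fg; have C : forall (s u : seq T), foldl (fun u x => x :: u) u s = catrev s u.
  by elim=> //= x s IH u; rewrite IH.
apply: (FPt_ext (f := fun e => foldl (fun u x => x :: u) (g e) (rev (f e)))).
  by move=> e; rewrite C catrevE revK.
apply: (@FPt_fold _ _ _ _ _ _ (fun _ u x => x :: u) _ _ (fun e => sz (f e) + sz (g e))) => //.
- by apply: FPt_cons; [exact: FPt_fst | exact: FPt_fst_of FPt_snd].
- exact: FPt_rev.
- by apply: pb_add; exact: FPt_sz.
- move=> e n; rewrite C catrevE; apply: leq_trans (leqnSn _) _; rewrite sz_catS sz_rev leq_add2r.
  by apply: leq_trans (sz_take _ _) _; rewrite sz_rev.
Qed.

Lemma FPt_map (T U E : Type) {eT : Enc T} {eU : Enc U} {eE : Enc E} (f : E -> T -> U) (l : E -> seq T) :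
  FPt (fun p : T * E => f p.2 p.1) -> FPt l -> FPt (fun e => map (f e) (l e)).
Proof.
move=> Ff Fl; have C : forall e (s : seq T) u, foldl (fun u x => f e x :: u) u s = catrev (map (f e) s) u.
  by move=> e; elim=> //= x s IH u; rewrite IH.
apply: (FPt_ext (f := fun e => rev (foldl (fun u x => f e x :: u) [::] (l e)))).
  by move=> e; rewrite C catrevE cats0 revK.
case: (FPt_sz Ff) => d Hd; apply: FPt_comp; last exact: (FPt_rev FPt_id).
apply: (@FPt_fold _ _ _ _ _ _ (fun e u x => f e x :: u) _ _
  (fun e => sz (l e) * ((sz (l e) + sz e + 3) ^ d + 1) + 1)) => //.
- apply: FPt_cons; last exact: FPt_fst_of FPt_snd.
  exact: (FPt_comp (FPt_pair FPt_fst (FPt_snd_of FPt_snd)) Ff).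
- exact: FPt_const.
- by have Hl := FPt_sz Fl; pbt.
- move=> e n; rewrite C catrevE cats0 sz_rev (addn1 (_ ^ d)).
  apply: leq_trans (@sz_map_le _ _ _ _ _ _ ((sz (l e) + sz e + 3) ^ d) _) _.
    move=> x lx; apply: leq_trans (Hd (x, e)) _; apply: leq_expn; rewrite sz_pair.
    by have := leq_trans lx (sz_take n (l e)); lia.
  rewrite leq_add2r leq_mul2r; apply/orP; right.
  by apply: leq_trans (size_le_sz _) (sz_take _ _).
Qed.

Lemma sz_flatten (T : Type) {eT : Enc T} (s : seq (seq T)) : sz (flatten s) <= sz s.
Proof.
elim: s => //= l s IH; rewrite sz_cons; pose proof (sz_catS l (flatten s)); lia.
Qed.

Lemma FPt_flatten (T E : Type) {eT : Enc T} {eE : Enc E} (f : E -> seq (seq T)) : FPt f -> FPt (fun e => flatten (f e)).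
Proof.
move=> Ff; have C : forall (s : seq (seq T)) u, foldl (fun u x => u ++ x) u s = u ++ flatten s.
  by elim=> /= [|x s IH] u; rewrite ?cats0 // IH catA.
apply: (FPt_ext (f := fun e => foldl (fun u x => u ++ x) [::] (f e))).
  by move=> e; rewrite C.
apply: (@FPt_fold _ _ _ _ _ _ (fun _ u x => u ++ x) _ _ (fun e => sz (f e))) => //.
- by apply: FPt_cat; [exact: FPt_fst_of FPt_snd | exact: FPt_fst].
- exact: FPt_const.
- exact: FPt_sz.
- by move=> e n; rewrite C; apply: leq_trans (sz_flatten _) (sz_take _ _).
Qed.

Lemma FPt_filter (T E : Type) {eT : Enc T} {eE : Enc E} (p : E -> T -> bool) (l : E -> seq T) :
  FPt (fun q : T * E => p q.2 q.1) -> FPt l -> FPt (fun e => filter (p e) (l e)).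
Proof.
move=> Fp Fl; apply: (FPt_ext (f := fun e => flatten [seq if p e x then [:: x] else [::] | x <- l e])).
  by move=> e; elim: (l e) => //= x s ->; case: (p e x).
apply: FPt_flatten; apply: (FPt_map (f := fun e x => if p e x then [:: x] else [::])) Fl.
exact: (FPt_if Fp (FPt_cons FPt_fst (FPt_const [::])) (FPt_const [::])).
Qed.

Lemma FPt_has (T E : Type) {eT : Enc T} {eE : Enc E} (p : E -> T -> bool) (l : E -> seq T) :
  FPt (fun q : T * E => p q.2 q.1) -> FPt l -> FPt (fun e => has (p e) (l e)).
Proof.
move=> Fp Fl; apply: (FPt_ext (f := fun e => if filter (p e) (l e) is _ :: _ then true else false)).
  by move=> e /=; elim: (l e) => //= x s; case: (p e x).
exact: (FPt_case (g := fun=> true) (FPt_filter Fp Fl) (FPt_const false) (FPt_const true)).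
Qed.

Lemma FPt_all (T E : Type) {eT : Enc T} {eE : Enc E} (p : E -> T -> bool) (l : E -> seq T) :
  FPt (fun q : T * E => p q.2 q.1) -> FPt l -> FPt (fun e => all (p e) (l e)).
Proof.
move=> Fp Fl; apply: (FPt_ext (f := fun e => ~~ has (fun x => ~~ p e x) (l e))).
  by move=> e /=; elim: (l e) => //= x s <-; case: (p e x).
by apply: FPt_negb; apply: FPt_has Fl; apply: FPt_negb.
Qed.

Lemma FPt_size (T E : Type) {eT : Enc T} {eE : Enc E} (l : E -> seq T) : FPt l -> FPt (fun e => size (l e)).
Proof.
move=> Fl; apply: (FPt_ext (f := fun e => size [seq tt | x <- l e])).
  by move=> e /=; rewrite size_map.
apply: (FPt_comp (g := @size unit)); first exact: (FPt_map (f := fun _ _ => tt) (FPt_const tt) Fl).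
by apply: FPt_cast; elim=> [|[] s /= ->].
Qed.

Lemma FPt_nseq (T E : Type) {eT : Enc T} {eE : Enc E} (x : E -> T) (n : E -> nat) : FPt x -> FPt n -> FPt (fun e => nseq (n e) (x e)).
Proof.
move=> Fx Fn; apply: (FPt_ext (f := fun e => [seq x e | _ <- nseq (n e) tt])).
  by move=> e /=; rewrite map_nseq.
apply: (FPt_map (f := fun e _ => x e)); first exact: (FPt_comp FPt_snd Fx).
apply: (FPt_comp Fn (g := fun k => nseq k tt)).
by apply: FPt_cast; elim=> // k /= ->.
Qed.

Lemma FPt_addn (E : Type) {eE : Enc E} (m n : E -> nat) : FPt m -> FPt n -> FPt (fun e => m e + n e).
Proof.
move=> Fm Fn; apply: (FPt_ext (f := fun e => size (nseq (m e) tt ++ nseq (n e) tt))).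
  by move=> e /=; rewrite size_cat !size_nseq.
by apply: FPt_size; apply: FPt_cat; apply: FPt_nseq => //; apply: FPt_const.
Qed.

Lemma FPt_muln (E : Type) {eE : Enc E} (m n : E -> nat) : FPt m -> FPt n -> FPt (fun e => m e * n e).
Proof.
move=> Fm Fn; apply: (FPt_ext (f := fun e => size (flatten (nseq (m e) (nseq (n e) tt))))).
  by move=> e; elim: (m e) => //= k IH; rewrite size_cat IH size_nseq mulSn.
apply: FPt_size; apply: FPt_flatten; apply: FPt_nseq => //; apply: FPt_nseq => //.
exact: FPt_const.
Qed.

Lemma FPt_expn (E : Type) {eE : Enc E} (m : E -> nat) d : FPt m -> FPt (fun e => m e ^ d).
Proof.
move=> Fm; elim: d => [|d IH]; first exact: FPt_const 1.
by apply: FPt_ext (FPt_muln Fm IH) => e; rewrite expnS.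
Qed.

Lemma FPt_poly (E : Type) {eE : Enc E} c d (m : E -> nat) : FPt m -> FPt (fun e => poly c d (m e)).
Proof.
move=> Fm; apply: FPt_addn (FPt_const c); apply: FPt_muln (FPt_const c) _.
exact: FPt_expn.
Qed.

(** No counter is carried along: the next number is the length of the list built so far. *)
Lemma FPt_iota0 (E : Type) {eE : Enc E} (n : E -> nat) : FPt n -> FPt (fun e => iota 0 (n e)).
Proof.
move=> Fn; have C k : foldl (fun u (x : unit) => size u :: u) [::] (nseq k tt) = rev (iota 0 k).
  elim: k => // k IH; rewrite -[k.+1]addn1 nseqD foldl_cat IH /= size_rev size_iota.
  by rewrite iotaD rev_cat.
apply: (FPt_ext (f := fun e => rev (foldl (fun u (x : unit) => size u :: u) [::] (nseq (n e) tt)))).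
  by move=> e; rewrite C revK.
apply: FPt_rev; apply: (@FPt_fold _ _ _ _ _ _ (fun _ u x => size u :: u) _ _
  (fun e => n e * (2 * n e + 2) + 1)) => //.
- apply: FPt_cons; last exact: FPt_fst_of FPt_snd.
  by apply: FPt_size; exact: FPt_fst_of FPt_snd.
- exact: FPt_const.
- by apply: FPt_nseq Fn; apply: FPt_const.
- have pn : pb sz n by apply: pb_le (FPt_sz Fn) => e; rewrite sz_nat; lia.
  by pbt.
- move=> e k.
  have -> : take k (nseq (n e) tt) = nseq (minn k (n e)) tt by elim: (n e) k => [|m IH] [|k] //=; rewrite ?minn0 ?minnSS //= IH.
  rewrite C sz_rev; apply: (@leq_trans (minn k (n e) * (2 * n e + 2) + 1)); last first.
    by rewrite leq_add2r leq_mul2r geq_minr orbT.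
  have H : forall s : seq nat, all (fun i => i < n e) s -> sz s <= size s * (2 * n e + 2) + 1.
    by elim=> //= i s IH /andP[lt /IH le_s]; rewrite sz_cons sz_nat; lia.
  rewrite -[X in X * _](size_iota 0); apply: H.
  by apply/allP => i; rewrite mem_iota add0n => /andP[_ lt]; apply: leq_trans lt (geq_minr _ _).
Qed.

Lemma FPt_allpairs (T U W E : Type) {eT : Enc T} {eU : Enc U} {eW : Enc W} {eE : Enc E}
    (f : E -> T -> U -> W) (s : E -> seq T) (t : E -> T -> seq U) :
  FPt (fun q : U * (T * E) => f q.2.2 q.2.1 q.1) -> FPt s -> FPt (fun q : T * E => t q.2 q.1) ->
  FPt (fun e => [seq f e x y | x <- s e, y <- t e x]).
Proof.
move=> Ff Fs Ft; apply: FPt_flatten.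
apply: (FPt_map (f := fun e x => [seq f e x y | y <- t e x])) Fs.
exact: (FPt_map (f := fun (q : T * E) y => f q.2 q.1 y)) Ft.
Qed.

Lemma FPt_drop (T E : Type) {eT : Enc T} {eE : Enc E} (n : E -> nat) (s : E -> seq T) :
  FPt n -> FPt s -> FPt (fun e => drop (n e) (s e)).
Proof.
move=> Fn Fs; have C k (s0 : seq T) : foldl (fun u (x : unit) => behead u) s0 (nseq k tt) = drop k s0.
  by elim: k s0 => [|k IH] [|y s0] //=; rewrite ?drop0 // IH //; case: k {IH}.
apply: (FPt_ext (f := fun e => foldl (fun u (x : unit) => behead u) (s e) (nseq (n e) tt))).
  by move=> e; rewrite C.
apply: (@FPt_fold _ _ _ _ _ _ (fun _ u x => behead u) _ _ (fun e => sz (s e))) => //.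
- by apply: FPt_behead; exact: FPt_fst_of FPt_snd.
- by apply: FPt_nseq Fn; apply: FPt_const.
- exact: FPt_sz.
- move=> e k.
  have -> : take k (nseq (n e) tt) = nseq (minn k (n e)) tt.
    by elim: (n e) k => [|m IH] [|k] //=; rewrite ?minn0 ?minnSS //= IH.
  by rewrite C; apply: sz_drop.
Qed.

Lemma FPt_nth (T E : Type) {eT : Enc T} {eE : Enc E} (x0 : T) (s : E -> seq T) (i : E -> nat) :
  FPt s -> FPt i -> FPt (fun e => nth x0 (s e) (i e)).
Proof.
move=> Fs Fi; apply: (FPt_ext (f := fun e => head x0 (drop (i e) (s e)))).
  by move=> e /=; rewrite -nth0 nth_drop addn0.
by apply: FPt_head; apply: FPt_drop.
Qed.

Lemma FPt_eqb (E : Type) {eE : Enc E} (f g : E -> bool) : FPt f -> FPt g -> FPt (fun e => f e == g e).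
Proof. by move=> Ff Fg; apply: FPt_ext (FPt_if Ff Fg (FPt_negb Fg)) => e; case: (f e); case: (g e). Qed.

Definition eqw_step (u : seq bool * bool) (x : bool) : seq bool * bool :=
  if u.1 is y :: r then (r, u.2 && (x == y)) else ([::], false).

Lemma eqw_foldl (v w : seq bool) b :
  (foldl eqw_step (w, b) v).2 && nilp (foldl eqw_step (w, b) v).1 = b && (v == w).
Proof.
have F0 s : foldl eqw_step ([::], false) s = ([::], false) by elim: s.
elim: v w b => [|x v IH] [|y w] b //=; first by rewrite F0 andbF.
have -> : eqw_step (y :: w, b) x = (w, b && (x == y)) by [].
by rewrite IH eqseq_cons andbA.
Qed.

Lemma FPt_eqw (E : Type) {eE : Enc E} (f g : E -> seq bool) :
  FPt f -> FPt g -> FPt (fun e => f e == g e).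
Proof.
move=> Ff Fg.
apply: (FPt_ext (f := fun e => (foldl eqw_step (g e, true) (f e)).2 && nilp (foldl eqw_step (g e, true) (f e)).1)).
  by move=> e; rewrite eqw_foldl.
have F : FPt (fun e => foldl eqw_step (g e, true) (f e)).
  apply: (@FPt_fold _ _ _ _ _ _ (fun _ => eqw_step) _ _ (fun e => sz (g e) + 4)) => //.
  - apply: (FPt_case (l := fun p : bool * ((seq bool * bool) * E) => p.2.1.1)
      (g := fun p : (bool * seq bool) * (bool * ((seq bool * bool) * E)) =>
        (p.1.2, p.2.2.1.2 && (p.2.1 == p.1.1)))).
    + exact: FPt_fst_of (FPt_fst_of FPt_snd).
    + exact: FPt_const.
    + apply: FPt_pair; first exact: FPt_snd_of FPt_fst.
      apply: FPt_andb; first exact: FPt_snd_of (FPt_fst_of (FPt_snd_of FPt_snd)).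
      by apply: FPt_eqb; [exact: FPt_fst_of FPt_snd | exact: FPt_fst_of FPt_fst].
  - by apply: FPt_pair Fg _; apply: FPt_const.
  - by have Hg := FPt_sz Fg; pbt.
  - move=> e n; have szb : forall b : bool, sz b <= 3 by case.
    elim: (take n (f e)) (g e) true => [|x s IH] w b.
      by rewrite /= sz_pair; have := szb b; lia.
    case: w => [|y w]; first exact: IH [::] false.
    by apply: leq_trans (IH w (b && (x == y))) _; rewrite sz_cons; lia.
apply: FPt_andb; first exact: (FPt_comp F FPt_snd).
apply: (FPt_ext (f := fun e => if (foldl eqw_step (g e, true) (f e)).1 is _ :: _ then false else true)).
  by move=> e; case: (foldl _ _ _) => [[]].
exact: (FPt_case (g := fun=> false) (FPt_fst_of F) (FPt_const true) (FPt_const false)).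
Qed.

Lemma FPt_eq (T : eqType) (E : Type) {eT : Enc T} {eE : Enc E} (f g : E -> T) :
  FPt f -> FPt g -> FPt (fun e => f e == g e).
Proof.
move=> Ff Fg; apply: (FPt_ext (f := fun e => code (f e) == code (g e))).
  by move=> e; apply/eqP/eqP => [E0|-> //]; apply: code_inj E0.
by apply: FPt_eqw; [exact: FPt_comp Ff FPt_code | exact: FPt_comp Fg FPt_code].
Qed.

Lemma FPt_mem (T : eqType) (E : Type) {eT : Enc T} {eE : Enc E} (x : E -> T) (s : E -> seq T) :
  FPt x -> FPt s -> FPt (fun e => x e \in s e).
Proof.
move=> Fx Fs; apply: (FPt_ext (f := fun e => has (fun y => y == x e) (s e))).
  by move=> e; rewrite has_pred1.
apply: (FPt_has (p := fun e y => y == x e)) Fs.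
by apply: FPt_eq; [exact: FPt_fst | exact: FPt_comp FPt_snd Fx].
Qed.

Lemma FPt_undup (T : eqType) (E : Type) {eT : Enc T} {eE : Enc E} (s : E -> seq T) :
  FPt s -> FPt (fun e => undup (s e)).
Proof.
move=> Fs; have C (r : seq T) : foldl (fun u x => if x \in u then u else x :: u) [::] (rev r) = undup r.
  rewrite foldl_rev; elim: r => //= x r ->; rewrite mem_undup; by [].
apply: (FPt_ext (f := fun e => foldl (fun u x => if x \in u then u else x :: u) [::] (rev (s e)))).
  by move=> e; rewrite C.
apply: (@FPt_fold _ _ _ _ _ _ (fun _ u x => if x \in u then u else x :: u) _ _ (fun e => sz (s e))) => //.
- apply: FPt_if; first by apply: FPt_mem; [exact: FPt_fst | exact: FPt_fst_of FPt_snd].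
  + exact: FPt_fst_of FPt_snd.
  + by apply: FPt_cons; [exact: FPt_fst | exact: FPt_fst_of FPt_snd].
- exact: FPt_const.
- exact: FPt_rev.
- exact: FPt_sz.
- move=> e n; rewrite -(revK (take n _)) C; apply: (@leq_trans (sz (rev (take n (rev (s e)))))).
    elim: (rev _) => //= x r IH; case: ifP => _; rewrite !sz_cons; lia.
  by rewrite sz_rev; apply: leq_trans (sz_take _ _) _; rewrite sz_rev.
Qed.

(** Directed by the head symbol. Two-index comprehensions are matched before plain [flatten], and
    whatever remains is taken to be a conditional. *)
Ltac fpt_step :=
  cbv beta;
  lazymatch goal with
  | |- FPt (fun e => e) => exact FPt_id
  | |- FPt fst => exact FPt_fst
  | |- FPt snd => exact FPt_snd
  | |- FPt (fun _ => ?c) => exact (FPt_const c)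
  | |- FPt (fun e => (@?f e, @?g e)) => apply (FPt_pair (f := f) (g := g))
  | |- FPt (fun e => (@?f e).1) => apply (FPt_fst_of (f := f))
  | |- FPt (fun e => (@?f e).2) => apply (FPt_snd_of (f := f))
  | |- FPt (fun e => @?f e :: @?g e) => apply (FPt_cons (f := f) (g := g))
  | |- FPt (fun e => (@?f e).+1) => apply (FPt_S (f := f))
  | |- FPt (fun e => inl (@?f e)) => apply (FPt_inl (f := f))
  | |- FPt (fun e => inr (@?f e)) => apply (FPt_inr (f := f))
  | |- FPt (fun e => ~~ @?f e) => apply (FPt_negb (f := f))
  | |- FPt (fun e => @?f e && @?g e) => apply (FPt_andb (f := f) (g := g))
  | |- FPt (fun e => @?f e || @?g e) => apply (FPt_orb (f := f) (g := g))
  | |- FPt (fun e => @?f e (+) @?g e) => apply (FPt_addb (f := f) (g := g))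
  | |- FPt (fun e => behead (@?f e)) => apply (FPt_behead (f := f))
  | |- FPt (fun e => rev (@?f e)) => apply (FPt_rev (l := f))
  | |- FPt (fun e => @?f e ++ @?g e) => apply (FPt_cat (f := f) (g := g))
  | |- FPt (fun e => flatten (map (fun x => map (fun y => @?f e x y) (@?t e x)) (@?s e))) =>
      apply (FPt_allpairs (f := f) (s := s) (t := t))
  | |- FPt (fun e => flatten (@?f e)) => apply (FPt_flatten (f := f))
  | |- FPt (fun e => map (fun x => @?f e x) (@?l e)) => apply (FPt_map (f := f) (l := l))
  | |- FPt (fun e => filter (fun x => @?f e x) (@?l e)) => apply (FPt_filter (p := f) (l := l))
  | |- FPt (fun e => has (fun x => @?f e x) (@?l e)) => apply (FPt_has (p := f) (l := l))
  | |- FPt (fun e => all (fun x => @?f e x) (@?l e)) => apply (FPt_all (p := f) (l := l))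
  | |- FPt (fun e => size (@?l e)) => apply (FPt_size (l := l))
  | |- FPt (fun e => nseq (@?n e) (@?x e)) => apply (FPt_nseq (n := n) (x := x))
  | |- FPt (fun e => @?f e + @?g e) => apply (FPt_addn (m := f) (n := g))
  | |- FPt (fun e => @?f e * @?g e) => apply (FPt_muln (m := f) (n := g))
  | |- FPt (fun e => poly ?c ?d (@?g e)) => apply (FPt_poly c d (m := g))
  | |- FPt (fun e => iota 0 (@?n e)) => apply (FPt_iota0 (n := n))
  | |- FPt (fun e => drop (@?n e) (@?s e)) => apply (FPt_drop (n := n) (s := s))
  | |- FPt (fun e => nth ?x0 (@?s e) (@?i e)) => apply (FPt_nth x0 (s := s) (i := i))
  | |- FPt (fun e => @?f e == @?g e) => apply (FPt_eq (f := f) (g := g))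
  | |- FPt (fun e => in_mem (@?f e) (mem (@?s e))) => apply (FPt_mem (x := f) (s := s))
  | |- FPt (fun e => undup (@?s e)) => apply (FPt_undup (s := s))
  | |- _ => refine (FPt_if _ _ _)
  end.
Ltac fpt_hook := fail.
Ltac fpt := repeat first
  [ assumption
  | fpt_hook
  | match goal with
    | H : FPt ?f |- FPt (fun e => ?f (@?a e)) => apply (FPt_comp (f := a) (g := f)); [|exact H]
    end
  | fpt_step ].

Corollary FPt_inP (f : seq bool -> bool) (L : language) :
  FPt f -> (forall x, L x <-> f x) -> inP L.
Proof.
move=> Ff HL; have Fg : FPt (fun x => [:: f x]) by fpt.
case: (FPt_tm Fg) => M [c [d H]].
exists M, c, d => x cf; case: (H x) => h _ v; split=> //.
by rewrite HL.
Qed.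

(** * Binary encodings *)

(** Binary increment, least significant bit first; the state is the carry and the reversed
    output. *)
Definition incr_step (u : bool * seq bool) (b : bool) : bool * seq bool :=
  (u.1 && b, (u.1 (+) b) :: u.2).

Definition incr_bits (w : seq bool) : seq bool :=
  let u := foldl incr_step (true, [::]) w in rev (if u.1 then true :: u.2 else u.2).

Fixpoint incr_rec (w : seq bool) : seq bool :=
  if w is b :: r then if b then false :: incr_rec r else true :: r else [:: true].

Lemma incr_bitsE w : incr_bits w = incr_rec w.
Proof.
have F s u : foldl incr_step (false, u) s = (false, catrev s u) by elim: s u => //= b s IH u; rewrite IH.
rewrite /incr_bits.
suff H v : rev (let u := foldl incr_step (true, v) w in if u.1 then true :: u.2 else u.2) =
   rev v ++ incr_rec w by rewrite H.
elim: w v => [|b w IH] v /=; first by rewrite rev_cons cats1.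
case: b; rewrite /incr_step /=; first by rewrite IH rev_cons cat_rcons.
by rewrite F /= catrevE rev_cat revK rev_cons cat_rcons.
Qed.

Lemma nat_bitsS n : nat_bits n.+1 = incr_bits (nat_bits n).
Proof.
rewrite incr_bitsE /nat_bits Nnat.Nat2N.inj_succ; case: (BinNat.N.of_nat n) => //= p.
by elim: p => //= p ->.
Qed.

Lemma size_incr_bits w : size (incr_bits w) <= (size w).+1.
Proof. by rewrite incr_bitsE; elim: w => //= -[] w IH. Qed.

Lemma size_nat_bits n : size (nat_bits n) <= n.
Proof. by elim: n => // n IH; rewrite nat_bitsS; apply: leq_trans (size_incr_bits _) _. Qed.

Lemma FPt_incr_bits : FPt incr_bits.
Proof.
have F : FPt (foldl incr_step (true, [::])).
  apply: (@FPt_fold _ _ _ _ _ _ (fun _ => incr_step) (fun=> (true, [::])) id (fun e => 4 * sz e + 8)) => //.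
  - by rewrite /incr_step; fpt.
  - exact: FPt_const.
  - exact: FPt_id.
  - by pbt.
  - move=> e n; have szb : forall b : bool, sz b <= 3 by case.
    have H s u : size (foldl incr_step u s).2 = size s + size u.2.
      by elim: s u => //= b s IH u; rewrite IH addnS.
    case E: (foldl _ _ _) => [b w]; rewrite sz_pair.
    have := H (take n e) (true, [::]); rewrite E /= addn0 => sw.
    have : size (take n e) <= size e by rewrite size_take; case: ltnP => // /ltnW.
    by pose proof (size_le_sz e); have := sz_bits w; have := szb b; lia.
rewrite /incr_bits; apply: (FPt_comp F (g := fun u => rev (if u.1 then true :: u.2 else u.2))).
by fpt.
Qed.

(** Incrementing [n] times from the empty word is affordable because [n] is given in unary. *)
Lemma FPt_nat_bits : FPt nat_bits.
Proof.
have C n : foldl (fun u (x : unit) => incr_bits u) [::] (nseq n tt) = nat_bits n.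
  by elim: n => // n IH; rewrite -[n.+1]addn1 nseqD foldl_cat IH /= addn1 nat_bitsS.
apply: (FPt_ext (f := fun e => foldl (fun u (x : unit) => incr_bits u) [::] (nseq e tt))).
  by move=> n; rewrite C.
apply: (@FPt_fold _ _ _ _ _ _ (fun _ u x => incr_bits u) _ _ (fun e => 4 * e + 1)) => //.
- by apply: FPt_comp FPt_incr_bits; fpt.
- exact: FPt_const.
- by fpt.
- by apply: pb_le (pb_mul (pb_const _ 2) (pb_id sz)) => n; rewrite sz_nat; lia.
- move=> e k.
  have -> : take k (nseq e tt) = nseq (minn k e) tt.
    by elim: e k => [|m IH] [|k] //=; rewrite ?minn0 ?minnSS //= IH.
  rewrite C; apply: leq_trans (sz_bits _) _; have := size_nat_bits (minn k e).
  have := geq_minr k e; lia.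
Qed.

Lemma FPt_double_bits (E : Type) {eE : Enc E} (f : E -> seq bool) :
  FPt f -> FPt (fun e => double_bits (f e)).
Proof. by move=> Ff; rewrite /double_bits; fpt. Qed.

Lemma FPt_enc_nats (E : Type) {eE : Enc E} (f : E -> seq nat) :
  FPt f -> FPt (fun e => enc_nats (f e)).
Proof.
move=> Ff; rewrite /enc_nats; fpt.
by apply: FPt_double_bits; apply: FPt_comp FPt_nat_bits; fpt.
Qed.

Ltac fpt_hook ::= first [refine (FPt_double_bits _) | refine (FPt_enc_nats _)].

(** * Distances in a graph given by its adjacency bits *)

(** Symmetrised and loop-free by construction, so every bit string describes a simple graph and
    certificates need no validity check. *)
Definition adj (y : seq bool) (m u v : nat) : bool :=
  ~~ (u == v) && (nth false y (u * m + v) || nth false y (v * m + u)).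

Definition grow (y : seq bool) (m : nat) (b : seq nat) : seq nat :=
  [seq v <- iota 0 m | (v \in b) || has (fun w => adj y m w v) b].

Definition ball (y : seq bool) (m u t : nat) : seq nat :=
  foldl (fun b _ => grow y m b) [:: u] (nseq t tt).

(** Balls grow with the radius, so the number of radii below [m] whose ball misses [v] is the
    distance. An unreachable [v] would give [m]; a separate ball test excludes it. *)
Definition gdist (y : seq bool) (m u v : nat) : nat :=
  size [seq t <- iota 0 m | ~~ (v \in ball y m u t)].

Lemma sz_filter (T : Type) {eT : Enc T} (p : pred T) (s : seq T) : sz (filter p s) <= sz s.
Proof. by elim: s => //= x s IH; case: (p x); rewrite !sz_cons; lia. Qed.

Lemma FPt_adj (E : Type) {eE : Enc E} (y : E -> seq bool) (m u v : E -> nat) :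
  FPt y -> FPt m -> FPt u -> FPt v -> FPt (fun e => adj (y e) (m e) (u e) (v e)).
Proof. by move=> *; rewrite /adj; fpt. Qed.

Ltac fpt_hook ::= first
  [refine (FPt_double_bits _) | refine (FPt_enc_nats _) | refine (FPt_adj _ _ _ _)].

Lemma FPt_grow (E : Type) {eE : Enc E} (y : E -> seq bool) (m : E -> nat) (b : E -> seq nat) :
  FPt y -> FPt m -> FPt b -> FPt (fun e => grow (y e) (m e) (b e)).
Proof. by move=> *; rewrite /grow; fpt. Qed.

Lemma FPt_ball (E : Type) {eE : Enc E} (y : E -> seq bool) (m u t : E -> nat) :
  FPt y -> FPt m -> FPt u -> FPt t -> FPt (fun e => ball (y e) (m e) (u e) (t e)).
Proof.
move=> Fy Fm Fu Ft; rewrite /ball.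
apply: (@FPt_fold _ _ _ _ _ _ (fun e b _ => grow (y e) (m e) b) (fun e => [:: u e])
  (fun e => nseq (t e) tt) (fun e => sz (iota 0 (m e)) + sz [:: u e])).
- by refine (FPt_grow _ _ _); fpt.
- by fpt.
- by fpt.
- by apply: pb_add; apply: FPt_sz; fpt.
(* After one round the accumulator is a filtered [iota 0 m], so it cannot grow further. *)
- move=> e n; case/lastP: (take _ _) => [|s x]; first by rewrite leq_addl.
  by rewrite -cats1 foldl_cat /=; apply: leq_trans (sz_filter _ _) (leq_addr _ _).
Qed.

Lemma FPt_gdist (E : Type) {eE : Enc E} (y : E -> seq bool) (m u v : E -> nat) :
  FPt y -> FPt m -> FPt u -> FPt v -> FPt (fun e => gdist (y e) (m e) (u e) (v e)).
Proof. by move=> *; rewrite /gdist; fpt; refine (FPt_ball _ _ _ _); fpt. Qed.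

Ltac fpt_hook ::= first
  [ refine (FPt_double_bits _) | refine (FPt_enc_nats _) | refine (FPt_ball _ _ _ _)
  | refine (FPt_gdist _ _ _ _)].

Section Walks.
Variables (V : finType) (e : rel V).

Lemma dist_lt u v d : is_dist e u v d -> d < #|V|.
Proof.
case=> [[p [sp pp lp]] H].
case/shortenP: pp lp => p' pp' up' sub lp'.
have le1 : size p' <= size p by apply: uniq_leq_size => //; case/andP: up'.
have le2 : d <= size p' by rewrite leqNgt; apply/negP => /H; apply; exists p'.
by apply: leq_ltn_trans le2 _; rewrite -[(size p').+1]/(size (u :: p')) -(card_uniqP up') max_card.
Qed.

Lemma walk_dist u v k : walk_of_len e u v k -> exists2 d, d <= k & is_dist e u v d.
Proof.
elim/ltn_ind: k => k IH w.
have [ex|nex] := boolP [exists j : 'I_k, [exists p : j.-tuple V, path e u p && (last u p == v)]].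
  case/existsP: ex => j /existsP[p /andP[pp /eqP lp]].
  have [|d le_d Hd] := IH j (ltn_ord j); first by exists p; rewrite size_tuple.
  by exists d => //; apply: leq_trans le_d (ltnW (ltn_ord j)).
exists k => //; split=> // j lt [p [sp pp lp]].
case/negP: nex; apply/existsP; exists (Ordinal lt); apply/existsP.
by exists (tcast sp (in_tuple p)); rewrite val_tcast /= pp lp eqxx.
Qed.

(** No edge leaves the image of [F], so walks that start in it are images of walks. This covers the
    addition of isolated vertices. *)
Lemma dist_embed (W : finType) (f : rel W) (F : V -> W) u v d : injective F ->
  (forall a w, f (F a) w <-> exists2 b, w = F b & e a b) ->
  is_dist e u v d -> is_dist f (F u) (F v) d.
Proof.
move=> Finj Ff; have P p a b : path e a p /\ last a p = b -> path f (F a) (map F p) /\ last (F a) (map F p) = F b.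
  case=> pp <-; split; last by rewrite last_map.
  by elim: p a pp => //= c p IH a /andP[eac /IH ->]; rewrite andbT; apply/Ff; exists c.
have P' q a b : path f (F a) q -> last (F a) q = F b -> exists p, [/\ q = map F p, path e a p & last a p = b].
  elim: q a => [|w q IH] a /=; first by move=> _ /Finj <-; exists [::].
  case/andP=> /Ff[c -> eac] pq lq; case: (IH c pq lq) => p [-> pp lp].
  by exists (c :: p); rewrite /= eac.
case=> [[p [sp pp lp]] H]; have [|pp' lp'] := P p u v; first by [].
split; first by exists (map F p); rewrite size_map.
move=> j lt [q [sq pq lq]]; case: (P' _ _ _ pq lq) => p0 [Eq pp0 lp0].
by apply: (H j lt); exists p0; rewrite -sq Eq size_map.
Qed.

End Walks.

Section Ball.
Variables (y : seq bool) (m : nat).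
Let e : rel 'I_m := fun u v => adj y m u v.

Lemma adj_simple : simple_graph e.
Proof.
split=> [u v|u]; last by rewrite /e /adj eqxx.
by rewrite /e /adj eq_sym orbC.
Qed.

Lemma ballS u t : ball y m u t.+1 = grow y m (ball y m u t).
Proof. by rewrite /ball -addn1 nseqD foldl_cat. Qed.

Lemma mem_grow b v : (v \in grow y m b) = (v < m) && ((v \in b) || has (fun w => adj y m w v) b).
Proof. by rewrite mem_filter mem_iota /= add0n andbC. Qed.

Lemma ballP (u v : 'I_m) t :
  val v \in ball y m u t <-> exists p, [/\ size p <= t, path e u p & last u p = v].
Proof.
elim: t v => [|t IH] v.
  rewrite inE; split=> [/eqP/val_inj->|[p [sp _ lp]]]; first by exists [::].
  by case: p sp lp => //= _ <-.
have blt w : w \in ball y m u t -> w < m.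
  case: t {IH} => [|t]; first by rewrite inE => /eqP->.
  by rewrite ballS mem_grow => /andP[].
rewrite ballS mem_grow ltn_ord; split.
  case/orP=> [/IH[p [sp pp lp]]|/hasP[w wb ewv]].
    by exists p; split=> //; apply: leqW.
  have [p [sp pp lp]] := (IH (Ordinal (blt _ wb))).1 wb.
  by exists (rcons p v); rewrite size_rcons rcons_path last_rcons pp lp.
case=> p; case/lastP: p => [[_ _ <-]|p w [sp pp]].
  by apply/orP; left; apply/IH; exists [::].
rewrite last_rcons => Ew; move: pp sp; rewrite Ew rcons_path size_rcons => /andP[pp ew] sp.
apply/orP; right; apply/hasP; exists (val (last u p)) => //.
by apply/IH; exists p.
Qed.

Lemma gdistP (u v : 'I_m) d : is_dist e u v d -> gdist y m u v = d /\ val v \in ball y m u m.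
Proof.
move=> H; have lt := dist_lt H; rewrite card_ord in lt.
have B t : (val v \in ball y m u t) = (d <= t).
  apply/idP/idP => [/ballP[p [sp pp lp]]|le].
    by rewrite leqNgt; apply/negP => ltd; apply: (H.2 (size p)); [apply: leq_ltn_trans ltd | exists p].
  by case: H => [[p [sp pp lp]] _]; apply/ballP; exists p; rewrite sp.
split; last by rewrite B ltnW.
rewrite /gdist (eq_filter (a2 := fun t => t < d)); last by move=> t; rewrite B ltnNge.
rewrite size_filter -[m](subnKC (ltnW lt)) iotaD count_cat.
rewrite (@eq_in_count _ _ predT); last by move=> t; rewrite mem_iota => /andP[].
rewrite count_predT size_iota (@eq_in_count _ _ pred0) ?count_pred0 ?addn0 //.
by move=> t; rewrite mem_iota add0n => /andP[le _]; rewrite ltnNge le.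
Qed.

Lemma ball_dist (u v : 'I_m) : val v \in ball y m u m -> is_dist e u v (gdist y m u v).
Proof.
case/ballP=> p [_ pp lp]; have [|d _ Hd] := @walk_dist _ e u v (size p); first by exists p.
by have [-> _] := gdistP Hd.
Qed.

End Ball.

(** * Membership in NP *)

Definition dist_list (y : seq bool) (m n : nat) : seq nat :=
  [seq gdist y m u v | u <- iota 0 n, v <- iota 0 n].

Definition good_cert (k n : nat) (z y : seq bool) : bool :=
  all (fun u => all (fun v => v \in ball y (n + k) u (n + k)) (iota 0 n)) (iota 0 n) &&
  (z == pair_words (enc_nats (n :: dist_list y (n + k) n)) y).

(* Nothing is parsed: the pair [z] is compared with the pair built from every suffix of [z]. *)
Definition verify (k : nat) (z : seq bool) : bool :=
  has (fun n => has (fun i => good_cert k n z (drop i z)) (iota 0 (size z).+1)) (iota 0 (size z).+1).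

Lemma FPt_verify k : FPt (verify k).
Proof. by rewrite /verify /good_cert /dist_list /pair_words; fpt. Qed.

Lemma pair_words_inj x x' y y' : pair_words x y = pair_words x' y' -> x = x' /\ y = y'.
Proof.
rewrite /pair_words; elim: x x' => [|b x IH] [|b' x'] //=; first by case.
- by rewrite -/(double_bits x'); case; case: b'.
- by rewrite -/(double_bits x); case; case: b.
by rewrite -/(double_bits x) -/(double_bits x'); case=> -> _ H; case: (IH _ H) => -> ->.
Qed.

Lemma verifyP k x y :
  verify k (pair_words x y) <->
  exists n, [/\ n <= size (pair_words x y),
    {in iota 0 n &, forall u v, v \in ball y (n + k) u (n + k)} &
    x = enc_nats (n :: dist_list y (n + k) n)].
Proof.
split.
  case/hasP=> n nz /hasP[i _ /andP[/allP H /eqP/pair_words_inj[Ex Ey]]].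
  rewrite -Ey in H Ex; exists n; split=> //; first by move: nz; rewrite mem_iota.
  by move=> u v /H/allP; apply.
case=> n [nz H Ex]; apply/hasP; exists n; first by rewrite mem_iota.
apply/hasP; exists (size (double_bits x) + 2).
  by rewrite mem_iota /pair_words !size_cat /=; lia.
have -> : drop (size (double_bits x) + 2) (pair_words x y) = y.
  by rewrite /pair_words catA drop_size_cat // size_cat.
apply/andP; split; last by rewrite -Ex.
by apply/allP => u Hu; apply/allP => v; apply: H.
Qed.

Lemma enc_matrix_dist n (D : 'M[nat]_n) y m :
  (forall i j : 'I_n, D i j = gdist y m i j) -> enc_matrix D = enc_nats (n :: dist_list y m n).
Proof.
move=> H; rewrite /enc_matrix /dist_list -val_enum_ord; congr (enc_nats (_ :: _)).
rewrite -map_comp; congr flatten; apply: eq_map => i /=.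
by rewrite -map_comp; apply: eq_map => j /=.
Qed.

(** The separators alone take more than [n] bits. Hence the $(n+k)^2$ adjacency bits are polynomial
    in the input length, although the entries are written in binary. *)
Lemma leq_size_enc_matrix n (D : 'M[nat]_n) : n <= size (enc_matrix D).
Proof.
have H s : size s <= size (enc_nats s).
  by elim: s => //= a s IH; rewrite /enc_nats /= !size_cat /= -/(enc_nats s); lia.
apply: leq_trans (H _); rewrite /= size_allpairs !size_enum_ord.
by case: n {D} => // n; rewrite ltnS; apply: leq_trans (leq_pmulr _ _).
Qed.

(** * From a realisation to a certificate *)

Section FromRealisation.
Variables (k n : nat) (V : finType) (e : rel V) (Phi : 'I_n -> V).
Hypothesis Phi_inj : injective Phi.
Hypothesis card_V : #|V| <= n + k.
Hypothesis e_simple : simple_graph e.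

(** Labelled vertices come first and in order, so that [Phi i] receives the number [i] which the
    verifier expects. *)
Definition listing : seq V := [seq Phi i | i <- enum 'I_n] ++ [seq v <- enum V | v \notin codom Phi].

Lemma mem_listing v : v \in listing.
Proof.
rewrite /listing mem_cat mem_filter mem_enum andbT orbC; case: (boolP (v \in codom Phi)) => //=.
Qed.

Lemma index_listing i : index (Phi i) listing = i.
Proof. by rewrite index_cat map_f ?mem_enum // index_map // index_enum_ord. Qed.

Lemma index_listing_lt v : index v listing < n + k.
Proof.
apply: leq_trans card_V; apply: (@leq_trans (size listing)); first by rewrite index_mem mem_listing.
rewrite cardE; apply: uniq_leq_size => [|u _]; last by rewrite mem_enum.
rewrite cat_uniq map_inj_uniq // enum_uniq filter_uniq ?enum_uniq // andbT /=.
apply/hasPn => u; rewrite mem_filter => /andP[/negP nu _]; apply/negP => /mapP[i _ Eu].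
by apply: nu; rewrite Eu codom_f.
Qed.

Definition listing_ord v : 'I_(n + k) := Ordinal (index_listing_lt v).

Lemma listing_ord_inj : injective listing_ord.
Proof.
by move=> u v [E]; rewrite -(nth_index u (mem_listing u)) E nth_index ?mem_listing.
Qed.

Definition image_edge (u v : nat) : bool :=
  [exists a, exists b, [&& val (listing_ord a) == u, val (listing_ord b) == v & e a b]].

Definition adj_bits : seq bool :=
  mkseq (fun j => image_edge (j %/ (n + k)) (j %% (n + k))) ((n + k) * (n + k)).

Lemma adj_bitsP (u v : 'I_(n + k)) : adj adj_bits (n + k) u v = image_edge u v.
Proof.
have N (a b : 'I_(n + k)) : nth false adj_bits (a * (n + k) + b) = image_edge a b.
  rewrite nth_mkseq; last first.
    have := ltn_ord a; have := ltn_ord b; move: (n + k) (val a) (val b) => m i j; nia.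
  rewrite divnMDl; last exact: leq_trans (ltn_ord a).
  by rewrite divn_small // addn0 modnMDl modn_small.
rewrite /adj !N; case: e_simple => es ei.
apply/idP/idP => [/andP[_ /orP[//|]]|].
  by case/existsP=> a /existsP[b /and3P[? ? ?]]; apply/existsP; exists b; apply/existsP; exists a;
    apply/and3P; split=> //; rewrite es.
move=> H; rewrite H andbT; case/existsP: H => a /existsP[b /and3P[/eqP <- /eqP <- eab]].
by apply/eqP => /val_inj/listing_ord_inj Eab; rewrite Eab ei in eab.
Qed.

Lemma adj_bits_dist i j d : is_dist e (Phi i) (Phi j) d ->
  gdist adj_bits (n + k) i j = d /\ val j \in ball adj_bits (n + k) i (n + k).
Proof.
move=> H; suff : is_dist (fun u v : 'I_(n + k) => adj adj_bits (n + k) u v)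
    (listing_ord (Phi i)) (listing_ord (Phi j)) d.
  by move/gdistP; rewrite /= !index_listing.
apply: dist_embed H; first exact: listing_ord_inj.
move=> a w; rewrite adj_bitsP; split.
  case/existsP=> a' /existsP[b /and3P[/eqP/val_inj/listing_ord_inj <- /eqP/val_inj Ew eab]].
  by exists b.
by case=> b -> eab; apply/existsP; exists a; apply/existsP; exists b; rewrite !eqxx.
Qed.

End FromRealisation.

Theorem CombDMR_NP k : inNP (CombDMR k).
Proof.
exists (fun z => verify k z); split; first by apply: (FPt_inP (FPt_verify k)).
have [c [d Hcd]] : exists c d, forall x : seq bool, (size x + k) * (size x + k) <= poly c d (size x).
  by apply: (pb_leq_poly (s := size) (f := fun x => (size x + k) * (size x + k))); pbt.
exists c, d => x; split.
  case=> n [D [-> [V [e [Phi [[es Pinj HD] cV]]]]]].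
  have DD := fun i j => adj_bits_dist Pinj cV es (HD i j).
  exists (adj_bits e Pinj cV); split.
    apply: leq_trans (Hcd _); rewrite size_mkseq.
    by apply: leq_mul; rewrite leq_add2r leq_size_enc_matrix.
  apply/verifyP; exists n; split.
  - apply: leq_trans (leq_size_enc_matrix D) _; rewrite /pair_words size_cat.
    apply: leq_trans (leq_addr _ _); elim: (enc_matrix D) => //= b w IH.
    by move: IH; rewrite /double_bits /=; lia.
  - move=> u v; rewrite !mem_iota !add0n => /= lu lv.
    by case: (DD (Ordinal lu) (Ordinal lv)).
  - by apply: enc_matrix_dist => i j; case: (DD i j).
case=> y [_ /verifyP[n [_ H Ex]]].
pose D : 'M[nat]_n := (\matrix_(i, j) gdist y (n + k) i j)%R.
exists n, D; split; first by rewrite Ex; apply/esym/enc_matrix_dist => i j; rewrite mxE.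
exists 'I_(n + k), (fun u v : 'I_(n + k) => adj y (n + k) u v), (widen_ord (leq_addr k n)).
split; last by rewrite card_ord.
split; first exact: adj_simple.
  by move=> i j /(congr1 val) /= /val_inj.
move=> i j; rewrite mxE; apply: (@ball_dist y (n + k) (widen_ord _ i) (widen_ord _ j)).
by apply: H; rewrite mem_iota /= add0n ltn_ord.
Qed.

(** * From colourings to distance matrices *)

Section Nodes.
Variable T : eqType.

(* An edge [uv] of the graph to be coloured is the list [[:: u; v]].  The labelled vertices of the
   realisation are the root [[::]], the vertices [[:: v]] and the pairs [[:: u; v]]. *)
Definition linked (es : seq (seq T)) (p : seq T) : bool := (p \in es) || (rev p \in es).

(** For [x = [:: w]] and [p = [:: u; v]] this says that [w] is [u], or that [w] is [v] and [uv] is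
    not an edge. Distinct non-adjacent vertices thus have their pair as common neighbour, adjacent
    ones have no pair in common. *)
Definition near (es : seq (seq T)) (x p : seq T) : bool :=
  (x ++ behead p == p) || ((behead p == x) && ~~ linked es p).

(** By sizes, with the root as size 0: root to vertex 2, root to pair 3, vertex to vertex 3 or 2,
    vertex to pair 1 or 2, distinct pairs 1. The root has no entry 1. *)
Definition ndist (es : seq (seq T)) (x y : seq T) : nat :=
  if x == y then 0 else
  if size x + size y == 1 then 2 else
  if (size x == 0) || (size y == 0) then 3 else
  if (size x == 1) && (size y == 1) then if linked es (x ++ y) then 3 else 2 else
  if size x == 1 then if near es x y then 1 else 2 else
  if size y == 1 then if near es y x then 1 else 2 else 1.

Definition nodes (vs : seq T) : seq (seq T) :=
  [::] :: [seq [:: v] | v <- vs] ++ [seq [:: u; v] | u <- vs, v <- vs].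

Definition colour_word (vs : seq T) (es : seq (seq T)) : seq bool :=
  enc_nats (size (nodes vs) :: [seq ndist es x y | x <- nodes vs, y <- nodes vs]).

Definition colourable (k : nat) (vs : seq T) (es : seq (seq T)) : Prop :=
  exists2 col : T -> nat, {in vs, forall v, col v < k} &
    {in vs &, forall u v, linked es [:: u; v] -> col u != col v}.

End Nodes.

Lemma FPt_colour_word (T : eqType) (E : Type) {eT : Enc T} {eE : Enc E}
    (vs : E -> seq T) (es : E -> seq (seq T)) :
  FPt vs -> FPt es -> FPt (fun e => colour_word (vs e) (es e)).
Proof. by move=> *; rewrite /colour_word /nodes /ndist /near /linked; fpt. Qed.

Lemma enc_nats_cons m s : enc_nats (m :: s) = pair_words (nat_bits m) (enc_nats s).
Proof. by rewrite /enc_nats /pair_words /= -catA. Qed.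

Lemma pos_bits_inj : injective pos_bits.
Proof.
have nn p : pos_bits p <> [::] by case: p.
elim=> [p IH|p IH|] [q|q|] //= [] //.
- by move=> E; rewrite (IH _ E).
- by move/nn.
- by move=> E; rewrite (IH _ E).
- by move/esym/nn.
Qed.

Lemma nat_bits_inj : injective nat_bits.
Proof.
have nn p : pos_bits p <> [::] by case: p.
move=> m n; rewrite /nat_bits => H; apply: Nnat.Nat2N.inj; move: H.
case: (BinNat.N.of_nat m) (BinNat.N.of_nat n) => [|p] [|q] //=; last by move=> E; rewrite (pos_bits_inj E).
  by move/esym/nn.
by move/nn.
Qed.

Lemma enc_nats_inj : injective enc_nats.
Proof.
elim=> [|m s IH] [|n t] //; rewrite ?enc_nats_cons.
- by rewrite /pair_words; case: (double_bits _).
- by rewrite /pair_words; case: (double_bits _).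
by move=> H; case: (pair_words_inj H) => /nat_bits_inj-> E; rewrite (IH _ E).
Qed.

(** The language only asserts that some matrix has the given code; injectivity identifies it with
    the one constructed. *)
Lemma enc_matrix_inj n n' (D : 'M[nat]_n) (D' : 'M[nat]_n') :
  enc_matrix D = enc_matrix D' -> exists E : n = n', forall i j, D i j = D' (cast_ord E i) (cast_ord E j).
Proof.
move/enc_nats_inj => [En]; move: D'; rewrite -En => D' H; exists erefl => i j.
rewrite !cast_ord_id.
have A (M : 'M[nat]_n) : [seq M i j | i <- enum 'I_n, j <- enum 'I_n] =
   [seq M p.1 p.2 | p <- [seq (i, j) | i <- enum 'I_n, j <- enum 'I_n]] by rewrite map_allpairs.
move: H; rewrite !A => /eq_in_map/(_ (i, j)); apply.
by apply/allpairsP; exists (i, j); rewrite !mem_enum.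
Qed.

Section ShortWalks.
Variables (V : finType) (e : rel V).

Lemma walk1 i j : walk_of_len e i j 1 <-> e i j.
Proof.
split; last by move=> H; exists [:: j]; rewrite /= H.
by case=> -[|a [|b p]] [] //= _ /andP[H _] <-.
Qed.

Lemma walk2 i j : walk_of_len e i j 2 <-> exists2 w, e i w & e w j.
Proof.
split; last by case=> w H1 H2; exists [:: w; j]; rewrite /= H1 H2.
by case=> -[|a [|b [|c p]]] [] //= _ /and3P[H1 H2 _] <-; exists a.
Qed.

Lemma walk3 i a b j : e i a -> e a b -> e b j -> walk_of_len e i j 3.
Proof. by move=> H1 H2 H3; exists [:: a; b; j]; rewrite /= H1 H2 H3. Qed.

End ShortWalks.

Lemma is_dist_sym (V : finType) (e : rel V) u v d :
  symmetric e -> is_dist e u v d -> is_dist e v u d.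
Proof.
move=> se; have W a b k : walk_of_len e a b k -> walk_of_len e b a k.
  case=> p [sp pp lp]; exists (rev (belast a p)); split.
  - by rewrite size_rev size_belast.
  - by rewrite -lp rev_path; apply: sub_path pp => x y; rewrite se.
  - by case: p pp lp {sp} => [_ <-|x p _ _] //=; rewrite rev_cons last_rcons.
by case=> w H; split; [exact: W | move=> m lt /W; apply: H].
Qed.

Section ColourMatrix.
Variables (T : eqType) (k : nat) (vs : seq T) (es : seq (seq T)).
Hypothesis vs_uniq : uniq vs.
Hypothesis noloop : forall u, [:: u; u] \notin es.

Local Notation nds := (nodes vs).
Local Notation n := (size nds).
Local Notation lk u v := (linked es [:: u; v]).

Definition nd (i : 'I_n) : seq T := nth [::] nds i.

Definition colour_matrix : 'M[nat]_n := (\matrix_(i, j) ndist es (nd i) (nd j))%R.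

Lemma enc_colour_matrix : enc_matrix colour_matrix = colour_word vs es.
Proof.
rewrite /enc_matrix /colour_word; congr (enc_nats (_ :: _)).
have E : nds = [seq nd i | i <- enum 'I_n].
  by rewrite -[LHS](mkseq_nth [::]) /mkseq -val_enum_ord -map_comp.
rewrite [in RHS]E allpairs_mapl allpairs_mapr.
by congr flatten; apply: eq_map => i; apply: eq_map => j; rewrite mxE.
Qed.

Lemma nodesP x : x \in nds <->
  [\/ x = [::], exists2 v, v \in vs & x = [:: v] |
      exists u v, [/\ u \in vs, v \in vs & x = [:: u; v]]].
Proof.
rewrite inE mem_cat; split.
  case/or3P=> [/eqP->|/mapP[v vv ->]|/allpairsP[[u v] [/= uu vv ->]]]; [exact: Or31 | |].
    by apply: Or32; exists v.
  by apply: Or33; exists u, v.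
case=> [->|[v vv ->]|[u [v [uu vv ->]]]] //.
  by rewrite map_f ?orbT.
by rewrite orbC; apply/orP; left; apply/orP; right; apply/allpairsP; exists (u, v).
Qed.

Lemma uniq_nodes : uniq nds.
Proof.
rewrite /= mem_cat cat_uniq; apply/and4P; split.
- by apply/norP; split; apply/negP; [case/mapP | case/allpairsP=> -[? ?] []].
- by rewrite map_inj_uniq // => u v [].
- by apply/hasPn => x /allpairsP[[u v] [_ _ ->]]; apply/negP; case/mapP.
- by apply: allpairs_uniq => // -[a b] [c d] _ _ [-> ->].
Qed.

Lemma nd_inj : injective nd.
Proof. by move=> i j /eqP; rewrite /nd nth_uniq ?uniq_nodes // => /eqP/val_inj. Qed.

Lemma nd_mem i : nd i \in nds. Proof. exact: mem_nth. Qed.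

Lemma ndP x : x \in nds -> exists i, nd i = x.
Proof. by move=> xn; have lt := xn; rewrite -index_mem in lt; exists (Ordinal lt); apply: nth_index. Qed.

Lemma linked_sym u v : lk u v = lk v u.
Proof. by rewrite /linked /rev /= orbC. Qed.

Lemma linked_neq u v : lk u v -> u != v.
Proof. by apply: contraL => /eqP->; rewrite /linked /rev /= orbb. Qed.

Lemma ndist_rv v : ndist es [::] [:: v] = 2. Proof. by []. Qed.
Lemma ndist_rp u v : ndist es [::] [:: u; v] = 3. Proof. by []. Qed.
Lemma ndist_vv u v : ndist es [:: u] [:: v] = if u == v then 0 else if lk u v then 3 else 2.
Proof. by rewrite /ndist /= ?eqseq_cons ?andbT. Qed.
Lemma ndist_vp w u v : ndist es [:: w] [:: u; v] =
  if (w == u) || (w == v) && ~~ lk u v then 1 else 2.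
Proof. by rewrite /ndist /near /= ?eqseq_cons /= ?eqxx ?andbT ?andbF (eq_sym v). Qed.
Lemma ndist_pp p q : size p = 2 -> size q = 2 -> ndist es p q = if p == q then 0 else 1.
Proof. by move=> sp sq; rewrite /ndist sp sq. Qed.

Lemma ndist_pv w u v : ndist es [:: u; v] [:: w] = ndist es [:: w] [:: u; v].
Proof. by rewrite /ndist !eqseq_cons !andbF. Qed.

Lemma ndist_sym x y : x \in nds -> y \in nds -> ndist es x y = ndist es y x.
Proof.
move=> /nodesP[->|[v vv ->]|[u [v [uu vv ->]]]] /nodesP[->|[v' vv' ->]|[u' [v' [uu' vv' ->]]]];
  rewrite ?ndist_pv //; first by rewrite !ndist_vv eq_sym linked_sym.
by rewrite !ndist_pp // eq_sym.
Qed.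

(** * From a realisation to a colouring *)

Section Realised.
Variables (V : finType) (e : rel V) (Phi : 'I_n -> V).
Hypothesis es_simple : simple_graph e.
Hypothesis Phi_inj : injective Phi.
Hypothesis Phi_dist : forall i j, is_dist e (Phi i) (Phi j) (ndist es (nd i) (nd j)).
Hypothesis card_V : #|V| <= n + k.

Lemma realised_colourable : colourable k vs es.
Proof.
have [r Er] : exists i, nd i = [::] by apply: ndP; apply/nodesP; apply: Or31.
have [f Ef] : exists f : T -> 'I_n, {in vs, forall v, nd (f v) = [:: v]}.
  exists (fun v => nth r (enum 'I_n) (index [:: v] nds)) => v vv.
  have vn : [:: v] \in nds by apply/nodesP; apply: Or32; exists v.
  have lt := vn; rewrite -index_mem in lt.
  by rewrite (_ : nth _ _ _ = Ordinal lt) ?/nd /= ?nth_index //; apply: (nth_ord_enum r (Ordinal lt)).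
pose H := [set h | h \notin codom Phi].
have cH : #|H| <= k.
  have : #|codom Phi| + #|H| = #|V|.
    by rewrite -(cardC (mem (codom Phi))) cardsE; congr (_ + _); apply: eq_card.
  by rewrite card_codom // card_ord; move: card_V; lia.
pose h v := odflt (Phi r) [pick h | e (Phi r) h && e h (Phi (f v))].
have hP v : v \in vs -> [/\ e (Phi r) (h v), e (h v) (Phi (f v)) & h v \in H].
  move=> vv; have ex : exists h, e (Phi r) h && e h (Phi (f v)).
    have := (Phi_dist r (f v)).1; rewrite Er Ef // ndist_rv => /walk2[a ea ea'].
    by exists a; rewrite ea ea'.
  have [e1 e2] : e (Phi r) (h v) /\ e (h v) (Phi (f v)).
    rewrite /h; case: pickP => [h' /andP[]//|no]; case: ex => h' Hh'; by rewrite no in Hh'.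
  (* A labelled neighbour of the root would be at distance 1 from it, but the row of the root
     contains only 0, 2 and 3. *)
  split=> //; rewrite inE; apply/negP => /codomP[j Ej].
  have := (Phi_dist r j).2 1; have := (Phi_dist r j).1.
  have W : walk_of_len e (Phi r) (Phi j) 1 by apply/walk1; rewrite -Ej.
  rewrite Er; have [->|[v' _ ->]|[u [v' [_ _ ->]]]] := (nodesP (nd j)).1 (nd_mem j).
  - case=> -[|x p] [] //= _ _ E0 _; case: es_simple => _ ir.
    by move: e1; rewrite Ej -E0 ir.
  - by move=> _ /(_ isT); apply.
  - by move=> _ /(_ isT); apply.
exists (fun v => index (h v) (enum H)).
  move=> v /hP[_ _ hH]; apply: leq_trans cH; rewrite cardE index_mem mem_enum; exact: hH.
move=> u v uu vv lkuv; apply/eqP => E.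
have [_ eu hu] := hP u uu; have [_ ev hv] := hP v vv.
have Eh : h u = h v.
  by rewrite -(nth_index (h u) (_ : h u \in enum H)) ?mem_enum // E nth_index ?mem_enum.
have := (Phi_dist (f u) (f v)).2 2; rewrite !Ef // ndist_vv (negPf (linked_neq lkuv)) lkuv.
move/(_ isT); apply; apply/walk2; exists (h u); last by rewrite Eh.
by case: es_simple => sy _; rewrite sy.
Qed.

End Realised.

(** * From a colouring to a realisation *)

Section Coloured.
Variable col : T -> nat.
Hypothesis col_lt : {in vs, forall v, col v < k}.
Hypothesis col_ok : {in vs &, forall u v, lk u v -> col u != col v}.

Definition attached (c : nat) (x : seq T) : bool :=
  match x with [::] => true | [:: v] => col v == c | _ => false end.

(** The additional vertices are the colours, each the midpoint between the root and its colour
    class. A class contains no edge, so no required distance 3 between vertices is shortened. *)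
Definition cedge (a b : 'I_n + 'I_k) : bool :=
  match a, b with
  | inl i, inl j => ndist es (nd i) (nd j) == 1
  | inl i, inr c | inr c, inl i => attached c (nd i)
  | inr _, inr _ => false
  end.

Lemma cedge_simple : simple_graph (cedge : rel _).
Proof.
split; first by move=> [i|c] [j|c'] //=; rewrite ndist_sym ?nd_mem.
by case=> //= i; rewrite /ndist eqxx.
Qed.

Lemma coloured_dist i j : is_dist cedge (inl i) (inl j) (ndist es (nd i) (nd j)).
Proof.
wlog le : i j / size (nd i) <= size (nd j).
  move=> H; case/orP: (leq_total (size (nd i)) (size (nd j))) => /H// {}H.
  by rewrite ndist_sym ?nd_mem //; apply: is_dist_sym H; case: cedge_simple.
have [<-|nij] := eqVneq i j.
  by rewrite /ndist eqxx; split=> //; exists [::].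
have nnd : nd i != nd j by apply: contra nij => /eqP/nd_inj->.
have nw0 : ~ walk_of_len cedge (inl i) (inl j) 0.
  by case=> -[|x p] [] //= _ _ [E]; rewrite E eqxx in nij.
have nw1 : ndist es (nd i) (nd j) != 1 -> ~ walk_of_len cedge (inl i) (inl j) 1.
  by move=> H /walk1; rewrite /= (negPf H).
have at_col v : v \in vs -> exists c : 'I_k, col v = c.
  by move=> vv; exists (Ordinal (col_lt vv)).
have pairP a b : a \in vs -> b \in vs -> exists p, nd p = [:: a; b].
  by move=> aa bb; apply: ndP; apply/nodesP; apply: Or33; exists a, b.
move: nnd le nw1; have [Ei|[u uu Ei]|[a [b [aa bb Ei]]]] := (nodesP _).1 (nd_mem i);
  have [Ej|[v vv Ej]|[a' [b' [aa' bb' Ej]]]] := (nodesP _).1 (nd_mem j); rewrite Ei Ej // => nnd _ nw1.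
- rewrite ndist_rv in nw1 *; split; last by case=> [|[|//]] _ //; apply: nw1.
  case: (at_col v vv) => c Ec; apply/walk2; exists (inr c); by rewrite /= ?Ei ?Ej //= Ec.
- rewrite ndist_rp in nw1 *; split.
    (* The walk goes from the root through the colour of [a'] and the vertex [[:: a']] to the
       pair. *)
    case: (at_col a' aa') => c Ec.
    have [x Ex] : exists x, nd x = [:: a'] by apply: ndP; apply/nodesP; apply: Or32; exists a'.
    apply: (@walk3 _ _ _ (inr c) (inl x)); rewrite /= ?Ei ?Ex ?Ej //= ?Ec // ndist_vp.
    by rewrite eqxx.
  case=> [|[|[|//]]] _ //; [exact: nw1 | case/walk2 => -[w|c] /=].
    by rewrite Ei; have [->|[v' _ ->]|[u' [v' [_ _ ->]]]] := (nodesP _).1 (nd_mem w).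
  by rewrite Ej.
- rewrite ndist_vv in nw1 *; have nuv : u != v by apply: contra nnd => /eqP->.
  rewrite (negPf nuv) in nw1 *; case: ifP nw1 => lkuv nw1; last first.
    split; last by case=> [|[|//]] _ //; apply: nw1.
    (* Since [uv] is not an edge, the pair [[:: u; v]] is next to both. *)
    case: (pairP u v uu vv) => p Ep; apply/walk2; exists (inl p); rewrite /= Ep ?Ei ?Ej.
      by rewrite ndist_vp eqxx.
    by rewrite ndist_pv ndist_vp eqxx lkuv orbT.
  split.
    (* A pair is always next to its first component, and pairs form a clique; hence the walk through
       [[:: u; v]] and [[:: v; u]]. *)
    case: (pairP u v uu vv) => p Ep; case: (pairP v u vv uu) => q Eq.
    apply: (@walk3 _ _ _ (inl p) (inl q)); rewrite /= ?Ep ?Eq ?Ei ?Ej.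
    + by rewrite ndist_vp eqxx.
    + by rewrite ndist_pp // ifN //; apply/negP => /eqP[E _]; rewrite E eqxx in nuv.
    + by rewrite ndist_pv ndist_vp eqxx.
  (* A midpoint cannot be a colour, as [u] and [v] are coloured differently. A pair next to both
     would consist of [u] and [v], and for an edge it is next to its first component only. *)
  case=> [|[|[|//]]] _ //; [exact: nw1 | case/walk2 => -[w|c] /=]; rewrite Ei Ej; last first.
    by move=> /eqP Eu /eqP Ev; case/eqP: (col_ok uu vv lkuv); rewrite Eu Ev.
  have [->|[v' _ ->]|[a [b [_ _ ->]]]] := (nodesP _).1 (nd_mem w) => //.
    by rewrite ndist_vv; case: ifP => // _; case: ifP.
  rewrite ndist_pv !ndist_vp.
  case: ifP => // Hu _; case: ifP => // Hv _.
  case/orP: Hu => [/eqP Eu|/andP[/eqP Eu nl]]; case/orP: Hv => [/eqP Ev|/andP[/eqP Ev nl']].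
  + by rewrite Eu Ev eqxx in nuv.
  + by rewrite Eu Ev (negPf nl') in lkuv.
  + by rewrite linked_sym Eu Ev (negPf nl) in lkuv.
  + by rewrite Eu Ev eqxx in nuv.
- rewrite ndist_vp in nw1 *; case: ifP nw1 => H nw1.
    split; last by case=> [|//] _.
    by apply/walk1; rewrite /= Ei Ej ndist_vp H.
  split; last by case=> [|[|//]] _ //; apply: nw1.
  (* The diagonal pair [[:: u; u]] is next to [u] and to every other pair. *)
  case: (pairP u u uu uu) => p Ep; apply/walk2; exists (inl p); rewrite /= Ep ?Ei ?Ej.
    by rewrite ndist_vp eqxx.
  by rewrite ndist_pp // ifN //; apply/negP => /eqP[E _]; rewrite E eqxx in H.
- rewrite ndist_pp // (negPf nnd); split; last by case=> [|//] _.
  by apply/walk1; rewrite /= Ei Ej ndist_pp // (negPf nnd).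
Qed.

Lemma coloured_realisable : comb_realisable k colour_matrix.
Proof.
exists ('I_n + 'I_k)%type, (cedge : rel _), (fun i => inl i).
split; last by rewrite card_sum !card_ord.
split; first exact: cedge_simple.
  by move=> i j [].
by move=> i j; rewrite mxE; apply: coloured_dist.
Qed.

End Coloured.

Theorem colour_word_correct : CombDMR k (colour_word vs es) <-> colourable k vs es.
Proof.
split.
  case=> m [D []]; rewrite -enc_colour_matrix => /enc_matrix_inj[E ED] [V [e [Phi [[s i d] c]]]].
  apply: (@realised_colourable V e (fun j => Phi (cast_ord E j))) => //.
  - by move=> a b /i/cast_ord_inj.
  - by move=> a b; have := d (cast_ord E a) (cast_ord E b); rewrite -ED mxE.
  - by rewrite E.
case=> col c1 c2; exists n, colour_matrix; split; first by rewrite enc_colour_matrix.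
exact: coloured_realisable c1 c2.
Qed.

End ColourMatrix.

(** * From clauses to colourings *)

Definition clause (X : Type) : Type := (((X * bool) * (X * bool)) * ((X * bool) * (X * bool)))%type.

Definition cvertex (X : Type) : Type := (nat + ((X * bool) + (clause X * nat)))%type.

Section ClauseGraph.
Variable X : eqType.
Implicit Types (c : clause X) (cls : seq (clause X)) (asg : X -> bool).

Definition holds asg (l : X * bool) : bool := asg l.1 == l.2.

Definition sat asg c : bool :=
  [|| holds asg c.1.1, holds asg c.1.2, holds asg c.2.1 | holds asg c.2.2].

(* Palette colours: 0 is false, 1 is true; a clause is a 5-cycle whose vertices are joined to the
   colour 0 and to the four literals, respectively. *)
Definition pal (i : nat) : cvertex X := inl i.
Definition lit (l : X * bool) : cvertex X := inr (inl l).
Definition gad c (i : nat) : cvertex X := inr (inr (c, i)).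

Definition vars cls : seq X :=
  flatten [seq [:: c.1.1.1; c.1.2.1; c.2.1.1; c.2.2.1] | c <- cls].

Definition lits cls : seq (X * bool) := [seq (x, b) | x <- vars cls, b <- [:: true; false]].

Definition gads cls : seq (cvertex X) := [seq gad c i | c <- cls, i <- iota 0 5].

Definition graph_vs (k : nat) cls : seq (cvertex X) :=
  undup ([seq pal i | i <- iota 0 k] ++ [seq lit l | l <- lits cls] ++ gads cls).

Definition gadget c : seq (seq (cvertex X)) :=
  [:: [:: gad c 0; gad c 1]; [:: gad c 1; gad c 2]; [:: gad c 2; gad c 3]; [:: gad c 3; gad c 4];
      [:: gad c 4; gad c 0]; [:: gad c 0; pal 0]; [:: gad c 1; lit c.1.1]; [:: gad c 2; lit c.1.2];
      [:: gad c 3; lit c.2.1]; [:: gad c 4; lit c.2.2]].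

(** Edges to the palette from 2 on leave a literal only false and true; edges from 3 on leave a
    gadget vertex three colours, whatever [k] is. *)
Definition graph_es (k : nat) cls : seq (seq (cvertex X)) :=
  [seq [:: pal i; pal j] | i <- iota 0 k, j <- iota 0 i] ++
  [seq [:: lit (x, true); lit (x, false)] | x <- vars cls] ++
  [seq [:: lit l; pal j] | l <- lits cls, j <- iota 2 (k - 2)] ++
  [seq [:: g; pal j] | g <- gads cls, j <- iota 3 (k - 3)] ++
  flatten [seq gadget c | c <- cls].

Lemma mem_iota_sub (m k j : nat) : (j \in iota m (k - m)) = (m <= j < k).
Proof. by rewrite mem_iota; apply/idP/idP; lia. Qed.

Lemma graph_es_ind k cls (P : seq (cvertex X) -> Prop) :
  (forall i j, j < i -> i < k -> P [:: pal i; pal j]) ->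
  (forall x, x \in vars cls -> P [:: lit (x, true); lit (x, false)]) ->
  (forall l j, 2 <= j -> j < k -> P [:: lit l; pal j]) ->
  (forall c i j, c \in cls -> i < 5 -> 3 <= j -> j < k -> P [:: gad c i; pal j]) ->
  (forall c p, c \in cls -> p \in gadget c -> P p) ->
  forall p, p \in graph_es k cls -> P p.
Proof.
move=> H1 H2 H3 H4 H5 p; rewrite !mem_cat => /or4P[| | |/orP[]].
- case/allpairsPdep=> i [j []]; rewrite !mem_iota !add0n => /= li lj ->; exact: H1.
- by case/mapP=> x /H2 Hx ->.
- by case/allpairsP=> -[l j] [_ /=]; rewrite mem_iota_sub => /andP[l2 lk] ->; apply: H3.
- case/allpairsP=> -[g j] [/allpairsP[[c i] [cc]]]; rewrite mem_iota add0n => li Eg.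
  by rewrite mem_iota_sub => /andP[l3 lk]; rewrite [(g, j).1]Eg => ->; apply: H4.
- by case/flattenP=> s /mapP[c cc ->]; apply: H5.
Qed.

Lemma graph_noloop k cls u : [:: u; u] \notin graph_es k cls.
Proof.
pose P (q : seq (cvertex X)) : Prop := if q is [:: a; b] then a <> b else True.
apply/negP => H; suff : P [:: u; u] by [].
apply: (graph_es_ind _ _ _ _ _ H) => // [i j lt _|c p _].
- by case=> E; rewrite E ltnn in lt.
- by rewrite !inE; do ![case/orP=> [/eqP->|] //=] => /eqP->.
Qed.

Definition gad_ok (s g : seq nat) : bool :=
  [&& all (fun i => i < 3) g, size g == 5,
      all (fun i => nth 0 g i != nth 0 g ((i + 1) %% 5)) (iota 0 5) &
      all (fun i => nth 0 g i != nth 0 s i) (iota 0 5)].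

Definition words3 : seq (seq nat) :=
  iter 5 (fun ws => [seq a :: w | a <- iota 0 3, w <- ws]) [:: [::]].

Definition gad_colour (s : seq nat) : seq nat := head [::] [seq g <- words3 | gad_ok s g].

(** A true literal frees colour 0 for its cycle vertex, which breaks the parity obstruction; the
    fifteen patterns are checked by computation over all $3^5$ words. *)
Lemma gad_colourP (b1 b2 b3 b4 : bool) : [|| b1, b2, b3 | b4] ->
  let s := [:: 0; b1 : nat; b2 : nat; b3 : nat; b4 : nat] in gad_ok s (gad_colour s).
Proof. by case: b1; case: b2; case: b3; case: b4 => // _; vm_compute. Qed.

(** * From a colouring to a satisfying assignment *)

Section Sound.
Variables (k : nat) (cls : seq (clause X)) (col : cvertex X -> nat).
Hypothesis k3 : 3 <= k.
Hypothesis col_lt : {in graph_vs k cls, forall v, col v < k}.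
Hypothesis col_ok : {in graph_vs k cls &, forall u v,
  linked (graph_es k cls) [:: u; v] -> col u != col v}.

Lemma pal_mem i : i < k -> pal i \in graph_vs k cls.
Proof. by move=> li; rewrite mem_undup mem_cat map_f // mem_iota. Qed.

Lemma mem_lits l : l.1 \in vars cls -> l \in lits cls.
Proof.
by case: l => x b xv; apply/allpairsP; exists (x, b); split=> //; rewrite !inE; case: (b).
Qed.

Lemma lit_mem l : l.1 \in vars cls -> lit l \in graph_vs k cls.
Proof.
by move=> lv; rewrite mem_undup !mem_cat; apply/or3P; apply: Or32; apply: map_f; apply: mem_lits.
Qed.

Lemma gad_mem c i : c \in cls -> i < 5 -> gad c i \in graph_vs k cls.
Proof.
move=> cc li; rewrite mem_undup !mem_cat; apply/or3P; apply: Or33.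
by apply/allpairsP; exists (c, i); rewrite mem_iota.
Qed.

Lemma edge_neq u v : u \in graph_vs k cls -> v \in graph_vs k cls ->
  [:: u; v] \in graph_es k cls -> col u != col v.
Proof. by move=> uu vv uv; apply: col_ok => //; rewrite /linked uv. Qed.

Lemma pal_neq i j : j < i -> i < k -> col (pal i) != col (pal j).
Proof.
move=> lj li; apply: edge_neq; rewrite ?pal_mem //; first exact: ltn_trans li.
rewrite mem_cat; apply/orP; left; apply/allpairsPdep; exists i, j.
by rewrite !mem_iota.
Qed.

(** The palette is a clique on [k] vertices, so its colours exhaust the [k] available ones. *)
Lemma colour_pal v : v \in graph_vs k cls -> exists2 i, i < k & col v = col (pal i).
Proof.
move=> vv; pose f (i : 'I_k) : 'I_k := Ordinal (col_lt (pal_mem (ltn_ord i))).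
have finj : injective f.
  move=> i j [E]; apply: val_inj => /=; case: (ltngtP i j) => // lt.
    by have := pal_neq lt (ltn_ord j); rewrite E eqxx.
  by have := pal_neq lt (ltn_ord i); rewrite E eqxx.
have [g _ fg] := injF_bij finj.
exists (g (Ordinal (col_lt vv))) => //.
by have := congr1 val (fg (Ordinal (col_lt vv))).
Qed.

Definition col_asg (x : X) : bool := col (lit (x, true)) == col (pal 1).

Lemma lit_colour l : l.1 \in vars cls -> (col (lit l) == col (pal 0)) || (col (lit l) == col (pal 1)).
Proof.
move=> lv; have [[|[|i]] li E] := colour_pal (lit_mem lv); rewrite E ?eqxx ?orbT //.
have : col (lit l) != col (pal i.+2).
  apply: edge_neq; rewrite ?lit_mem ?pal_mem // !mem_cat; do 2!(apply/orP; right).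
  apply/orP; left; apply/allpairsP; exists (l, i.+2); split=> //; first exact: mem_lits.
  by rewrite mem_iota_sub.
by rewrite E eqxx.
Qed.

Lemma gad_colour3 c i : c \in cls -> i < 5 ->
  exists2 j, j < 3 & col (gad c i) = col (pal j).
Proof.
move=> cc i5; have [j lj E] := colour_pal (gad_mem cc i5); exists j => //.
rewrite ltnNge; apply/negP => j3; have : col (gad c i) != col (pal j).
  apply: edge_neq; rewrite ?gad_mem ?pal_mem // !mem_cat; do 3!(apply/orP; right).
  apply/orP; left; apply/allpairsP; exists (gad c i, j); split=> //; last by rewrite mem_iota_sub j3.
  by apply/allpairsP; exists (c, i); rewrite mem_iota.
by rewrite E eqxx.
Qed.

Lemma lit_holds l : l.1 \in vars cls -> ~~ holds col_asg l -> col (lit l) = col (pal 0).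
Proof.
case: l => x b /= xv; have := lit_colour (l := (x, b)) xv; have := lit_colour (l := (x, true)) xv.
have n01 : col (pal 1) != col (pal 0) by apply: pal_neq => //; apply: leq_trans k3.
rewrite /holds /col_asg /=; case: b => /=.
  by move=> _ /orP[/eqP-> //|->]; rewrite eqxx.
have ntf : col (lit (x, true)) != col (lit (x, false)).
  apply: edge_neq; rewrite ?lit_mem // !mem_cat; apply/orP; right; apply/orP; left.
  by apply: (map_f (fun x => [:: lit (x, true); lit (x, false)])).
move=> _ /orP[/eqP//|/eqP Ef]; rewrite eqbF_neg negbK => /eqP Et.
by rewrite Et Ef eqxx in ntf.
Qed.

Lemma col_asg_sat : all (sat col_asg) cls.
Proof.
apply/allP => c cc; apply/negPn; rewrite /sat !negb_or; apply/negP.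
case/and4P=> /lit_holds H1 /lit_holds H2 /lit_holds H3 /lit_holds H4.
have V x : x \in [:: c.1.1.1; c.1.2.1; c.2.1.1; c.2.2.1] -> x \in vars cls.
  by move=> xc; apply/flatten_mapP; exists c.
have e u v : [:: u; v] \in gadget c -> u \in graph_vs k cls -> v \in graph_vs k cls ->
    col u != col v.
  move=> uv uu vv; apply: edge_neq => //; rewrite !mem_cat; do 4!(apply/orP; right).
  by apply/flatten_mapP; exists c.
have G i : i < 5 -> gad c i \in graph_vs k cls by apply: gad_mem.
have L l : l.1 \in [:: c.1.1.1; c.1.2.1; c.2.1.1; c.2.2.1] -> lit l \in graph_vs k cls.
  by move=> /V; apply: lit_mem.
have P0 : pal 0 \in graph_vs k cls by apply: pal_mem; apply: leq_trans k3.
have n0 : [/\ col (gad c 0) != col (pal 0), col (gad c 1) != col (pal 0),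
   col (gad c 2) != col (pal 0), col (gad c 3) != col (pal 0) & col (gad c 4) != col (pal 0)].
  split; [|rewrite -H1|rewrite -H2|rewrite -H3|rewrite -H4]; rewrite ?V ?e ?G ?L ?P0 ?inE ?eqxx ?orbT //.
have n1 : [/\ col (gad c 0) != col (gad c 1), col (gad c 1) != col (gad c 2),
   col (gad c 2) != col (gad c 3), col (gad c 3) != col (gad c 4) & col (gad c 4) != col (gad c 0)].
  by split; rewrite ?e ?G ?inE ?eqxx ?orbT.
have J i : i < 5 -> col (gad c i) != col (pal 0) ->
    (col (gad c i) == col (pal 1)) || (col (gad c i) == col (pal 2)).
  move=> i5 ni; have [[|[|[|]]] // _ E] := gad_colour3 cc i5; rewrite E ?eqxx ?orbT // in ni *.
case: n0 => /(J 0 isT) + /(J 1 isT) + /(J 2 isT) + /(J 3 isT) + /(J 4 isT).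
case: n1; move: (col (gad c 0)) (col (gad c 1)) (col (gad c 2)) (col (gad c 3)) (col (gad c 4)).
move=> g0 g1 g2 g3 g4; move: (col (pal 1)) (col (pal 2)) => p q.
move=> n01 n12 n23 n34 n40.
(* In each of the 32 distributions of two colours on the 5-cycle, some edge is monochromatic. *)
case/orP=> /eqP E0; case/orP=> /eqP E1; case/orP=> /eqP E2; case/orP=> /eqP E3; case/orP=> /eqP E4;
  subst; by rewrite ?eqxx in n01 n12 n23 n34 n40.
Qed.

End Sound.

(** * From a satisfying assignment to a colouring *)

Section Complete.
Variables (k : nat) (cls : seq (clause X)) (asg : X -> bool).
Hypothesis k3 : 3 <= k.
Hypothesis sat_cls : all (sat asg) cls.

Definition spokes (c : clause X) : seq nat :=
  [:: 0; holds asg c.1.1 : nat; holds asg c.1.2 : nat; holds asg c.2.1 : nat; holds asg c.2.2 : nat].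

Definition sat_col (v : cvertex X) : nat :=
  match v with
  | inl i => i
  | inr (inl l) => holds asg l
  | inr (inr (c, i)) => nth 0 (gad_colour (spokes c)) i
  end.

Lemma spokesP c : c \in cls -> gad_ok (spokes c) (gad_colour (spokes c)).
Proof. by move=> /(allP sat_cls); apply: gad_colourP. Qed.

Lemma gad_lt3 c i : c \in cls -> i < 5 -> nth 0 (gad_colour (spokes c)) i < 3.
Proof. by move=> /spokesP/and4P[/all_nthP H /eqP s5 _ _] i5; apply: H; rewrite s5. Qed.

Lemma sat_colourable : colourable k (graph_vs k cls) (graph_es k cls).
Proof.
exists sat_col.
  move=> v; rewrite mem_undup !mem_cat => /or3P[/mapP[i]|/mapP[l _ ->]|/allpairsP[[c i] [cc]]].
  - by rewrite mem_iota add0n => li ->.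
  - by apply: leq_trans k3; rewrite /=; case: (holds _ _).
  - by rewrite mem_iota add0n => li -> /=; apply: leq_trans (gad_lt3 cc li) k3.
pose P (q : seq (cvertex X)) : Prop := if q is [:: a; b] then sat_col a != sat_col b else True.
suff H p : p \in graph_es k cls -> P p.
  by move=> u v _ _ /orP[/H//|/H]; rewrite /P /= eq_sym.
apply: graph_es_ind => {p} [i j lt _|x _|l j l2 lk|c i j cc i5 j3 jk|c p cc].
- by rewrite /P /= neq_ltn lt orbT.
- by rewrite /P /= /holds /=; case: (asg x).
- by rewrite /P /=; case: (holds _ _); rewrite /= neq_ltn (leq_trans _ l2).
- by rewrite /P /= neq_ltn (leq_trans (gad_lt3 cc i5) j3).
case/and4P: (spokesP cc) => _ _ /and5P[? ? ? ? /andP[? _]] /and5P[? ? ? ? /andP[? _]].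
by rewrite !inE; do ![case/orP=> [/eqP->|] //=] => /eqP->.
Qed.

End Complete.

Theorem clause_graph_correct k cls : 3 <= k ->
  colourable k (graph_vs k cls) (graph_es k cls) <-> exists asg, all (sat asg) cls.
Proof.
move=> k3; split; last by case=> asg; apply: sat_colourable.
by case=> col c1 c2; exists (col_asg col); apply: col_asg_sat c1 c2.
Qed.

End ClauseGraph.

Lemma FPt_clause_word (X : eqType) (E : Type) {eX : Enc X} {eE : Enc E} k (cls : E -> seq (clause X)) :
  FPt cls -> FPt (fun e => colour_word (graph_vs k (cls e)) (graph_es k (cls e))).
Proof.
move=> Fc; apply: FPt_colour_word.
  by rewrite /graph_vs /gads /lits /vars /pal /lit /gad /clause /cvertex; fpt.
by rewrite /graph_es /gadget /gads /lits /vars /pal /lit /gad /clause /cvertex; fpt.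
Qed.

Theorem clause_word_correct (X : eqType) k (cls : seq (clause X)) : 3 <= k ->
  CombDMR k (colour_word (graph_vs k cls) (graph_es k cls)) <-> exists asg, all (sat asg) cls.
Proof.
move=> k3; rewrite -(clause_graph_correct cls k3); apply: colour_word_correct.
  exact: undup_uniq.
exact: graph_noloop.
Qed.

(** * The tableau of a computation *)

Section Tableau.
Variable M : TM.

Definition cell : Type := (option 'I_(tm_n M).+3 * 'I_3)%type.

(* Row [t + 1] is shifted by one place against row [t], so that its cell [i] depends on the
   cells [i], [i + 1] and [i + 2] of row [t] and no cell needs a left neighbour outside the row. *)
Definition cell_at (c : config M) (h i : nat) : cell :=
  let: (q, l, r) := c in
  (if i == h then Some q else None, if i < h then nth blank l (h - i).-1 else nth blank r (i - h)).

Definition out_move (a : cell) : option ('I_(tm_n M).+3 * 'I_3 * bool) :=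
  if a.1 is Some q then if halting q then None else Some (tm_delta q a.2) else None.

Definition enters (dir : bool) (a : cell) : option 'I_(tm_n M).+3 :=
  if out_move a is Some (q, _, mv) then if mv == dir then Some q else None else None.

Definition next_cell (a b c : cell) : cell :=
  match out_move b with
  | Some (_, s, _) => (None, s)
  | None =>
    match b.1 with
    | Some q => b
    | None => (if enters true a is Some q then Some q else enters false c, b.2)
    end
  end.

(** The shift of the rows lowers every index by one. Combined with the move of the head this gives
    [h] for a move to the right, [h - 2] for one to the left and [h.-1] after halting. *)
Definition hstep (c : config M * nat) : config M * nat :=
  let: (q, l, r, h) := c in
  (step (q, l, r),
   if halting q then h.-1 else if (tm_delta q (head blank r)).2 then h else h - 2).

Lemma nth_behead (T : Type) (x : T) s i : nth x (behead s) i = nth x s i.+1.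
Proof. by case: s => //=; rewrite nth_nil. Qed.

Ltac nat_tests := repeat match goal with
  | |- context [?a == ?b] =>
    first [rewrite (_ : (a == b) = true); last by lia | rewrite (_ : (a == b) = false); last by lia]
  | |- context [leq ?a ?b] =>
    first [rewrite (_ : leq a b = true); last by lia | rewrite (_ : leq a b = false); last by lia]
  end.

Ltac nat_index := repeat match goal with
  | |- context [nth _ _ ?n] =>
    lazymatch n with predn _ => idtac | subn _ _ => idtac end;
    first
      [ rewrite (_ : n = 0); last by lia | rewrite (_ : n = 1); last by lia
      | rewrite (_ : n = 2); last by lia
      | match goal with d : nat |- _ => first
          [ rewrite (_ : n = d); last by lia | rewrite (_ : n = d.+1); last by lia
          | rewrite (_ : n = d.+2); last by lia | rewrite (_ : n = d.+3); last by lia ] end ]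
  end.

Lemma next_cellP c h i : 2 <= h ->
  cell_at (hstep (c, h)).1 (hstep (c, h)).2 i =
  next_cell (cell_at c h i) (cell_at c h i.+1) (cell_at c h i.+2).
Proof.
case: c => [[q l] r]; case: h => [|[|h]] // _.
have hr : head blank r = nth blank r 0 by rewrite nth0.
(* The head stands at [h.+2]: the window of three cells lies left of it, meets it in its last,
   middle or first cell, or lies right of it. *)
have pos : (exists d, h = (i + d).+1) \/ i = h \/ i = h.+1 \/ i = h.+2 \/ exists d, i = (h + d).+3.
  have [lt|gt|->] := ltngtP i h; first by left; exists (h - i).-1; lia.
    have [lt|gt2|->] := ltngtP i h.+2; last by do 3!right; left.
      by do 2!right; left; lia.
    by do 4!right; exists (i - h.+3); lia.
  by right; left.
rewrite /hstep /step hr.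
case: (boolP (halting q)) => hq; last case E: (tm_delta q (nth blank r 0)) => [[q' s] [|]];
  case: pos => [[d ->]|[->|[->|[->|[d ->]]]]]; rewrite /next_cell /out_move /enters /cell_at /=; nat_tests;
  rewrite /out_move /= ?subnn ?hq ?(negPf hq) ?E /= ?hq ?(negPf hq) ?E /=;
  nat_index; rewrite /= ?nth_behead ?nth0 //.
Qed.

Definition cell_code (a : cell) : nat := enum_rank a.

Lemma cell_code_inj : injective cell_code.
Proof. by move=> a b /val_inj/enum_rank_inj. Qed.

Definition start : 'I_(tm_n M).+3 := @Ordinal (tm_n M).+3 0 isT.

Definition tab (h0 : nat) (z : seq bool) (t : nat) : config M * nat :=
  iter t hstep (init M z, h0).

Lemma tab_run h0 z t : (tab h0 z t).1 = run M t z.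
Proof.
rewrite /run; elim: t => //= t <-; by case: (tab h0 z t) => [[[q l] r] h].
Qed.

Lemma tab_head h0 z t : (tab h0 z t).2 <= h0 <= (tab h0 z t).2 + 2 * t.
Proof.
elim: t => [|t IH]; first by rewrite muln0 addn0 leqnn.
rewrite /tab iterS -/(tab h0 z t); case: (tab h0 z t) IH => [[[q l] r] h] /=.
by case: ifP => _; [lia | case: ifP => _; lia].
Qed.

End Tableau.

(** * Clauses describing the computations of a verifier *)

Section Clauses.
Variables (M : TM) (c d c' d' : nat).
Local Notation var := (nat * (nat * nat))%type.
Local Notation cell := (cell M).
Local Notation cc := (@cell_code M).

Definition head_cell (b : bool) : cell := (Some (start M), sym_of_bit b).
Definition bit_cell (b : bool) : cell := (None, sym_of_bit b).
Definition blank_cell : cell := (None, blank).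

Definition rules : seq ((nat * nat) * (nat * nat)) :=
  [seq (cc p.1.1, cc p.1.2, (cc p.2, cc (next_cell p.1.1 p.1.2 p.2))) |
    p <- enum {: cell * cell * cell}].

Definition rejecting : seq nat :=
  [seq cc a | a <- enum {: cell} & if a.1 is Some q then val q == 2 else false].

Definition certs (x : seq bool) : nat := poly c' d' (size x).
Definition prefix_word (x : seq bool) : seq bool := double_bits x ++ [:: false; true].
(** The clock at the longest admissible input; with a shorter certificate the machine stops earlier
    and its configuration persists. *)
Definition time (x : seq bool) : nat := poly c d (size (prefix_word x) + certs x).
(* The head index drops by at most two from a row to the next and must stay at least two. *)
Definition origin (x : seq bool) : nat := 2 * time x + 2.
Definition guess (x : seq bool) : nat := origin x + size (prefix_word x).
(** Windows reach two cells ahead, so each row loses two cells on the right. The trailing blanks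
    ensure that the head, never beyond [origin], is still covered in the last row. *)
Definition width (x : seq bool) : nat := guess x + certs x + (2 * time x + 1).

Definition pos (v : var) : var * bool := (v, true).
Definition neg (v : var) : var * bool := (v, false).
Definition fact (v : var) : clause var := ((pos v, pos v), (pos v, pos v)).

(** Blanks propagate to the right in the guessed zone, which admits shorter certificates. The nested
    conditionals keep [cell_code] applied to constants only, so no program for it is required. *)
Definition input_clauses (x : seq bool) : seq (clause var) :=
  [seq fact (0, (i, cc blank_cell)) | i <- iota 0 (origin x)] ++
  [seq fact (0, (origin x + j,
     if j == 0 then if nth false (prefix_word x) j then cc (head_cell true) else cc (head_cell false)
     else if nth false (prefix_word x) j then cc (bit_cell true) else cc (bit_cell false))) |
     j <- iota 0 (size (prefix_word x))] ++
  [seq ((pos (0, (guess x + j, cc (bit_cell false))), pos (0, (guess x + j, cc (bit_cell true)))),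
        (pos (0, (guess x + j, cc blank_cell)), pos (0, (guess x + j, cc blank_cell)))) |
     j <- iota 0 (certs x)] ++
  [seq ((neg (0, (guess x + j, cc blank_cell)), neg (0, (guess x + j, cc blank_cell))),
        (pos (0, ((guess x + j).+1, cc blank_cell)), pos (0, ((guess x + j).+1, cc blank_cell)))) |
     j <- iota 0 (certs x)] ++
  [seq fact (0, (guess x + certs x + j, cc blank_cell)) | j <- iota 0 (2 * time x + 1)].

Definition step_clause (t i : nat) (r : (nat * nat) * (nat * nat)) : clause var :=
  ((neg (t, (i, r.1.1)), neg (t, (i.+1, r.1.2))), (neg (t, (i.+2, r.2.1)), pos (t.+1, (i, r.2.2)))).

Definition never (v : var) : clause var := ((neg v, neg v), (neg v, neg v)).

Definition clauses (x : seq bool) : seq (clause var) :=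
  input_clauses x ++
  flatten [seq [seq step_clause t i r | i <- iota 0 (width x), r <- rules] | t <- iota 0 (time x)] ++
  flatten [seq [seq never (t, (i, a)) | i <- iota 0 (width x), a <- rejecting] |
    t <- iota 0 (time x).+1].

Lemma FPt_clauses : FPt clauses.
Proof.
have Fw : FPt prefix_word by rewrite /prefix_word; fpt.
have Fc : FPt certs by rewrite /certs; fpt.
have Ft : FPt time by rewrite /time; fpt.
have Fo : FPt origin by rewrite /origin; fpt.
have Fg : FPt guess by rewrite /guess; fpt.
have FW : FPt width by rewrite /width; fpt.
rewrite /clauses /input_clauses /step_clause /never /fact /pos /neg /clause; fpt.
Qed.

Lemma all_iota (P : nat -> bool) n : all P (iota 0 n) <-> forall i, i < n -> P i.
Proof.
split=> [/allP H i lt|H]; first by apply: H; rewrite mem_iota.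
by apply/allP => i; rewrite mem_iota add0n => /andP[_]; apply: H.
Qed.

Lemma sat_fact asg v : sat asg (fact v) = asg v.
Proof. by rewrite /sat /holds /= !eqb_id !orbb. Qed.

Lemma sat_never asg v : sat asg (never v) = ~~ asg v.
Proof. by rewrite /sat /holds /= !eqbF_neg !orbb. Qed.

Lemma clausesP asg x : all (sat asg) (clauses x) <->
  all (sat asg) (input_clauses x) /\
  (forall t i a b e, t < time x -> i < width x ->
     asg (t, (i, cc a)) -> asg (t, (i.+1, cc b)) -> asg (t, (i.+2, cc e)) ->
     asg (t.+1, (i, cc (next_cell a b e)))) /\
  (forall t i q s, t <= time x -> i < width x -> val q = 2 -> ~~ asg (t, (i, cc (Some q, s)))).
Proof.
rewrite /clauses all_cat [all _ (flatten _ ++ _)]all_cat; split.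
  case/and3P=> -> /allP H1 /allP H2; split=> //; split.
    move=> t i a b e lt li; have := H1 (step_clause t i (cc a, cc b, (cc e, cc (next_cell a b e)))).
    rewrite /sat /holds /= !eqbF_neg eqb_id => H A B Ee; move: H; rewrite A B Ee /=; apply.
    apply/flatten_mapP; exists t; first by rewrite mem_iota.
    apply/allpairsP; exists (i, (cc a, cc b, (cc e, cc (next_cell a b e)))); rewrite mem_iota; split=> //.
    by apply: (map_f _ (x := (a, b, e))); rewrite mem_enum.
  move=> t i q s lt li q2; rewrite -sat_never; apply: H2.
  apply/flatten_mapP; exists t; first by rewrite mem_iota.
  apply/allpairsP; exists (i, cc (Some q, s)); rewrite mem_iota; split=> //.
  by apply: map_f; rewrite mem_filter mem_enum /= q2.
case=> -> [H1 H2]; apply/and3P; split=> //; apply/allP => cl /flatten_mapP[t]; rewrite mem_iota add0n.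
  move=> lt /allpairsP[[i r] [/= + /mapP[[[a b] e] _ ->] ->]]; rewrite mem_iota add0n => li.
  rewrite /sat /holds /= !eqbF_neg eqb_id.
  case A: (asg _) => //=; case B: (asg _) => //=; case Ee: (asg (t, (i.+2, _))) => //=.
  exact: H1.
move=> lt /allpairsP[[i r] [/= + /mapP[[[q|] s]]]]; rewrite mem_filter //= mem_iota add0n => li.
by case/andP=> /eqP q2 _ -> ->; rewrite sat_never; apply: H2.
Qed.

Definition row0 (x y : seq bool) (i : nat) : cell := cell_at (init M (pair_words x y)) (origin x) i.

Lemma pair_words_cat x y : pair_words x y = prefix_word x ++ y.
Proof. by rewrite /pair_words /prefix_word -catA. Qed.

Lemma row0_left x y i : i < origin x -> row0 x y i = blank_cell.
Proof. by move=> lt; rewrite /row0 /= lt nth_nil ltn_eqF. Qed.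

Lemma nth_sym z j : nth blank (map sym_of_bit z) j = if j < size z then sym_of_bit (nth false z j) else blank.
Proof.
by case: ltnP => H; [rewrite (nth_map false) | rewrite nth_default ?size_map].
Qed.

Lemma row0_right x y j : row0 x y (origin x + j) =
  (if j == 0 then Some (start M) else None, nth blank (map sym_of_bit (prefix_word x ++ y)) j).
Proof.
rewrite /row0 pair_words_cat /cell_at /init; move: (origin x) => o.
have -> : (o + j < o) = false by lia.
have -> : (o + j == o) = (j == 0) by lia.
by rewrite addKn.
Qed.

Lemma size_prefix_word x : 1 < size (prefix_word x).
Proof. by rewrite size_cat addn2. Qed.

Lemma row0_prefix x y j : j < size (prefix_word x) -> row0 x y (origin x + j) =
  if j == 0 then head_cell (nth false (prefix_word x) j) else bit_cell (nth false (prefix_word x) j).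
Proof.
move=> lt; rewrite row0_right nth_sym size_cat ltn_addr // nth_cat lt.
by case: ifP.
Qed.

Lemma row0_guess x y j : row0 x y (guess x + j) =
  if j < size y then bit_cell (nth false y j) else blank_cell.
Proof.
have := size_prefix_word x => s2.
rewrite /guess -addnA row0_right nth_sym size_cat ltn_add2l nth_cat addKn.
have -> : (size (prefix_word x) + j < size (prefix_word x)) = false by lia.
have -> : (size (prefix_word x) + j == 0) = false by lia.
by case: ifP.
Qed.

Lemma inputP asg x : all (sat asg) (input_clauses x) <->
  (forall i, i < origin x -> asg (0, (i, cc blank_cell))) /\
  (forall j, j < size (prefix_word x) -> asg (0, (origin x + j, cc
     (if j == 0 then head_cell (nth false (prefix_word x) j) else bit_cell (nth false (prefix_word x) j))))) /\
  (forall j, j < certs x -> [|| asg (0, (guess x + j, cc (bit_cell false))),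
     asg (0, (guess x + j, cc (bit_cell true))) | asg (0, (guess x + j, cc blank_cell))]) /\
  (forall j, j < certs x -> asg (0, (guess x + j, cc blank_cell)) ->
     asg (0, ((guess x + j).+1, cc blank_cell))) /\
  (forall j, j < 2 * time x + 1 -> asg (0, (guess x + certs x + j, cc blank_cell))).
Proof.
have E3 (l1 l2 l3 : var) : sat asg ((pos l1, pos l2), (pos l3, pos l3)) = [|| asg l1, asg l2 | asg l3].
  by rewrite /sat /holds /= !eqb_id !orbb.
have E4 (l1 l2 : var) : sat asg ((neg l1, neg l1), (pos l2, pos l2)) = (asg l1 ==> asg l2).
  by rewrite /sat /holds /= !eqb_id !eqbF_neg !orbb implybE orbA orbb.
have sym_if (b b' : bool) (A C : bool -> cell) : (if b then if b' then cc (A true) else cc (A false) else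
    if b' then cc (C true) else cc (C false)) = cc (if b then A b' else C b') :> nat.
  by case: b; case: b'.
rewrite /input_clauses !all_cat !all_map; split.
  case/and5P=> /all_iota H1 /all_iota H2 /all_iota H3 /all_iota H4 /all_iota H5.
  split; first by move=> i /H1 /=; rewrite sat_fact.
  split; first by move=> j /H2 /=; rewrite sat_fact sym_if.
  split; first by move=> j /H3 /=; rewrite E3.
  split; first by move=> j /H4 /=; rewrite E4 => /implyP.
  by move=> j /H5 /=; rewrite sat_fact.
case=> H1 [H2 [H3 [H4 H5]]]; apply/and5P; split; apply/all_iota => j lt /=; rewrite ?sat_fact ?E3 ?E4.
- exact: H1.
- by rewrite sym_if; apply: H2.
- exact: H3.
- by apply/implyP; apply: H4.
- exact: H5.
Qed.

Lemma width_cases x i : i < width x ->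
  [\/ i < origin x, exists2 j, j < size (prefix_word x) & i = origin x + j,
      exists2 j, j < certs x & i = guess x + j |
      exists2 j, j < 2 * time x + 1 & i = guess x + certs x + j].
Proof.
rewrite /width => lt; have [|g1] := ltnP i (origin x); first by move=> ?; apply: Or41.
have [l2|g2] := ltnP i (guess x).
  by apply: Or42; exists (i - origin x); rewrite /guess in l2; lia.
have [l3|g3] := ltnP i (guess x + certs x).
  by apply: Or43; exists (i - guess x); lia.
by apply: Or44; exists (i - (guess x + certs x)); lia.
Qed.

Lemma input_sound asg x : all (sat asg) (input_clauses x) ->
  exists2 y, size y <= certs x & forall i, i < width x -> asg (0, (i, cc (row0 x y i))).
Proof.
case/inputP=> H1 [H2 [H3 [H4 H5]]].
(* The certificate ends at the first guessed cell where blank holds. Before it, a cell in which both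
   bits hold is read as [true]. *)
pose L := find (fun j => asg (0, (guess x + j, cc blank_cell))) (iota 0 (certs x)).
have leL : L <= certs x by rewrite -[X in _ <= X](size_iota 0) find_size.
pose y := [seq asg (0, (guess x + j, cc (bit_cell true))) | j <- iota 0 L].
have sy : size y = L by rewrite size_map size_iota.
have blankL j : L <= j -> j < certs x -> asg (0, (guess x + j, cc blank_cell)).
  elim: j => [|j IH] lj jc.
    have L0 : L = 0 by lia.
    have hs : has (fun j => asg (0, (guess x + j, cc blank_cell))) (iota 0 (certs x)).
      by rewrite has_find -/L L0 size_iota.
    by have := nth_find 0 hs; rewrite -/L L0 nth_iota.
  have [lt|le] := ltnP j L; last by rewrite addnS; apply: H4 (ltnW jc) (IH le (ltnW jc)).
  have EL : L = j.+1 by apply/eqP; rewrite eqn_leq lj lt.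
  have hs : has (fun j => asg (0, (guess x + j, cc blank_cell))) (iota 0 (certs x)).
    by rewrite has_find -/L EL size_iota.
  by have := nth_find 0 hs; rewrite -/L EL nth_iota.
exists y; first by rewrite sy.
move=> i /width_cases[lt|[j lt ->]|[j lt ->]|[j lt ->]].
- by rewrite row0_left //; apply: H1.
- by rewrite row0_prefix //; apply: H2.
- rewrite row0_guess sy; case: ltnP => [lL|le]; last exact: blankL.
  have nB : ~~ asg (0, (guess x + j, cc blank_cell)).
    have := before_find 0 (s := iota 0 (certs x)) (a := fun j => asg (0, (guess x + j, cc blank_cell))) lL.
    by rewrite nth_iota // add0n => ->.
  rewrite (nth_map 0) ?size_iota // nth_iota // add0n.
  have := H3 _ lt; rewrite (negPf nB) orbF; case E: (asg (0, (_, cc (bit_cell true)))) => //.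
  by rewrite orbF.
- rewrite -addnA row0_guess sy ifN; last by rewrite -leqNgt; lia.
  by rewrite addnA; apply: H5.
Qed.

Lemma input_complete asg x y : size y <= certs x ->
  (forall i a, asg (0, (i, cc a)) = (a == row0 x y i)) -> all (sat asg) (input_clauses x).
Proof.
move=> sy H; apply/inputP; do 4?[split].
- by move=> i lt; rewrite H row0_left.
- by move=> j lt; rewrite H row0_prefix.
- move=> j lt; rewrite !H row0_guess; case: ifP => _; last by rewrite eqxx !orbT.
  by case: (nth _ _ _); rewrite eqxx ?orbT.
- move=> j lt; rewrite !H -addnS !row0_guess; case: (ltnP j.+1 (size y)) => // l1.
  by rewrite (ltnW l1); case: (nth false y j).
- by move=> j lt; rewrite H -addnA row0_guess ifN // -leqNgt; lia.
Qed.

Hypothesis M_halts : forall z, halting (cstate (run M (poly c d (size z)) z)).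

Lemma run_later z t t' : halting (cstate (run M t z)) -> t <= t' -> run M t' z = run M t z.
Proof.
move=> H le; rewrite /run -(subnK le) iterD -/(run M t z).
elim: (t' - t) => //= n ->; move: H; rewrite /cstate.
by case: (run M t z) => [[q l] r] /= ->.
Qed.

Lemma time_ge x y : size y <= certs x -> poly c d (size (pair_words x y)) <= time x.
Proof. by move=> sy; apply: leq_poly; rewrite pair_words_cat size_cat leq_add2l. Qed.

Lemma cell_at_head (cf : config M) h : exists s, cell_at cf h h = (Some (cstate cf), s).
Proof. by case: cf => [[q l] r]; rewrite /= eqxx; eexists. Qed.

(** The true run on the certificate read off row 0 is traced through the assignment. At time
    [time x] its state is halting and cannot be the rejecting one. *)
Lemma clauses_sound asg x : all (sat asg) (clauses x) ->
  exists2 y, size y <= certs x & val (cstate (run M (poly c d (size (pair_words x y))) (pair_words x y))) = 1.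
Proof.
case/clausesP=> /input_sound[y sy R0] [RS RN]; exists y => //.
set z := pair_words x y; pose tb t := @tab M (origin x) z t.
have row t : t <= time x -> forall i, i + 2 * t < width x ->
    asg (t, (i, cc (cell_at (tb t).1 (tb t).2 i))).
  elim: t => [|t IH] lt i li; first by apply: R0; rewrite muln0 addn0 in li.
  have := @tab_head M (origin x) z t => /andP[_ hh].
  have E : tb t.+1 = hstep ((tb t).1, (tb t).2) by rewrite -surjective_pairing.
  rewrite E next_cellP; last by rewrite /tb; move: hh; rewrite {1}/origin; lia.
  by apply: RS; rewrite ?IH //; lia.
have hT := M_halts z; have le := time_ge sy.
have ET := run_later hT le; rewrite -ET in hT *.
have [s Es] := cell_at_head (tb (time x)).1 (tb (time x)).2.
have /andP[hle _] := @tab_head M (origin x) z (time x).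
have lw : (tb (time x)).2 + 2 * time x < width x.
  by apply: (@leq_ltn_trans (origin x + 2 * time x)); [rewrite leq_add2r | rewrite /width /guess; lia].
have := row _ (leqnn _) _ lw; rewrite Es => A.
have := RN (time x) (tb (time x)).2 (cstate (tb (time x)).1) s (leqnn _).
rewrite A => /(_ (leq_ltn_trans (leq_addr _ _) lw)); rewrite /tb tab_run => N.
by move: hT; rewrite /halting => /orP[/eqP//|/eqP/N].
Qed.

Lemma clauses_complete x y : size y <= certs x ->
  val (cstate (run M (poly c d (size (pair_words x y))) (pair_words x y))) = 1 ->
  exists asg, all (sat asg) (clauses x).
Proof.
set z := pair_words x y => sy acc; pose tb t := @tab M (origin x) z t.
pose asg (v : var) := v.2.2 == cc (cell_at (tb v.1).1 (tb v.1).2 v.2.1).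
have aE t i a : asg (t, (i, cc a)) = (a == cell_at (tb t).1 (tb t).2 i).
  by rewrite /asg /= (inj_eq (@cell_code_inj M)).
exists asg; apply/clausesP; split; first by apply: (input_complete sy) => i a; rewrite aE.
split.
  move=> t i a b e lt _; rewrite !aE => /eqP-> /eqP-> /eqP->; apply/eqP.
  have := @tab_head M (origin x) z t => /andP[_ hh].
  have E : tb t.+1 = hstep ((tb t).1, (tb t).2) by rewrite -surjective_pairing.
  by rewrite E next_cellP // /tb; move: hh; rewrite {1}/origin; lia.
move=> t i q s lt _ q2; rewrite aE; apply/negP => /eqP.
rewrite /tb tab_run; case E: (run M t z) => [[q' l] r] /= [].
case: ifP => // _ [Eq] _.
have ht : halting (cstate (run M t z)) by rewrite E /cstate /= -Eq /halting q2.
(* Halted states persist, so rejecting in row [t] contradicts accepting at time [P], whichever comes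
   first. *)
set P := poly _ _ _ in acc; have hP := M_halts z; rewrite -/P in hP.
case: (leqP t P) => [le|/ltnW le].
  by rewrite (run_later ht le) E /cstate /= -Eq q2 in acc.
by move: E; rewrite (run_later hP le) => E; rewrite E /cstate /= -Eq q2 in acc.
Qed.

End Clauses.

Theorem CombDMR_NP_hard k : 3 <= k -> NP_hard (CombDMR k).
Proof.
move=> k3 L' [V [[M [c [d HM]]] [c' [d' HL]]]].
pose cl := @clauses M c d c' d'.
exists (fun x => colour_word (graph_vs k (cl x)) (graph_es k (cl x))); split.
  by apply: FPt_FP; apply: FPt_clause_word; apply: FPt_clauses.
have halts z : halting (cstate (run M (poly c d (size z)) z)) by case: (HM z).
move=> x; rewrite clause_word_correct //; split.
  case/HL=> y [sy Vy]; apply: (clauses_complete halts sy).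
  by case: (HM (pair_words x y)) => _ ->.
case=> asg /(clauses_sound halts)[y sy acc]; apply/HL; exists y; split=> //.
by case: (HM (pair_words x y)) => _ <-.
Qed.

Theorem mainTheorem1 : forall k : nat, 3 <= k -> NP_complete (CombDMR k).
Proof. by move=> k k3; split; [apply: CombDMR_NP | apply: CombDMR_NP_hard]. Qed.
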